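(* Let $S$ be a set of $n$ points in the plane, $P$ a simple polygon with $m$ vertices, and $\ell$ a line segment in the plane. The Segment-restricted MCR problem, namely finding a point $r$ on $\ell$ and an angle $\theta\in[0,2\pi)$ such that, after rotating $P$ clockwise around $r$ by $\theta$, the number of points of $S$ contained in $P$ is maximized (over all choices of $r\in\ell$ and $\theta$), can be solved in $O(n^2m^2\log(nm))$ time and $O(n^2m^2)$ space.
   Context: A simple polygon $P$ is understood as the closed planar region bounded by it. Time and space are worst-case in the usual real-RAM model of computational geometry (exact real arithmetic and elementary geometric operations, including computing the real roots of polynomials of bounded degree, at unit cost). *)

(* Defs.v *)
From HB Require Import structures.
From mathcomp Require Import all_boot all_order all_algebra.
From mathcomp Require Import all_classical all_reals all_analysis.
From mathcomp Require polyrcf.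

Set Implicit Arguments.
Unset Strict Implicit.
Unset Printing Implicit Defensive.

Import Order.TTheory GRing.Theory Num.Theory.
Import numFieldNormedType.Exports.

Local Open Scope classical_set_scope.
Local Open Scope ring_scope.

(** * Geometry *)

Definition segment (R : realType) (a b : R * R) : set (R * R) :=
  [set (a.1 + t * (b.1 - a.1), a.2 + t * (b.2 - a.2)) | t in `[0, 1]].

(* A polygon is given by its cyclic sequence of vertices, in either
   orientation; edge [i] joins vertex [i] to vertex [i+1 mod m]. *)
Definition edge (R : realType) (P : seq (R * R)) (i : nat) : set (R * R) :=
  segment P`_i P`_(i.+1 %% size P).

Definition boundary (R : realType) (P : seq (R * R)) : set (R * R) :=
  \bigcup_(i in [set i | (i < size P)%N]) edge P i.

(* Each edge meets the next one in their common vertex only, and edges that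
   are not cyclically consecutive are disjoint. *)
Definition simple_polygon (R : realType) (P : seq (R * R)) : Prop :=
  [/\ (3 <= size P)%N, uniq P,
      (forall i, (i < size P)%N ->
         edge P i `&` edge P (i.+1 %% size P) = [set P`_(i.+1 %% size P)])
    & (forall i j, (i < size P)%N -> (j < size P)%N -> i != j ->
         j != (i.+1 %% size P)%N -> i != (j.+1 %% size P)%N ->
         edge P i `&` edge P j = set0)].

(* The closed region bounded by [P]: the boundary together with the bounded
   components of its complement. *)
Definition region (R : realType) (P : seq (R * R)) : set (R * R) :=
  boundary P `|`
  [set x | (~` boundary P) x /\
           bounded_set (connected_component (~` boundary P) x)].

Definition rotate_cw (R : realType) (r : R * R) (theta : R) (x : R * R) :
    R * R :=
  (r.1 + (cos theta * (x.1 - r.1) + sin theta * (x.2 - r.2)),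
   r.2 + (cos theta * (x.2 - r.2) - sin theta * (x.1 - r.1))).

(* Number of points of [S] contained in the rotated polygon. *)
Definition contained (R : realType) (S P : seq (R * R)) (r : R * R)
    (theta : R) : nat :=
  count (fun s => `[< (rotate_cw r theta @` region P) s >]) S.

Definition segment_MCR_solution (R : realType) (S P : seq (R * R))
    (a b r : R * R) (theta : R) : Prop :=
  [/\ segment a b r, 0 <= theta < 2 * pi &
      forall r' theta', segment a b r' -> 0 <= theta' < 2 * pi ->
        (contained S P r' theta' <= contained S P r theta)%N].

(** * Real RAM *)

(* The memory is a bank of integer cells and a bank of real cells. Programs
   are finite and do not mention [R]: they are uniform in the input. A cell is
   designated by a constant address or by the content of the integer cell at a
   constant address (indirect addressing). *)
Variant loc := Dir of nat | Ind of nat.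

(* [ISub] is truncated. *)
Variant iop := IAdd | ISub | IMul | IDiv | IMod.
Variant rop := RAdd | RSub | RMul | RDiv.

Variant instr :=
  | IConst of loc & nat
  | IMove of loc & loc
  | IBin of iop & loc & loc & loc
  | RConst of loc & nat
  | RMove of loc & loc
  | RBin of rop & loc & loc & loc
  | RAcos of loc & loc
  (* [RRoots d cnt dst src]: [src] locates the first of the d+1 consecutive
     real cells that hold the coefficients, constant term first. The distinct
     real roots are written in increasing order from [dst] on, and their number
     in the integer cell [cnt]. As [d] is part of the program text, each program
     only solves equations of bounded degree. *)
  | RRoots (d : nat) (cnt dst src : loc).

Variant test :=
  | ILt of loc & loc | IEq of loc & loc | RLt of loc & loc | REq of loc & loc.

Inductive com :=
  | Skip
  | Do of instr
  | Seq of com & com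
  | If of test & com & com
  | While of test & com.

Record state (R : realType) :=
  State { imem : nat -> nat ; rmem : nat -> R }.

(* The machine has [M] integer cells and [M] real cells, and its integers are
   smaller than [W]. Out-of-range addresses, integer overflow, division of a
   real by 0, [acos] outside [-1, 1] and solving the equation 0 = 0 are faults
   ([None]). *)
Definition addr (R : realType) (M : nat) (s : state R) (x : loc) :
    option nat :=
  match x with
  | Dir k => if (k < M)%N then Some k else None
  | Ind k => if (k < M)%N && (imem s k < M)%N then Some (imem s k) else None
  end.

Definition iget (R : realType) (M : nat) (s : state R) (x : loc) : option nat :=
  omap (imem s) (addr M s x).

Definition rget (R : realType) (M : nat) (s : state R) (x : loc) : option R :=
  omap (rmem s) (addr M s x).

Definition iset (R : realType) (M W : nat) (s : state R) (x : loc) (v : nat) :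
    option (state R) :=
  if (v < W)%N then
    omap (fun i => State (fun j => if j == i then v else imem s j) (rmem s))
         (addr M s x)
  else None.

Definition rset (R : realType) (M : nat) (s : state R) (x : loc) (v : R) :
    option (state R) :=
  omap (fun i => State (imem s) (fun j => if j == i then v else rmem s j))
       (addr M s x).

Definition iop_eval (o : iop) (u v : nat) : nat :=
  match o with
  | IAdd => u + v
  | ISub => u - v
  | IMul => u * v
  | IDiv => u %/ v
  | IMod => u %% v
  end%N.

Definition rop_eval (R : realType) (o : rop) (u v : R) : option R :=
  match o with
  | RAdd => Some (u + v)
  | RSub => Some (u - v)
  | RMul => Some (u * v)
  | RDiv => if v == 0 then None else Some (u / v)
  end.

Definition roots_eval (R : realType) (M W d : nat) (cnt dst src : loc)
    (s : state R) : option (state R) :=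
  match addr M s dst, addr M s src with
  | Some i, Some j =>
    let p := \poly_(k < d.+1) rmem s (j + k)%N in
    let rs := polyrcf.rootsR p in
    if [&& p != 0, (j + d < M)%N & (i + size rs <= M)%N] then
      iset M W
        (State (imem s) (fun k => if (i <= k < i + size rs)%N then rs`_(k - i)
                                  else rmem s k))
        cnt (size rs)
    else None
  | _, _ => None
  end.

Definition instr_eval (R : realType) (M W : nat) (c : instr) (s : state R) :
    option (state R) :=
  match c with
  | IConst x v => iset M W s x v
  | IMove x y => obind (iset M W s x) (iget M s y)
  | IBin o x y z =>
    match iget M s y, iget M s z with
    | Some u, Some v => iset M W s x (iop_eval o u v)
    | _, _ => None
    end
  | RConst x v => rset M s x v%:R
  | RMove x y => obind (rset M s x) (rget M s y)
  | RBin o x y z =>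
    match rget M s y, rget M s z with
    | Some u, Some v => obind (rset M s x) (rop_eval o u v)
    | _, _ => None
    end
  | RAcos x y =>
    match rget M s y with
    | Some v => if -1 <= v <= 1 then rset M s x (acos v) else None
    | None => None
    end
  | RRoots d cnt dst src => roots_eval M W d cnt dst src s
  end.

Definition test_eval (R : realType) (M : nat) (b : test) (s : state R) :
    option bool :=
  match b with
  | ILt x y =>
    match iget M s x, iget M s y with
    | Some u, Some v => Some (u < v)%N
    | _, _ => None
    end
  | IEq x y =>
    match iget M s x, iget M s y with
    | Some u, Some v => Some (u == v)
    | _, _ => None
    end
  | RLt x y =>
    match rget M s x, rget M s y with
    | Some u, Some v => Some (u < v)
    | _, _ => None
    end
  | REq x y =>
    match rget M s x, rget M s y with
    | Some u, Some v => Some (u == v)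
    | _, _ => None
    end
  end.

(* [exec M W c s t s']: started in [s], the program [c] halts without fault in
   [s'] after [t] steps, each instruction and each test being one step. *)
Inductive exec (R : realType) (M W : nat) :
    com -> state R -> nat -> state R -> Prop :=
  | ExecSkip s : exec M W Skip s 0 s
  | ExecDo c s s' : instr_eval M W c s = Some s' -> exec M W (Do c) s 1 s'
  | ExecSeq c1 c2 s s' s'' t1 t2 :
      exec M W c1 s t1 s' -> exec M W c2 s' t2 s'' ->
      exec M W (Seq c1 c2) s (t1 + t2) s''
  | ExecIf b c1 c2 s s' v t :
      test_eval M b s = Some v -> exec M W (if v then c1 else c2) s t s' ->
      exec M W (If b c1 c2) s t.+1 s'
  | ExecWhileFalse b c s :
      test_eval M b s = Some false -> exec M W (While b c) s 1 s
  | ExecWhileTrue b c s s' s'' t1 t2 :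
      test_eval M b s = Some true ->
      exec M W c s t1 s' -> exec M W (While b c) s' t2 s'' ->
      exec M W (While b c) s (t1 + t2).+1 s''.

(* Integer cells 0 and 1 hold the numbers of points and of vertices; the real
   cells hold the coordinates of the endpoints of the segment, of the points
   and of the vertices, in this order; all other cells hold 0. *)
Definition input_state (R : realType) (S P : seq (R * R)) (a b : R * R) :
    state R :=
  State (nth 0%N [:: size S; size P])
        (nth 0 (flatten [seq [:: x.1; x.2] | x <- [:: a; b] ++ S ++ P])).

(* The output is in real cells 0, 1 (the point) and 2 (the angle). *)
Definition output_point (R : realType) (s : state R) : R * R :=
  (rmem s 0, rmem s 1).

Definition output_angle (R : realType) (s : state R) : R := rmem s 2.

(* Main.v *)
Require Import Defs.
From mathcomp Require Import all_boot all_order all_algebra.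
From mathcomp Require Import all_classical all_reals all_analysis.
From mathcomp Require Import zify ring lra.
From mathcomp Require polyrcf.

(** A configuration is a rotation of angle theta about the point a + t d of the
    segment. For fixed theta, all images of the points of S move with the same
    velocity as t varies. Decrease t from an arbitrary configuration: as long as
    no image crosses the line of an edge transversally, membership in the closed
    polygon does not change, since an image that slides along an edge reaches a
    vertex only where the next edge continues in the same direction. Hence the
    optimum is attained at t = 0, at theta = pi, or when some point lies on the
    line of some edge and this contact is transversal. With u = tan (theta / 2),
    these configurations form nm + 2 curves that are rational in u.

    On one curve, the position of each point with respect to each edge changes
    only at the roots of 8 polynomials of degree at most 4. After sorting these
    O(nm) events, a sweep maintains, for each point, the number of edges that
    contain it or are crossed by its rightward ray, and thus the number of
    points in the polygon, in O(nm log (nm)) time per curve.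

    Points off the boundary are located by the parity of the crossed edges. An
    odd point has a bounded component because parity is locally constant. For an
    even point x, follow the horizontal line through x: the first edge met from x
    and the first edge met from infinity are joined by walking along one side of
    the polygon, and if the sides differed, x and a point at infinity would lie on
    the two sides of a common edge, hence have opposite parities. *)

(** Nothing is assumed about the position of the points: they may lie on lines of edges, move
    parallel to edges or not move at all, and many contacts may coincide. So the state of a point
    with respect to an edge is read off the signs of polynomials, of which an identically zero one
    never changes sign, and the sweep examines each event value itself as well as a value between
    consecutive events. The slide can stop at a contact because the polygon is closed: a point that
    is inside just before the contact is still inside at the contact, so no point is lost. The
    half-angle parameter misses theta = pi, which therefore has a curve of its own. All curves reuse
    the same arrays, with O(nm) entries each. As the machine faults on overflow, bad addresses and
    undefined operations, the array programs carry side conditions along with their specifications,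
    and a time budget that is consumed as they run; only the final estimates look at the shape of
    the costs. *)

Set Implicit Arguments.
Unset Strict Implicit.
Unset Printing Implicit Defensive.

Import Order.TTheory GRing.Theory Num.Theory.
Import numFieldNormedType.Exports.

Local Open Scope classical_set_scope.
Local Open Scope ring_scope.

(** * Compilation of array programs to the real RAM *)

(* The scratch cells, and the number of arrays; locked because conversion would
   otherwise compute with unary numerals. *)
Definition tmp : nat := locked 128%N.
Definition nids : nat := locked 64%N.

Lemma tmpE : tmp = 128%N. Proof. by rewrite /tmp -lock. Qed.

Lemma nidsE : nids = 64%N. Proof. by rewrite /nids -lock. Qed.

Lemma nids_tmp : (nids < tmp)%N. Proof. by rewrite nidsE tmpE. Qed.

(* Expressions and commands over a memory made of arrays: [EV a e] is the entry
   [e] of the integer array [a]. *)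
Inductive iexp :=
  | EN of nat
  | EV of nat & iexp
  | EB of iop & iexp & iexp
  | EL of iexp & iexp
  | EE of iexp & iexp.

Inductive rexp :=
  | RN of nat
  | RV of nat & iexp
  | RB of rop & rexp & rexp
  | RA of rexp.

Inductive xexp :=
  | XI of iexp
  | XL of rexp & rexp
  | XE of rexp & rexp
  | XB of iop & xexp & xexp.

Inductive hcom :=
  | HSkip
  | HI of nat & iexp & xexp
  | HR of nat & iexp & rexp
  | HRoots of seq rexp & nat & iexp
  | HSeq of hcom & hcom
  | HIf of xexp & hcom & hcom
  | HWhile of xexp & hcom.

Section Machine.
Local Open Scope nat_scope.
Variables (R : realType) (M W Lim : nat).
Hypothesis LimM : (tmp + Lim * nids <= M)%N.
Hypothesis MW : (M <= W)%N.

Definition ast := ((nat -> nat -> nat) * (nat -> nat -> R))%type.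

Definition upd (T : Type) (f : nat -> nat -> T) (a i : nat) (v : T) :=
  fun a' i' => if (a' == a) && (i' == i) then v else f a' i'.

Definition iupd (s : ast) a i v : ast := (upd s.1 a i v, s.2).
Definition rupd (s : ast) a i v : ast := (s.1, upd s.2 a i v).

Fixpoint ieval (s : ast) (e : iexp) : nat :=
  match e with
  | EN n => n
  | EV a e => s.1 a (ieval s e)
  | EB o e1 e2 => iop_eval o (ieval s e1) (ieval s e2)
  | EL e1 e2 => (ieval s e1 < ieval s e2)%N
  | EE e1 e2 => ieval s e1 == ieval s e2
  end.

(** The entry read by [EV] needs no bound: every integer cell stays below [W] (see [wf]).
    Comparisons need none either, their value being 0 or 1. *)
Fixpoint iok (s : ast) (e : iexp) : Prop :=
  match e with
  | EN n => (n < W)%N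
  | EV a e => [/\ iok s e, (a < nids)%N & (ieval s e < Lim)%N]
  | EB o e1 e2 => [/\ iok s e1, iok s e2 &
                      (iop_eval o (ieval s e1) (ieval s e2) < W)%N]
  | EL e1 e2 | EE e1 e2 => iok s e1 /\ iok s e2
  end.

Definition rop_val (o : rop) (u v : R) : R :=
  match o with
  | RAdd => u + v
  | RSub => u - v
  | RMul => u * v
  | RDiv => u / v
  end%R.

Fixpoint reval (s : ast) (e : rexp) : R :=
  match e with
  | RN n => n%:R
  | RV a e => s.2 a (ieval s e)
  | RB o e1 e2 => rop_val o (reval s e1) (reval s e2)
  | RA e => acos (reval s e)
  end.

Fixpoint rok (s : ast) (e : rexp) : Prop :=
  match e with
  | RN n => True
  | RV a e => [/\ iok s e, (a < nids)%N & (ieval s e < Lim)%N]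
  | RB RDiv e1 e2 => [/\ rok s e1, rok s e2 & reval s e2 <> 0%R]
  | RB _ e1 e2 => rok s e1 /\ rok s e2
  | RA e => rok s e /\ (-1 <= reval s e <= 1)%R
  end.

Fixpoint xeval (s : ast) (e : xexp) : nat :=
  match e with
  | XI e => ieval s e
  | XL e1 e2 => (reval s e1 < reval s e2)%R
  | XE e1 e2 => reval s e1 == reval s e2
  | XB o e1 e2 => iop_eval o (xeval s e1) (xeval s e2)
  end.

Fixpoint xok (s : ast) (e : xexp) : Prop :=
  match e with
  | XI e => iok s e
  | XL e1 e2 | XE e1 e2 => rok s e1 /\ rok s e2
  | XB o e1 e2 => [/\ xok s e1, xok s e2 &
                      (iop_eval o (xeval s e1) (xeval s e2) < W)%N]
  end.

(** Upper bounds for the scratch cells taken by the code of an expression: [idep] and [ridep] for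
    the integer bank, [rdep] for the real one, [xdep] for both. An array access takes one more
    integer cell, for the address computation. *)
Fixpoint idep (e : iexp) : nat :=
  match e with
  | EN n => 1
  | EV a e => (idep e).+1
  | EB _ e1 e2 | EL e1 e2 | EE e1 e2 => maxn (idep e1) (idep e2).+1
  end.

Fixpoint rdep (e : rexp) : nat :=
  match e with
  | RN n => 1
  | RV a e => idep e
  | RB o e1 e2 => maxn (rdep e1) (rdep e2).+1
  | RA e => rdep e
  end.

Fixpoint ridep (e : rexp) : nat :=
  match e with
  | RN n => 1
  | RV a e => (idep e).+1
  | RB o e1 e2 => maxn (ridep e1) (ridep e2)
  | RA e => ridep e
  end.

Fixpoint xdep (e : xexp) : nat :=
  match e with
  | XI e => idep e
  | XL e1 e2 | XE e1 e2 =>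
    maxn (maxn (ridep e1) (ridep e2)) (maxn (rdep e1) (rdep e2).+1)
  | XB o e1 e2 => maxn (xdep e1) (xdep e2).+1
  end.

(* Cell [i] of the array [a] lives at the address [tmp + i * nids + a]: the
   arrays are interleaved, hence disjoint. The cells below [tmp] are scratch. *)
Definition addr_code (a k : nat) : com :=
  Seq (Do (IConst (Dir k.+1) nids))
 (Seq (Do (IBin IMul (Dir k) (Dir k) (Dir k.+1)))
 (Seq (Do (IConst (Dir k.+1) (tmp + a)))
      (Do (IBin IAdd (Dir k) (Dir k) (Dir k.+1))))).

Fixpoint icomp (e : iexp) (k : nat) : com :=
  match e with
  | EN n => Do (IConst (Dir k) n)
  | EV a e => Seq (icomp e k) (Seq (addr_code a k) (Do (IMove (Dir k) (Ind k))))
  | EB o e1 e2 =>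
    Seq (icomp e1 k)
   (Seq (icomp e2 k.+1) (Do (IBin o (Dir k) (Dir k) (Dir k.+1))))
  | EL e1 e2 =>
    Seq (icomp e1 k)
   (Seq (icomp e2 k.+1)
        (If (ILt (Dir k) (Dir k.+1))
            (Do (IConst (Dir k) 1)) (Do (IConst (Dir k) 0))))
  | EE e1 e2 =>
    Seq (icomp e1 k)
   (Seq (icomp e2 k.+1)
        (If (IEq (Dir k) (Dir k.+1))
            (Do (IConst (Dir k) 1)) (Do (IConst (Dir k) 0))))
  end.

Fixpoint icost (e : iexp) : nat :=
  match e with
  | EN n => 1
  | EV a e => icost e + (1 + (1 + (1 + 1)) + 1)
  | EB o e1 e2 => icost e1 + (icost e2 + 1)
  | EL e1 e2 | EE e1 e2 => icost e1 + (icost e2 + 2)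
  end.

Fixpoint rcomp (e : rexp) (k kr : nat) : com :=
  match e with
  | RN n => Do (RConst (Dir kr) n)
  | RV a e =>
    Seq (icomp e k) (Seq (addr_code a k) (Do (RMove (Dir kr) (Ind k))))
  | RB o e1 e2 =>
    Seq (rcomp e1 k kr)
   (Seq (rcomp e2 k kr.+1) (Do (RBin o (Dir kr) (Dir kr) (Dir kr.+1))))
  | RA e => Seq (rcomp e k kr) (Do (RAcos (Dir kr) (Dir kr)))
  end.

Fixpoint rcost (e : rexp) : nat :=
  match e with
  | RN n => 1
  | RV a e => icost e + (1 + (1 + (1 + 1)) + 1)
  | RB o e1 e2 => rcost e1 + (rcost e2 + 1)
  | RA e => rcost e + 1
  end.

Fixpoint xcomp (e : xexp) (k : nat) : com :=
  match e with
  | XI e => icomp e k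
  | XL e1 e2 =>
    Seq (rcomp e1 k 0)
   (Seq (rcomp e2 k 1)
        (If (RLt (Dir 0) (Dir 1))
            (Do (IConst (Dir k) 1)) (Do (IConst (Dir k) 0))))
  | XE e1 e2 =>
    Seq (rcomp e1 k 0)
   (Seq (rcomp e2 k 1)
        (If (REq (Dir 0) (Dir 1))
            (Do (IConst (Dir k) 1)) (Do (IConst (Dir k) 0))))
  | XB o e1 e2 =>
    Seq (xcomp e1 k)
   (Seq (xcomp e2 k.+1) (Do (IBin o (Dir k) (Dir k) (Dir k.+1))))
  end.

Fixpoint xcost (e : xexp) : nat :=
  match e with
  | XI e => icost e
  | XL e1 e2 | XE e1 e2 => rcost e1 + (rcost e2 + 2)
  | XB o e1 e2 => xcost e1 + (xcost e2 + 1)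
  end.

(** Ids from [nids] on read a default: their addresses fall on cells of other arrays, so that an
    update of one array would show in two. *)
Definition view (s : state R) : ast :=
  (fun a i => if (a < nids)%N then imem s (tmp + i * nids + a) else 0%N,
   fun a i => if (a < nids)%N then rmem s (tmp + i * nids + a) else 0%R).

(** What code with scratch space from [k] on must preserve: the cells below [k], which hold pending
    operands, and those from [tmp] on, which hold the arrays. *)
Definition same_above (T : Type) (k : nat) (f g : nat -> T) :=
  forall j, (j < k)%N || (tmp <= j)%N -> f j = g j.

Lemma same_aboveW (T : Type) (k k' : nat) (f g : nat -> T) :
  (k' <= k)%N -> same_above k f g -> same_above k' f g.
Proof. by move=> kk h j /orP[jk|jt]; apply: h; lia. Qed.

Lemma same_above_trans (T : Type) (k : nat) (f g h : nat -> T) :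
  same_above k f g -> same_above k g h -> same_above k f h.
Proof. by move=> fg gh j hj; rewrite fg ?gh. Qed.

Lemma view_same (s s' : state R) k k' :
  same_above k (imem s') (imem s) -> same_above k' (rmem s') (rmem s) ->
  view s' = view s.
Proof.
move=> hi hr; rewrite /view; congr pair; apply: funext => a; apply: funext => i.
  by case: ifP => // _; apply: hi; lia.
by case: ifP => // _; apply: hr; lia.
Qed.

Lemma addr_lt a i : (a < nids)%N -> (i < Lim)%N -> (tmp + i * nids + a < M)%N.
Proof. by have := LimM; rewrite nidsE tmpE => *; nia. Qed.

Lemma tmpM : (tmp <= M)%N. Proof. by have := LimM; lia. Qed.

Lemma Lim_le : Lim <= M. Proof. by have := LimM; rewrite nidsE; lia. Qed.

Definition upd1 (T : Type) (f : nat -> T) (i : nat) (v : T) :=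
  fun j => if j == i then v else f j.

Lemma upd1E (T : Type) (f : nat -> T) i v : upd1 f i v i = v.
Proof. by rewrite /upd1 eqxx. Qed.

Lemma upd1N (T : Type) (f : nat -> T) i v j : j <> i -> upd1 f i v j = f j.
Proof. by move=> /eqP/negbTE ji; rewrite /upd1 ji. Qed.

Lemma same_above_upd1 (T : Type) (f : nat -> T) i k v :
  k <= i < tmp -> same_above k (upd1 f i v) f.
Proof. by move=> ki j hj; rewrite upd1N //; lia. Qed.

Notation ex := (exec M W).

Lemma exIConst (s : state R) k v : k < M -> v < W ->
  ex (Do (IConst (Dir k) v)) s 1 (State (upd1 (imem s) k v) (rmem s)).
Proof. by move=> h1 h2; apply: ExecDo; rewrite /= /iset h2 /= h1. Qed.

Lemma exRConst (s : state R) k v : k < M ->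
  ex (Do (RConst (Dir k) v)) s 1 (State (imem s) (upd1 (rmem s) k v%:R)).
Proof. by move=> h1; apply: ExecDo; rewrite /= /rset /= h1. Qed.

Lemma exIBin (s : state R) o k i j : k < M -> i < M -> j < M ->
  iop_eval o (imem s i) (imem s j) < W ->
  ex (Do (IBin o (Dir k) (Dir i) (Dir j))) s 1
     (State (upd1 (imem s) k (iop_eval o (imem s i) (imem s j))) (rmem s)).
Proof.
move=> h1 h2 h3 h4; apply: ExecDo.
by rewrite /= /iget /= h2 h3 /= /iset h4 /= h1.
Qed.

Lemma exRBin (s : state R) o k i j : k < M -> i < M -> j < M ->
  (if o is RDiv then rmem s j <> 0%R else True) ->
  ex (Do (RBin o (Dir k) (Dir i) (Dir j))) s 1
     (State (imem s) (upd1 (rmem s) k (rop_val o (rmem s i) (rmem s j)))).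
Proof.
move=> h1 h2 h3 h4; apply: ExecDo.
rewrite /= /rget /= h2 h3 /=; case: o h4 => h4 /=; rewrite /rset /= ?h1 //.
by move/eqP/negbTE: h4 => ->.
Qed.

Lemma exRAcos (s : state R) k i : k < M -> i < M ->
  (-1 <= rmem s i <= 1)%R ->
  ex (Do (RAcos (Dir k) (Dir i))) s 1
     (State (imem s) (upd1 (rmem s) k (acos (rmem s i)))).
Proof.
move=> h1 h2 h3; apply: ExecDo.
by rewrite /= /rget /= h2 /= h3 /rset /= h1.
Qed.

Lemma exIMove_from (s : state R) k i : k < M -> i < M -> imem s i < M ->
  imem s (imem s i) < W ->
  ex (Do (IMove (Dir k) (Ind i))) s 1
     (State (upd1 (imem s) k (imem s (imem s i))) (rmem s)).
Proof.
move=> h1 h2 h3 h4; apply: ExecDo.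
by rewrite /= /iget /= h2 h3 /= /iset h4 /= h1.
Qed.

Lemma exIMove_to (s : state R) k i : k < M -> i < M -> imem s i < M ->
  imem s k < W ->
  ex (Do (IMove (Ind i) (Dir k))) s 1
     (State (upd1 (imem s) (imem s i) (imem s k)) (rmem s)).
Proof.
move=> h1 h2 h3 h4; apply: ExecDo.
by rewrite /= /iget /= h1 /= /iset h4 /= h2 h3.
Qed.

Lemma exRMove_from (s : state R) k i : k < M -> i < M -> imem s i < M ->
  ex (Do (RMove (Dir k) (Ind i))) s 1
     (State (imem s) (upd1 (rmem s) k (rmem s (imem s i)))).
Proof.
move=> h1 h2 h3; apply: ExecDo.
by rewrite /= /rget /= h2 h3 /= /rset /= h1.
Qed.

Lemma exRMove_to (s : state R) k i : k < M -> i < M -> imem s i < M ->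
  ex (Do (RMove (Ind i) (Dir k))) s 1
     (State (imem s) (upd1 (rmem s) (imem s i) (rmem s k))).
Proof.
move=> h1 h2 h3; apply: ExecDo.
by rewrite /= /rget /= h1 /= /rset /= h2 h3.
Qed.

Lemma addr_code_ok a k (s : state R) :
  k.+1 < tmp -> a < nids -> imem s k < Lim ->
  exists s', [/\ ex (addr_code a k) s (1 + (1 + (1 + 1))) s',
    imem s' k = tmp + imem s k * nids + a,
    same_above k (imem s') (imem s) & rmem s' = rmem s].
Proof.
move=> hk ha hs.
have hA := addr_lt ha hs; have hT := tmpM.
have [hkM hkM1] : k < M /\ k.+1 < M by lia.
eexists; split.
- apply: ExecSeq; first by apply: exIConst => //; have := nids_tmp; lia.
  apply: ExecSeq.
    by apply: exIBin => //=; rewrite upd1E upd1N; lia.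
  apply: ExecSeq; first by apply: exIConst => //; rewrite /= ; lia.
  by apply: exIBin => //=; rewrite !(upd1E, upd1N); lia.
- by rewrite /= !(upd1E, upd1N) //; lia.
- move=> j hj /=; rewrite !upd1N //; lia.
- by [].
Qed.

Lemma view_id a i (s : state R) : a < nids ->
  (view s).1 a i = imem s (tmp + i * nids + a).
Proof. by rewrite /view /= => ->. Qed.

Lemma view_rd a i (s : state R) : a < nids ->
  (view s).2 a i = rmem s (tmp + i * nids + a).
Proof. by rewrite /view /= => ->. Qed.

Lemma If_eq_ok (s : state R) t b k : test_eval M t s = Some b -> k < M -> 1 < W ->
  ex (If t (Do (IConst (Dir k) 1)) (Do (IConst (Dir k) 0))) s 2
     (State (upd1 (imem s) k b) (rmem s)).
Proof. by move=> h hk hW; apply: (ExecIf h); case: b h => h; apply: exIConst; lia. Qed.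

(** An invariant of all programs, since integers enter the memory through [iset] only. It makes the
    value read by an array access storable. *)
Definition wf (s : state R) := forall j, imem s j < W.

Lemma iset_wf (s s' : state R) x v : iset M W s x v = Some s' -> wf s -> wf s'.
Proof.
rewrite /iset; case: ifP => // hv; case: (addr M s x) => //= i [<-] h j /=.
by case: ifP.
Qed.

Lemma rset_imem (s s' : state R) x v : rset M s x v = Some s' -> imem s' = imem s.
Proof. by rewrite /rset; case: (addr M s x) => //= i [<-]. Qed.

Lemma instr_wf c (s s' : state R) : instr_eval M W c s = Some s' -> wf s -> wf s'.
Proof.
case: c => [x v|x y|o x y z|x v|x y|o x y z|x y|d x y z] /=.
- exact: iset_wf.
- by case: (iget M s y) => //= v; apply: iset_wf.
- by case: (iget M s y) => // u; case: (iget M s z) => // v; apply: iset_wf.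
- by move=> /rset_imem; rewrite /wf => ->.
- by case: (rget M s y) => //= v /rset_imem; rewrite /wf => ->.
- case: (rget M s y) => // u; case: (rget M s z) => // v.
  by case: (rop_eval o u v) => //= w /rset_imem; rewrite /wf => ->.
- case: (rget M s y) => // v; case: ifP => // _ /rset_imem; by rewrite /wf => ->.
- rewrite /roots_eval; case: (addr M s y) => // i; case: (addr M s z) => // j.
  by case: ifP => // _ /iset_wf h hs; apply: h.
Qed.

Lemma exec_wf c (s s' : state R) t : ex c s t s' -> wf s -> wf s'.
Proof.
elim=> {c s s' t} //.
- by move=> c s s' /instr_wf.
- by move=> c1 c2 s s' s'' t1 t2 _ h1 _ h2 /h1 /h2.
- by move=> b c s s' s'' t1 t2 _ _ h1 _ h2 /h1 /h2.
Qed.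

(** The second operand is computed from [k.+1] on, which leaves the first one in the cell [k] and
    the arrays intact. *)
Lemma icomp_ok (e : iexp) k (s : state R) : wf s -> k + idep e < tmp ->
  iok (view s) e ->
  exists s', [/\ ex (icomp e k) s (icost e) s',
    imem s' k = ieval (view s) e,
    same_above k (imem s') (imem s) & rmem s' = rmem s].
Proof.
have hT := tmpM; have hW : 1 < W by rewrite tmpE in hT; lia.
elim: e k s => [n|a e IH|o e1 IH1 e2 IH2|e1 IH1 e2 IH2|e1 IH1 e2 IH2] k s ws /= hk.
- move=> hn; have hkM : k < M by lia.
  eexists; split; first exact: exIConst.
  + by rewrite /= upd1E.
  + by apply: same_above_upd1; lia.
  + by [].
- move=> [he ha hi]; have [|s1 [ex1 v1 i1 r1]] := IH k s ws _ he; first lia.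
  have [||s2 [ex2 v2 i2 r2]] := @addr_code_ok a k s1 _ ha; [lia|by rewrite v1|].
  have hM := addr_lt ha hi; have w2 := exec_wf ex2 (exec_wf ex1 ws).
  have hkM : k < M by lia.
  have e2 : imem s2 (imem s2 k) = (view s).1 a (ieval (view s) e).
    by rewrite v2 v1 i2 ?i1 ?view_id //; lia.
  eexists; split.
  + apply: ExecSeq ex1 _; apply: ExecSeq ex2 _; apply: exIMove_from.
    * by [].
    * by [].
    * by rewrite v2 v1.
    * exact: w2.
  + by rewrite /= upd1E e2.
  + apply: same_above_trans; first by apply: same_above_upd1; lia.
    exact: same_above_trans i2 i1.
  + by rewrite /= r2 r1.
- move=> [ok1 ok2 hlt].
  have [|s1 [ex1 v1 i1 r1]] := IH1 k s ws _ ok1; first lia.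
  have vw : view s1 = view s by apply: (view_same i1 (k' := k)) => // j; rewrite r1.
  have [|| s2 [ex2 v2 i2 r2]] := IH2 k.+1 s1 (exec_wf ex1 ws); [lia|by rewrite vw|].
  have e1k : imem s2 k = ieval (view s) e1 by rewrite i2 ?v1 //; lia.
  rewrite vw in v2; have [hkM hkM1] : k < M /\ k.+1 < M by lia.
  eexists; split.
  + apply: ExecSeq ex1 _; apply: ExecSeq ex2 _; apply: exIBin => //.
    by rewrite e1k v2.
  + by rewrite /= upd1E e1k v2.
  + apply: same_above_trans; first by apply: same_above_upd1; lia.
    by apply: same_above_trans i1; apply: same_aboveW i2; lia.
  + by rewrite /= r2 r1.
- move=> [ok1 ok2].
  have [|s1 [ex1 v1 i1 r1]] := IH1 k s ws _ ok1; first lia.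
  have vw : view s1 = view s by apply: (view_same i1 (k' := k)) => // j; rewrite r1.
  have [|| s2 [ex2 v2 i2 r2]] := IH2 k.+1 s1 (exec_wf ex1 ws); [lia|by rewrite vw|].
  have e1k : imem s2 k = ieval (view s) e1 by rewrite i2 ?v1 //; lia.
  rewrite vw in v2; have [hkM hkM1] : k < M /\ k.+1 < M by lia.
  eexists; split.
  + apply: ExecSeq ex1 _; apply: ExecSeq ex2 _; apply: If_eq_ok => //.
    by rewrite /= /iget /= hkM hkM1 /= e1k v2.
  + by rewrite /= upd1E.
  + apply: same_above_trans; first by apply: same_above_upd1; lia.
    by apply: same_above_trans i1; apply: same_aboveW i2; lia.
  + by rewrite /= r2 r1.
- move=> [ok1 ok2].
  have [|s1 [ex1 v1 i1 r1]] := IH1 k s ws _ ok1; first lia.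
  have vw : view s1 = view s by apply: (view_same i1 (k' := k)) => // j; rewrite r1.
  have [|| s2 [ex2 v2 i2 r2]] := IH2 k.+1 s1 (exec_wf ex1 ws); [lia|by rewrite vw|].
  have e1k : imem s2 k = ieval (view s) e1 by rewrite i2 ?v1 //; lia.
  rewrite vw in v2; have [hkM hkM1] : k < M /\ k.+1 < M by lia.
  eexists; split.
  + apply: ExecSeq ex1 _; apply: ExecSeq ex2 _; apply: If_eq_ok => //.
    by rewrite /= /iget /= hkM hkM1 /= e1k v2.
  + by rewrite /= upd1E.
  + apply: same_above_trans; first by apply: same_above_upd1; lia.
    by apply: same_above_trans i1; apply: same_aboveW i2; lia.
  + by rewrite /= r2 r1.
Qed.

Lemma rcomp_ok (e : rexp) k kr (s : state R) : wf s -> k + ridep e < tmp ->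
  kr + rdep e < tmp -> rok (view s) e ->
  exists s', [/\ ex (rcomp e k kr) s (rcost e) s',
    rmem s' kr = reval (view s) e,
    same_above k (imem s') (imem s) & same_above kr (rmem s') (rmem s)].
Proof.
have hT := tmpM; have hW : 1 < W by rewrite tmpE in hT; lia.
elim: e k kr s => [n|a e|o e1 IH1 e2 IH2|e IH] k kr s ws /= hk hkr.
- move=> _; eexists; split; first by apply: exRConst; lia.
  + by rewrite /= upd1E.
  + by [].
  + by apply: same_above_upd1; lia.
- move=> [he ha hi]; have [|s1 [ex1 v1 i1 r1]] := icomp_ok (k := k) ws _ he.
    lia.
  have [||s2 [ex2 v2 i2 r2]] := @addr_code_ok a k s1 _ ha; [lia|by rewrite v1|].
  have hM := addr_lt ha hi; have w2 := exec_wf ex2 (exec_wf ex1 ws).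
  have [hkM hkrM] : k < M /\ kr < M by lia.
  have e2 : rmem s2 (imem s2 k) = (view s).2 a (ieval (view s) e).
    by rewrite v2 v1 r2 r1 view_rd.
  eexists; split.
  + apply: ExecSeq ex1 _; apply: ExecSeq ex2 _; apply: exRMove_from => //.
    by rewrite v2 v1.
  + by rewrite /= upd1E e2.
  + exact: same_above_trans i2 i1.
  + by rewrite /= r2 r1; apply: same_above_upd1; lia.
- move=> hok.
  have [ok1 ok2 hdiv] : [/\ rok (view s) e1, rok (view s) e2 &
      if o is RDiv then reval (view s) e2 <> 0%R else True].
    by case: o hok => [[]|[]|[]|[]].
  have [||s1 [ex1 v1 i1 r1]] := IH1 k kr s ws _ _ ok1; [lia|lia|].
  have vw : view s1 = view s := view_same i1 r1.
  have [|||s2 [ex2 v2 i2 r2]] := IH2 k kr.+1 s1 (exec_wf ex1 ws).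
  + lia.
  + lia.
  + by rewrite vw.
  have e1k : rmem s2 kr = reval (view s) e1 by rewrite r2 ?v1 //; lia.
  rewrite vw in v2; have [hkM hkM1] : kr < M /\ kr.+1 < M by lia.
  eexists; split.
  + apply: ExecSeq ex1 _; apply: ExecSeq ex2 _; apply: exRBin => //.
    by case: o hdiv {hok} => //; rewrite v2.
  + by rewrite /= upd1E e1k v2.
  + by apply: same_above_trans i1; apply: same_aboveW i2; lia.
  + apply: same_above_trans; first by apply: same_above_upd1; lia.
    by apply: same_above_trans r1; apply: same_aboveW r2; lia.
- move=> [ok1 hac].
  have [||s1 [ex1 v1 i1 r1]] := IH k kr s ws _ _ ok1; [lia|lia|].
  have hkM : kr < M by lia.
  eexists; split.
  + by apply: ExecSeq ex1 _; apply: exRAcos => //; rewrite v1.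
  + by rewrite /= upd1E v1.
  + by [].
  + by apply: same_above_trans r1; apply: same_above_upd1; lia.
Qed.

Lemma rcmp_ok (t : loc -> loc -> test) (f : R -> R -> bool) e1 e2 k (s : state R) :
  (forall s i j, i < M -> j < M ->
     test_eval M (t (Dir i) (Dir j)) s = Some (f (rmem s i) (rmem s j))) ->
  wf s -> k + maxn (ridep e1) (ridep e2) < tmp -> 1 <= k.+1 ->
  maxn (rdep e1) (rdep e2).+1 < tmp -> rok (view s) e1 -> rok (view s) e2 ->
  k < tmp ->
  exists s', [/\ ex (Seq (rcomp e1 k 0) (Seq (rcomp e2 k 1)
        (If (t (Dir 0) (Dir 1))
            (Do (IConst (Dir k) 1)) (Do (IConst (Dir k) 0)))))
        s (rcost e1 + (rcost e2 + 2)) s',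
    imem s' k = f (reval (view s) e1) (reval (view s) e2),
    same_above k (imem s') (imem s) & same_above 0 (rmem s') (rmem s)].
Proof.
have hT := tmpM; have hW : 1 < W by rewrite tmpE in hT; lia.
move=> ht ws h1 _ h2 ok1 ok2 hk.
have [||s1 [ex1 v1 i1 r1]] := rcomp_ok (k := k) (kr := 0) ws _ _ ok1; [lia|lia|].
have vw : view s1 = view s := view_same i1 r1.
have [|||s2 [ex2 v2 i2 r2]] := rcomp_ok (k := k) (kr := 1) (e := e2) (exec_wf ex1 ws).
+ lia.
+ lia.
+ by rewrite vw.
have e1k : rmem s2 0 = reval (view s) e1 by rewrite r2 ?v1.
rewrite vw in v2.
have [[hkM M0] M1] : (k < M /\ 0 < M) /\ 1 < M by rewrite tmpE in hT; lia.
eexists; split.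
+ apply: ExecSeq ex1 _; apply: ExecSeq ex2 _; apply: If_eq_ok => //.
  by rewrite ht.
+ by rewrite /= upd1E e1k v2.
+ apply: same_above_trans; first by apply: same_above_upd1; lia.
  exact: same_above_trans i2 i1.
+ by apply: same_above_trans r1; apply: same_aboveW r2.
Qed.

Lemma xcomp_ok (e : xexp) k (s : state R) : wf s -> k + xdep e < tmp ->
  xok (view s) e ->
  exists s', [/\ ex (xcomp e k) s (xcost e) s',
    imem s' k = xeval (view s) e,
    same_above k (imem s') (imem s) & same_above 0 (rmem s') (rmem s)].
Proof.
have hT := tmpM; have hW : 1 < W by rewrite tmpE in hT; lia.
elim: e k s => [e|e1 e2|e1 e2|o e1 IH1 e2 IH2] k s ws /= hk.
- move=> he; have [s' [? ? ? h]] := icomp_ok ws hk he.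
  by exists s'; split=> //; rewrite h.
- move=> [ok1 ok2].
  apply: (@rcmp_ok RLt (fun x y => x < y)%R e1 e2 k s) => //; last first.
  - lia.
  - lia.
  - lia.
  by move=> s0 i j hi hj; rewrite /= /rget /= hi hj.
- move=> [ok1 ok2].
  apply: (@rcmp_ok REq (fun x y => x == y)%R e1 e2 k s) => //; last first.
  - lia.
  - lia.
  - lia.
  by move=> s0 i j hi hj; rewrite /= /rget /= hi hj.
- move=> [ok1 ok2 hlt].
  have [|s1 [ex1 v1 i1 r1]] := IH1 k s ws _ ok1; first lia.
  have vw : view s1 = view s by apply: view_same i1 r1.
  have [|| s2 [ex2 v2 i2 r2]] := IH2 k.+1 s1 (exec_wf ex1 ws); [lia|by rewrite vw|].
  have e1k : imem s2 k = xeval (view s) e1 by rewrite i2 ?v1 //; lia.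
  rewrite vw in v2; have [hkM hkM1] : k < M /\ k.+1 < M by lia.
  eexists; split.
  + apply: ExecSeq ex1 _; apply: ExecSeq ex2 _; apply: exIBin => //.
    by rewrite e1k v2.
  + by rewrite /= upd1E e1k v2.
  + apply: same_above_trans; first by apply: same_above_upd1; lia.
    by apply: same_above_trans i1; apply: same_aboveW i2; lia.
  + exact: same_above_trans r2 r1.
Qed.

(* The outputs of [RRoots] are zeroed first, so that the content of the cells
   beyond the number of roots is determined. *)
Fixpoint rload (l : seq rexp) (k : nat) : com :=
  match l with
  | [::] => Skip
  | e :: l => Seq (rcomp e 0 k) (rload l k.+1)
  end.

Fixpoint rload_cost (l : seq rexp) : nat :=
  match l with
  | [::] => 0
  | e :: l => rcost e + rload_cost l
  end.

Fixpoint rclear (k c : nat) : com :=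
  match c with
  | 0 => Skip
  | c.+1 => Seq (Do (RConst (Dir k) 0)) (rclear k.+1 c)
  end.

(** [RRoots] faults on the zero polynomial, which does occur: for instance, the numerator of the
    position on the segment vanishes along the curve t = 0. Hence this guard on the coefficients.
    The cell [z] holds 0, as the machine compares cells only. *)
Fixpoint rnz (z k c : nat) (body : com) : com :=
  match c with
  | 0 => Skip
  | c.+1 => If (REq (Dir k) (Dir z)) (rnz z k.+1 c body) body
  end.

Definition icell (a : nat) (ie : iexp) : com := Seq (icomp ie 0) (addr_code a 0).

Fixpoint rstore_code (a : nat) (ie : iexp) (k src c : nat) : com :=
  match c with
  | 0 => Skip
  | c.+1 => Seq (icell a (EB IAdd ie (EN k)))
           (Seq (Do (RMove (Ind 0) (Dir src))) (rstore_code a ie k.+1 src.+1 c))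
  end.

Definition roots_code (l : seq rexp) (a : nat) (ie : iexp) : com :=
  Seq (rload l 0)
 (Seq (rclear (size l) (size l))
 (Seq (rnz (size l).*2.-1 0 (size l)
           (Do (RRoots (size l).-1 (Dir 0) (Dir (size l)) (Dir 0))))
      (rstore_code a ie 0 (size l) (size l).-1))).

Definition roots_cost (l : seq rexp) (ie : iexp) : nat :=
  rload_cost l + (size l + ((size l).+1 + (size l).-1 * (icost ie + 7))).

(** The default of [nth] pads the increasing list of roots with 0, as the cleared cells do; the zero
    polynomial yields zeros only. *)
Definition rootsl (s : ast) (l : seq rexp) : seq R :=
  mkseq (nth 0%R (polyrcf.rootsR (Poly (map (reval s) l)))) (size l).-1.

Definition rput (s : ast) (a b : nat) (vs : seq R) : ast :=
  (s.1, fun a' i => if (a' == a) && (b <= i < b + size vs) then nth 0%R vs (i - b)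
                    else s.2 a' i).

(** Derivations exist only for executions whose compiled code does not fault. The time is that of
    the compiled code, except that [HRoots] is charged its worst case: its guard stops at the first
    nonzero coefficient. *)
Inductive hexec : hcom -> ast -> nat -> ast -> Prop :=
  | XSkip s : hexec HSkip s 0 s
  | XI_ a ie x s : a < nids -> iok s ie -> ieval s ie < Lim -> xok s x ->
      idep ie < tmp -> xdep x + 1 < tmp ->
      hexec (HI a ie x) s (icost ie + 4 + (xcost x + 1))
        (iupd s a (ieval s ie) (xeval s x))
  | XR_ a ie x s : a < nids -> iok s ie -> ieval s ie < Lim -> rok s x ->
      idep ie < tmp -> ridep x + 1 < tmp -> rdep x < tmp ->
      hexec (HR a ie x) s (icost ie + 4 + (rcost x + 1))
        (rupd s a (ieval s ie) (reval s x))
  | XRoots l a ie s : 0 < size l -> (size l).*2 < tmp -> a < nids -> iok s ie ->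
      ieval s ie + size l < Lim -> (idep ie).+2 < tmp ->
      all (fun x => (ridep x < tmp) && (rdep x + size l < tmp)) l ->
      foldr (fun e P => rok s e /\ P) True l ->
      hexec (HRoots l a ie) s (roots_cost l ie)
        (rput s a (ieval s ie) (rootsl s l))
  | XSeq c1 c2 s s' s'' t1 t2 :
      hexec c1 s t1 s' -> hexec c2 s' t2 s'' ->
      hexec (HSeq c1 c2) s (t1 + t2) s''
  | XIf x c1 c2 s s' t : xok s x -> xdep x < tmp ->
      hexec (if xeval s x == 0 then c2 else c1) s t s' ->
      hexec (HIf x c1 c2) s (xcost x + t.+2) s'
  | XWhileF x c s : xok s x -> xdep x < tmp -> xeval s x = 0 ->
      hexec (HWhile x c) s (xcost x).+2 s
  | XWhileT x c s s' s'' t1 t2 : xok s x -> xdep x < tmp -> xeval s x <> 0 ->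
      hexec c s t1 s' -> hexec (HWhile x c) s' t2 s'' ->
      hexec (HWhile x c) s ((xcost x).+2 + t1 + t2) s''.

Definition xtest (x : xexp) : com := Seq (xcomp x 0) (Do (IConst (Dir 1) 0)).

Fixpoint compile (c : hcom) : com :=
  match c with
  | HSkip => Skip
  | HI a ie x =>
    Seq (icell a ie) (Seq (xcomp x 1) (Do (IMove (Ind 0) (Dir 1))))
  | HR a ie x =>
    Seq (icell a ie) (Seq (rcomp x 1 0) (Do (RMove (Ind 0) (Dir 0))))
  | HRoots l a ie => roots_code l a ie
  | HSeq c1 c2 => Seq (compile c1) (compile c2)
  | HIf x c1 c2 =>
    Seq (xtest x) (If (IEq (Dir 0) (Dir 1)) (compile c2) (compile c1))
  | HWhile x c =>
    Seq (xtest x) (While (ILt (Dir 1) (Dir 0)) (Seq (compile c) (xtest x)))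
  end.

Lemma xwrite_ok a ie (s : state R) : wf s -> a < nids -> iok (view s) ie ->
  ieval (view s) ie < Lim -> idep ie < tmp ->
  exists s', [/\ ex (icell a ie) s (icost ie + 4) s',
     imem s' 0 = tmp + ieval (view s) ie * nids + a,
     view s' = view s, wf s' & rmem s' = rmem s].
Proof.
have hT := tmpM; have hT2 := tmpE; move=> ws ha hi hl hd.
have [|s1 [ex1 v1 i1 r1]] := icomp_ok (k := 0) ws _ hi; first lia.
have [||s2 [ex2 v2 i2 r2]] := @addr_code_ok a 0 s1 _ ha; [lia|by rewrite v1|].
have w2 := exec_wf ex2 (exec_wf ex1 ws).
exists s2; split=> //.
- exact: ExecSeq ex1 ex2.
- by rewrite v2 v1.
- apply: (view_same (k := 0) (k' := 0)); first exact: same_above_trans i2 i1.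
  by move=> j _; rewrite r2 r1.
- by rewrite r2 r1.
Qed.

Lemma divn_adr a i : a < nids -> (i * nids + a) %/ nids = i /\ (i * nids + a) %% nids = a.
Proof.
by move=> h; rewrite divnMDl ?modnMDl ?divn_small ?modn_small ?addn0 //; lia.
Qed.

Lemma adr_eq a i a' i' : a < nids -> a' < nids ->
  (tmp + i' * nids + a' == tmp + i * nids + a) = (a' == a) && (i' == i).
Proof.
move=> ha ha'; apply/eqP/andP => [h|[/eqP -> /eqP ->] //].
have {}h : i' * nids + a' = i * nids + a by lia.
have [d1 m1] := divn_adr i ha; have [d2 m2] := divn_adr i' ha'.
by rewrite h d1 m1 in d2 m2; rewrite -m2 d2.
Qed.

Lemma view_iput (s : state R) a i v : a < nids ->
  view (State (upd1 (imem s) (tmp + i * nids + a) v) (rmem s)) = iupd (view s) a i v.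
Proof.
move=> ha; rewrite /view /iupd /=; congr pair.
apply: funext => a'; apply: funext => i'; rewrite /upd /upd1.
case: ifP => ha'; last by case: eqP => // e; rewrite e ha in ha'.
by rewrite adr_eq.
Qed.

Lemma view_rput (s : state R) a i v : a < nids ->
  view (State (imem s) (upd1 (rmem s) (tmp + i * nids + a) v)) = rupd (view s) a i v.
Proof.
move=> ha; rewrite /view /rupd /=; congr pair.
apply: funext => a'; apply: funext => i'; rewrite /upd /upd1.
case: ifP => ha'; last by case: eqP => // e; rewrite e ha in ha'.
by rewrite adr_eq.
Qed.

Lemma rload_ok l k (s : state R) : wf s -> k + size l < tmp ->
  all (fun x => (ridep x < tmp) && (rdep x + (k + size l) < tmp)) l ->
  foldr (fun e P => rok (view s) e /\ P) True l ->
  exists s', [/\ ex (rload l k) s (rload_cost l) s',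
     (forall j, j < size l -> rmem s' (k + j) = nth 0%R (map (reval (view s)) l) j),
     view s' = view s, same_above k (rmem s') (rmem s) & wf s'].
Proof.
elim: l k s => [|e l IH] k s ws /= hk.
  by move=> _ _; exists s; split=> //; apply: ExecSkip.
move=> /andP[/andP[d1 d2] hal] [hok hoks].
have [||s1 [ex1 v1 i1 r1]] := rcomp_ok (k := 0) (kr := k) ws _ _ hok; [lia|lia|].
have vw : view s1 = view s := view_same i1 r1.
have [||||s2 [ex2 v2 i2 r2 w2]] := IH k.+1 s1.
- exact: exec_wf ex1 ws.
- lia.
- by apply: sub_all hal => x; lia.
- by rewrite vw.
exists s2; split=> //.
- exact: ExecSeq ex1 ex2.
- move=> [_|j hj] /=; first by rewrite addn0 r2 ?v1 //; lia.
  by rewrite -addSnnS v2 // vw.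
- by rewrite i2.
- by apply: same_above_trans r1; apply: same_aboveW r2; lia.
Qed.

Lemma rclear_ok k c (s : state R) : k + c <= tmp ->
  exists s', [/\ ex (rclear k c) s c s', imem s' = imem s &
    rmem s' = fun j => if k <= j < k + c then 0%R else rmem s j].
Proof.
have hT := tmpM.
elim: c k s => [|c IH] k s hk /=.
  exists s; split=> //; first exact: ExecSkip.
  by apply: funext => j; case: ifP => //; lia.
have [|s2 [ex2 i2 r2]] := IH k.+1 (State (imem s) (upd1 (rmem s) k 0%:R)); first lia.
exists s2; split=> //.
- rewrite -(add1n c); apply: ExecSeq ex2; apply: exRConst; lia.
- rewrite r2; apply: funext => j /=; rewrite /upd1 mulr0n.
  case: (j =P k) => [->|jk]; first by rewrite leqnn ltnn /= ifT //; lia.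
  by congr (if _ then _ else _); lia.
Qed.

Lemma rnz_ok z k c body (s s' : state R) : z < tmp -> k + c <= tmp ->
  rmem s z = 0%R ->
  (if [forall i : 'I_c, rmem s (k + i) == 0%R] then s' = s else ex body s 1 s') ->
  exists2 t, ex (rnz z k c body) s t s' & t <= c.+1.
Proof.
have hT := tmpM.
move=> hz + z0; elim: c k => [|c IH] k hk /=.
  case: ifP => [_ ->|/forallP h]; last by exfalso; apply: h; case.
  by exists 0 => //; apply: ExecSkip.
have [kM zM] : k < M /\ z < M by lia.
have tE b : (rmem s k == 0%R) = b ->
  test_eval M (REq (Dir k) (Dir z)) s = Some b.
  by move=> <-; rewrite /= /rget /= kM zM /= z0.
case: (eqVneq (rmem s k) 0%R) => hk0 hif.
  have [||t ht tc] := IH k.+1; first lia.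
    move: hif; set b1 := [forall _, _]; set b2 := [forall _, _].
    suff -> : b1 = b2 by [].
    apply/forallP/forallP => h i.
      by have := h (lift ord0 i); rewrite /= /bump /= addnA addn1.
    case: (unliftP ord0 i) => [j ->|->]; last by rewrite addn0 hk0.
    by rewrite /= /bump /= addnA addn1; apply: h.
  exists t.+1 => //; apply: (ExecIf (v := true)) => //; apply: tE; exact/eqP.
rewrite ifF in hif; last first.
  by apply/negbTE/negP => /forallP /(_ ord0) /=; rewrite addn0; exact/negP.
exists 2 => //; apply: (ExecIf (v := false)) => //; apply: tE; exact/negbTE.
Qed.

Lemma rstore_ok a ie k src c (s : state R) : wf s -> a < nids ->
  iok (view s) ie -> ieval (view s) ie + (k + c) < Lim ->
  k + c < tmp -> (idep ie).+2 < tmp -> src + c <= tmp ->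
  exists s', [/\ ex (rstore_code a ie k src c) s (c * (icost ie + 7)) s' &
    view s' = rput (view s) a (ieval (view s) ie + k)
                   (mkseq (fun j => rmem s (src + j)) c)].
Proof.
have hT := tmpM; have hT2 := tmpE.
have emp (s0 : ast) b : rput s0 a b [::] = s0.
  case: s0 => f g; rewrite /rput /=; congr pair.
  by apply: funext => a'; apply: funext => i; case: ifP => //; lia.
elim: c k src s => [|c IH] k src s ws ha hok hl hk hd hs /=.
  by exists s; split; [apply: ExecSkip|rewrite emp].
have [|||s1 [ex1 v1 vw1 w1 r1]] := @xwrite_ok a (EB IAdd ie (EN k)) s ws ha.
- by have := Lim_le; split=> //=; lia.
- by rewrite /=; lia.
- by rewrite /=; lia.
have hM : tmp + (ieval (view s) ie + k) * nids + a < M by apply: addr_lt => //; lia.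
have [M0 srcM] : 0 < M /\ src < M by lia.
have ex2 : ex (Do (RMove (Ind 0) (Dir src))) s1 1
     (State (imem s1) (upd1 (rmem s1) (imem s1 0) (rmem s1 src))).
  by apply: exRMove_to => //; rewrite v1.
set s2 := State _ _ in ex2.
have vw2 : view s2 = rupd (view s) a (ieval (view s) ie + k) (rmem s src).
  by rewrite /s2 v1 view_rput // vw1 r1.
have ev (x : iexp) v b i : ieval (rupd (view s) b i v) x = ieval (view s) x.
  by elim: x => //= [? ? ->|? ? -> ? ->|? -> ? ->|? -> ? ->].
have evok (x : iexp) v b i : iok (view s) x -> iok (rupd (view s) b i v) x.
  elim: x => //= [? ? h [/h]|? ? h1 ? h2 [/h1 ? /h2]|? h1 ? h2 [/h1 ? /h2]|? h1 ? h2 [/h1 ? /h2]] //; rewrite ?ev //.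
have [|||||s3 [ex3 vw3]] := IH k.+1 src.+1 s2 (exec_wf ex2 w1) ha.
- by rewrite vw2; apply: evok.
- by rewrite vw2 ev; lia.
- by lia.
- by [].
- by lia.
exists s3; split.
- have -> : c.+1 * (icost ie + 7) =
    (icost (EB IAdd ie (EN k)) + 4) + (1 + c * (icost ie + 7)) by rewrite /= mulSn; lia.
  exact: ExecSeq ex1 (ExecSeq ex2 ex3).
- rewrite vw3 vw2 ev /rput /rupd !size_mkseq; congr pair.
  apply: funext => a'; apply: funext => i /=; rewrite /upd.
  case: (a' =P a) => //= _.
  case: (i =P _) => [->|ni].
    rewrite ifF; last by lia.
    by rewrite ifT ?subnn /= ?addn0 //; lia.
  rewrite (_ : (_ + k.+1 <= i < _) = (ieval (view s) ie + k <= i < ieval (view s) ie + k + c.+1)); last lia.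
  case: ifP => // h1.
  rewrite nth_mkseq; last lia.
  rewrite -(subnSK (m := ieval (view s) ie + k)); last lia.
  rewrite /= (nth_map 0) ?size_iota; last lia.
  rewrite nth_iota; last lia.
  rewrite /s2 /= upd1N; first by rewrite r1; congr (rmem s _); lia.
  rewrite v1 /=; move: (_ * nids) => A; lia.
Qed.

Lemma size_rootsR (p : {poly R}) : size (polyrcf.rootsR p) <= (size p).-1.
Proof.
have [->|p0] := eqVneq p 0%R; first by rewrite polyrcf.rootsR0.
have /max_poly_roots : all (root p) (polyrcf.rootsR p).
  by apply/allP => x; rewrite -(polyrcf.roots_on_rootsR p0) => /andP[].
move=> /(_ p0); have : uniq (polyrcf.rootsR p) by exact: (sorted_uniq lt_trans ltxx) (polyrcf.sorted_roots _ _ _).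
by move=> -> /(_ isT); case: (size p) => //.
Qed.

Lemma roots_code_ok l a ie (s : state R) : wf s -> 0 < size l ->
  (size l).*2 < tmp -> a < nids -> iok (view s) ie ->
  ieval (view s) ie + size l < Lim -> (idep ie).+2 < tmp ->
  all (fun x => (ridep x < tmp) && (rdep x + size l < tmp)) l ->
  foldr (fun e P => rok (view s) e /\ P) True l ->
  exists t s', [/\ ex (roots_code l a ie) s t s', t <= roots_cost l ie &
     view s' = rput (view s) a (ieval (view s) ie) (rootsl (view s) l)].
Proof.
move=> ws l0 l2 ha hi hl hd hal hok.
have hT := tmpM; have hT2 := tmpE.
have [|s1 [ex1 v1 vw1 r1 w1]] := rload_ok (l := l) (k := 0) ws _ hal hok; first lia.
have [|s2 [ex2 i2 r2]] := @rclear_ok (size l) (size l) s1; first lia.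
have w2 := exec_wf ex2 w1.
have vw2 : view s2 = view s1.
  apply: (@view_same _ _ 0 0); first by rewrite i2.
  by move=> j hj; rewrite r2 ifF //; lia.
set p := Poly (map (reval (view s)) l).
set rs := polyrcf.rootsR p.
have hrs : size rs <= (size l).-1.
  apply: leq_trans (size_rootsR p) _.
  by rewrite -!subn1 leq_sub2r // (leq_trans (size_Poly _)) // size_map.
pose s3 := if [forall i : 'I_(size l), rmem s2 (0 + i) == 0%R] then s2
  else State (upd1 (imem s2) 0 (size rs))
     (fun k => if size l <= k < size l + size rs then nth 0%R rs (k - size l)
               else rmem s2 k).
have coef2 j : j < size l -> rmem s2 j = nth 0%R (map (reval (view s)) l) j.
  by move=> hj; rewrite r2 ifF ?v1 ?add0n //; lia.
have hp : \poly_(k < (size l).-1.+1) rmem s2 (0 + k) = p.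
  apply/polyP => k; rewrite coef_poly coef_Poly prednK // add0n.
  by case: ltnP => hk; [rewrite coef2|rewrite nth_default ?size_map].
have p0 : [forall i : 'I_(size l), rmem s2 (0 + i) == 0%R] = (p == 0%R).
  apply/forallP/eqP => [h|p0 i].
    rewrite -hp; apply/polyP => k; rewrite coef_poly coef0 prednK //.
    by case: ltnP => // hk; have /eqP := h (Ordinal hk).
  by rewrite add0n coef2 ?ltn_ord // -coef_Poly -/p p0 coef0.
(* The last of the cells just cleared, at [(size l).*2.-1], serves as the constant 0 of the
   guard. *)
have [|||| t3 ex3 ht3] := @rnz_ok (size l).*2.-1 0 (size l)
    (Do (RRoots (size l).-1 (Dir 0) (Dir (size l)) (Dir 0))) s2 s3.
- by lia.
- by lia.
- by rewrite r2 ifT //; lia.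
- rewrite /s3 !p0; case h0: (p == 0%R) => //; apply: ExecDo; rewrite /= /roots_eval.
  have [lM M0] : size l < M /\ 0 < M by lia.
  rewrite /= lM M0 hp h0 /= add0n.
  rewrite (_ : (_ < M)) /=; last lia.
  have rsM : size l + size rs <= M by lia.
  have rsW : size rs < W by lia.
  rewrite -/rs rsM.
  by rewrite /iset -/rs rsW /= M0.
have w3 := exec_wf ex3 w2.
have vw3 : view s3 = view s.
  rewrite -vw1 -vw2; apply: (@view_same _ _ 0 0); rewrite /s3; case: ifP => //= _.
    by apply: same_above_upd1; rewrite tmpE.
  move=> j hj; rewrite ifF //.
  by move: hrs l2 hj l0; move: (size rs) (size l) => A B; lia.
have r3 k : k < (size l).-1 -> rmem s3 (size l + k) = nth 0%R rs k.
  move=> hk; rewrite /s3 p0; case: eqP => [pz|_] /=.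
    rewrite /rs pz polyrcf.rootsR0 nth_nil r2 ifT //; lia.
  rewrite leq_addr /= ltn_add2l addKn; case: ltnP => // hk2.
  rewrite nth_default // r2 ifT //; lia.
have [|||||s4 [ex4 vw4]] := @rstore_ok a ie 0 (size l) (size l).-1 s3 w3 ha.
- by rewrite vw3.
- by rewrite vw3; lia.
- by lia.
- by [].
- by lia.
exists (rload_cost l + (size l + (t3 + (size l).-1 * (icost ie + 7)))), s4; split.
- exact: ExecSeq ex1 (ExecSeq ex2 (ExecSeq ex3 ex4)).
- by rewrite /roots_cost !leq_add2l leq_add2r.
- rewrite vw4 vw3 addn0; congr rput; rewrite /rootsl -/p -/rs.
  apply: (@eq_from_nth _ 0%R); rewrite !size_mkseq // => k hk.
  by rewrite !nth_mkseq // r3.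
Qed.

Lemma xcomp_test x (s : state R) : wf s -> xdep x < tmp -> xok (view s) x ->
  exists s', [/\ ex (xtest x) s (xcost x + 1) s',
    view s' = view s, wf s' & forall c1 c2 t s'',
    ex (if xeval (view s) x == 0 then c2 else c1) s' t s'' ->
    ex (If (IEq (Dir 0) (Dir 1)) c2 c1) s' t.+1 s''] /\
    test_eval M (ILt (Dir 1) (Dir 0)) s' = Some (xeval (view s) x != 0).
Proof.
have hT := tmpM; have hT2 := tmpE; move=> ws hd hok.
have [|s1 [ex1 v1 i1 r1]] := xcomp_ok (k := 0) ws _ hok; first by lia.
have [M0 M1] : 0 < M /\ 1 < M by lia.
have ex2 : ex (Do (IConst (Dir 1) 0)) s1 1 (State (upd1 (imem s1) 1 0) (rmem s1)).
  by apply: exIConst; lia.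
have w2 := exec_wf ex2 (exec_wf ex1 ws).
exists (State (upd1 (imem s1) 1 0) (rmem s1)); split; last first.
  by rewrite /= /iget /= M0 M1 /= upd1E upd1N // v1 lt0n.
split.
- exact: ExecSeq ex1 ex2.
- apply: (@view_same _ _ 0 0) => //=; apply: same_above_trans i1.
  by apply: same_above_upd1; lia.
- by [].
- move=> c1 c2 t s'' h; apply: (ExecIf (v := xeval (view s) x == 0)).
    by rewrite /= /iget /= M0 M1 /= upd1E upd1N // v1.
  exact: h.
Qed.

Theorem compile_ok c s t s' : hexec c s t s' ->
  forall st, wf st -> view st = s ->
  exists t' st', [/\ ex (compile c) st t' st', t' <= t & view st' = s'].
Proof.
have hT := tmpM; have hT2 := tmpE.
elim=> {c s t s'}.
- by move=> s st ws <-; exists 0, st; split=> //; apply: ExecSkip.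
- move=> a ie x s ha hi hl hx di dx st ws vws; rewrite -{}vws in hi hl hx *.
  have [s1 [ex1 v1 vw1 w1 r1]] := xwrite_ok ws ha hi hl di.
  rewrite -vw1 in hx; have [|s2 [ex2 v2 i2 r2]] := xcomp_ok (k := 1) w1 _ hx; first lia.
  have w2 := exec_wf ex2 w1.
  have hM := addr_lt ha hl.
  have [M0 M1] : 0 < M /\ 1 < M by lia.
  have v20 : imem s2 0 = tmp + ieval (view st) ie * nids + a by rewrite i2.
  have ex3 : ex (Do (IMove (Ind 0) (Dir 1))) s2 1 (State
     (upd1 (imem s2) (imem s2 0) (imem s2 1)) (rmem s2)).
    by apply: exIMove_to => //; rewrite v20.
  eexists _, _; split; first exact: ExecSeq ex1 (ExecSeq ex2 ex3).
    by [].
  by rewrite v20 view_iput // (view_same i2 r2) vw1 v2 vw1.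
- move=> a ie x s ha hi hl hx di dix dx st ws vws; rewrite -{}vws in hi hl hx *.
  have [s1 [ex1 v1 vw1 w1 r1]] := xwrite_ok ws ha hi hl di.
  rewrite -vw1 in hx.
  have [||s2 [ex2 v2 i2 r2]] := rcomp_ok (k := 1) (kr := 0) w1 _ _ hx; [lia|lia|].
  have w2 := exec_wf ex2 w1.
  have hM := addr_lt ha hl.
  have [M0 M1] : 0 < M /\ 1 < M by lia.
  have v20 : imem s2 0 = tmp + ieval (view st) ie * nids + a by rewrite i2.
  have ex3 : ex (Do (RMove (Ind 0) (Dir 0))) s2 1 (State
     (imem s2) (upd1 (rmem s2) (imem s2 0) (rmem s2 0))).
    by apply: exRMove_to => //; rewrite v20.
  eexists _, _; split; first exact: ExecSeq ex1 (ExecSeq ex2 ex3).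
    by [].
  by rewrite v20 view_rput // (view_same i2 r2) vw1 v2 vw1.
- move=> l a ie s l0 l2 ha hi hl hd hal hok st ws vws; subst s.
  exact: roots_code_ok.
- move=> c1 c2 s s' s'' t1 t2 _ IH1 _ IH2 st ws vws.
  have [t1' [st1 [ex1 ht1 vw1]]] := IH1 st ws vws.
  have [t2' [st2 [ex2 ht2 vw2]]] := IH2 st1 (exec_wf ex1 ws) vw1.
  exists (t1' + t2'), st2; split=> //; first exact: ExecSeq ex1 ex2.
  exact: leq_add.
- move=> x c1 c2 s s' t hx dx _ IH st ws vws; subst s.
  have [s1 [[ex1 vw1 w1 hif] _]] := xcomp_test ws dx hx.
  have [t' [st' [ex2 ht vw2]]] := IH s1 w1 vw1.
  exists (xcost x + 1 + t'.+1), st'; split=> //; last by lia.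
  by apply: ExecSeq ex1 (hif _ _ _ _ _); case: ifP ex2.
- move=> x c s hx dx hx0 st ws vws; subst s.
  have [s1 [[ex1 vw1 w1 _] ht]] := xcomp_test ws dx hx.
  rewrite hx0 in ht.
  exists (xcost x + 1 + 1), s1; split=> //; last by lia.
  by apply: ExecSeq ex1 _; apply: ExecWhileFalse; rewrite ht.
- move=> x c s s' s'' t1 t2 hx dx hx0 _ IH1 _ IH2 st ws vws; subst s.
  have [s1 [[ex1 vw1 w1 _] ht]] := xcomp_test ws dx hx.
  have [t1' [st1 [ex2 ht1 vw2]]] := IH1 s1 w1 vw1.
  have [t2' [st2 [ex3 ht2 vw3]]] := IH2 st1 (exec_wf ex2 w1) vw2.
  have {}ht : test_eval M (ILt (Dir 1) (Dir 0)) s1 = Some true.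
    by rewrite ht; congr Some; apply/eqP.
  (* The induction hypothesis runs [xtest] and then the loop, whereas in the compiled loop this
     [xtest] closes the body: the execution is cut there and glued differently. *)
  inversion ex3 as [| |? ? ? s2 ? u1 u2 e1 e2| | |]; subst.
  exists (xcost x + 1 + (t1' + u1 + u2).+1), st2; split=> //; last by lia.
  apply: ExecSeq ex1 (ExecWhileTrue ht _ e2).
  exact: ExecSeq ex2 e1.
Qed.
End Machine.

(** * Weakest preconditions with a time budget *)

Section Wp.
Variables (R : realType) (W Lim : nat).
Local Open Scope nat_scope.
Notation ast := (ast R).
Notation hexec := (@hexec R W Lim).
Implicit Types (s : ast) (c : hcom) (Q : ast -> Prop).

(** The static side conditions of [hexec], with the values of [nids] and [tmp] spelled out: these
    constants are locked, and the test is to be decided by computation. *)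
Fixpoint hchk c : bool :=
  match c with
  | HSkip => true
  | HI a ie x => [&& a < 64, idep ie < 128 & xdep x + 1 < 128]
  | HR a ie x => [&& a < 64, idep ie < 128, ridep x + 1 < 128 & rdep x < 128]
  | HRoots l a ie => [&& 0 < size l, (size l).*2 < 128, a < 64, (idep ie).+2 < 128
      & all (fun x => (ridep x < 128) && (rdep x + size l < 128)) l]
  | HSeq c1 c2 => hchk c1 && hchk c2
  | HIf x c1 c2 => [&& xdep x < 128, hchk c1 & hchk c2]
  | HWhile x c => (xdep x < 128) && hchk c
  end.

Fixpoint loopfree c : bool :=
  match c with
  | HSeq c1 c2 | HIf _ c1 c2 => loopfree c1 && loopfree c2
  | HWhile _ _ => false
  | _ => true
  end.

(** A bound for loop-free code, charging both branches of a conditional; loops get their budget from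
    [wp_while]. *)
Fixpoint hcost c : nat :=
  match c with
  | HSkip => 0
  | HI a ie x => icost ie + 4 + (xcost x + 1)
  | HR a ie x => icost ie + 4 + (rcost x + 1)
  | HRoots l a ie => roots_cost l ie
  | HSeq c1 c2 => hcost c1 + hcost c2
  | HIf x c1 c2 => xcost x + (hcost c1 + hcost c2).+2
  | HWhile _ _ => 0
  end.

Fixpoint wpc c Q s : Prop :=
  match c with
  | HSkip => Q s
  | HI a ie x => [/\ iok W Lim s ie, ieval s ie < Lim, xok W Lim s x &
                     Q (iupd s a (ieval s ie) (xeval s x))]
  | HR a ie x => [/\ iok W Lim s ie, ieval s ie < Lim, rok W Lim s x &
                     Q (rupd s a (ieval s ie) (reval s x))]
  | HRoots l a ie => [/\ iok W Lim s ie, ieval s ie + size l < Lim,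
      foldr (fun e P => rok W Lim s e /\ P) True l &
      Q (rput s a (ieval s ie) (rootsl s l))]
  | HSeq c1 c2 => wpc c1 (wpc c2 Q) s
  | HIf x c1 c2 => xok W Lim s x /\
      (if xeval s x == 0 then wpc c2 Q s else wpc c1 Q s)
  | HWhile _ _ => False
  end.

Definition wp c (k : nat) Q s :=
  exists t s', [/\ hexec c s t s', t <= k & Q s'].

Lemma wpW c k k' Q Q' s : wp c k Q s -> k <= k' ->
  (forall s', Q s' -> Q' s') -> wp c k' Q' s.
Proof.
move=> [t [s' [h1 h2 h3]]] kk qq; exists t, s'; split=> //.
  exact: leq_trans kk.
exact: qq.
Qed.

Lemma wp_seq c1 c2 k1 k2 Q1 Q s : wp c1 k1 Q1 s ->
  (forall s', Q1 s' -> wp c2 k2 Q s') -> wp (HSeq c1 c2) (k1 + k2) Q s.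
Proof.
move=> [t1 [s1 [h1 ht1 hq1]]] /(_ _ hq1)[t2 [s2 [h2 ht2 hq2]]].
exists (t1 + t2), s2; split=> //; first exact: XSeq h1 h2.
exact: leq_add.
Qed.

Lemma hcost_ok c s t s' : hexec c s t s' -> loopfree c -> t <= hcost c.
Proof.
elim=> {c s t s'} //=.
- by move=> c1 c2 s s' s'' t1 t2 _ h1 _ h2 /andP[/h1 ? /h2 ?]; apply: leq_add.
- move=> x c1 c2 s s' t _ _ _ + /andP[l1 l2].
  by case: ifP => _ /(_ _)/wrap[]// h; lia.
Qed.

Lemma wpc_ex c Q s : hchk c -> wpc c Q s -> exists t s', hexec c s t s' /\ Q s'.
Proof.
have e1 := tmpE; have e2 := nidsE.
elim: c Q s => [|a ie x|a ie x|l a ie|c1 IH1 c2 IH2|x c1 IH1 c2 IH2|//] Q s /=.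
- by exists 0, s; split=> //; apply: XSkip.
- move=> /and3P[h1 h2 h3] [h4 h5 h6 h7].
  by eexists _, _; split; [apply: XI_|exact: h7] => //; lia.
- move=> /and4P[h1 h2 h3 h3'] [h4 h5 h6 h7].
  by eexists _, _; split; [apply: XR_|exact: h7] => //; lia.
- move=> /and5P[h0 h1 h2 h3 h3'] [h4 h5 h6 h7].
  eexists _, _; split; [apply: XRoots|exact: h7] => //; try lia.
  by apply: sub_all h3' => y; lia.
- move=> /andP[k1 k2] /(IH1 _ _ k1)[t1 [s1 [h1 /(IH2 _ _ k2)[t2 [s2 [h2 q]]]]]].
  by eexists _, _; split; [apply: XSeq h1 h2|].
- move=> /and3P[h1 k1 k2] [hx].
  case: ifP => hz h.
    have [t [s' [h' q]]] := IH2 _ _ k2 h.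
    eexists _, _; split; [apply: XIf => //|exact: q]; first by lia.
    by rewrite hz; exact: h'.
  have [t [s' [h' q]]] := IH1 _ _ k1 h.
  eexists _, _; split; [apply: XIf => //|exact: q]; first by lia.
  by rewrite hz; exact: h'.
Qed.

Lemma wp_lf c Q s : hchk c && loopfree c -> wpc c Q s -> wp c (hcost c) Q s.
Proof.
move=> /andP[h1 h2] /(wpc_ex h1)[t [s' [h q]]].
by exists t, s'; split=> //; apply: hcost_ok h h2.
Qed.

(** The arrays that a program may write, read off its text. With [wp_frame], the preservation of all
    others is decided by computation instead of being carried through every specification. *)
Fixpoint imods c : seq nat :=
  match c with
  | HI a _ _ => [:: a]
  | HSeq c1 c2 | HIf _ c1 c2 => imods c1 ++ imods c2
  | HWhile _ c => imods c
  | _ => [::]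
  end.

Fixpoint rmods c : seq nat :=
  match c with
  | HR a _ _ | HRoots _ a _ => [:: a]
  | HSeq c1 c2 | HIf _ c1 c2 => rmods c1 ++ rmods c2
  | HWhile _ c => rmods c
  | _ => [::]
  end.

Definition framed (li lr : seq nat) s s' :=
  (forall a, a \notin li -> s'.1 a = s.1 a) /\
  (forall a, a \notin lr -> s'.2 a = s.2 a).

Lemma framed_refl li lr s : framed li lr s s. Proof. by []. Qed.

Lemma framed_trans li lr s s' s'' :
  framed li lr s s' -> framed li lr s' s'' -> framed li lr s s''.
Proof. by move=> [h1 h2] [h3 h4]; split=> a ha; rewrite ?h3 ?h4 ?h1 ?h2. Qed.

Lemma framedW li lr li' lr' s s' : {subset li <= li'} -> {subset lr <= lr'} ->
  framed li lr s s' -> framed li' lr' s s'.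
Proof.
by move=> h1 h2 [h3 h4]; split=> a ha; [apply: h3|apply: h4];
  apply: contra ha => /[dup]; [move=> /h1|move=> /h2].
Qed.

Lemma hexec_framed c s t s' : hexec c s t s' -> framed (imods c) (rmods c) s s'.
Proof.
elim=> {c s t s'} /=.
- exact: framed_refl.
- move=> a ie x s *; split=> b //; rewrite inE => /negbTE hb.
  by rewrite /iupd /upd /=; apply: funext => i; rewrite hb.
- move=> a ie x s *; split=> b //; rewrite inE => /negbTE hb.
  by rewrite /rupd /upd /=; apply: funext => i; rewrite hb.
- move=> l a ie s *; split=> b //; rewrite inE => /negbTE hb.
  by rewrite /rput /=; apply: funext => i; rewrite hb.
- move=> c1 c2 s s' s'' t1 t2 _ h1 _ h2.
  by apply: (framed_trans (s' := s')); [apply: framedW h1|apply: framedW h2] => a;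
    rewrite mem_cat => ->; rewrite ?orbT.
- move=> x c1 c2 s s' t _ _ _ h; apply: framedW h => a; rewrite mem_cat; case: ifP => _ ->; rewrite ?orbT //.
- by move=> *; apply: framed_refl.
- move=> x c s s' s'' t1 t2 _ _ _ _ h1 _ h2; exact: framed_trans h1 h2.
Qed.

Lemma wp_frame c k Q s : wp c k Q s ->
  wp c k (fun s' => Q s' /\ framed (imods c) (rmods c) s s') s.
Proof.
move=> [t [s' [h ht q]]]; exists t, s'; split=> //; split=> //.
exact: hexec_framed h.
Qed.

(** The first argument of the invariant is the budget left. Every iteration pays for its test and
    its body out of it, so it is at once the variant and the time bound. *)
Lemma wp_while (Inv : nat -> ast -> Prop) x c p Q s : xdep x < 128 -> Inv p s ->
  (forall p s, Inv p s -> xok W Lim s x /\ if xeval s x == 0 then Q s else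
     exists k p', wp c k (Inv p') s /\ (xcost x).+2 + k + p' <= p) ->
  wp (HWhile x c) (p + (xcost x).+2) Q s.
Proof.
move=> hd + hinv; rewrite -tmpE in hd; elim/ltn_ind: p s => p IH s hp.
have [hx] := hinv p s hp; case: eqP => hx0.
  move=> hq; exists (xcost x).+2, s; split=> //; [exact: XWhileF|exact: leq_addl].
move=> [k [p' [[t1 [s1 [h1 ht1 hi1]]] hk]]].
have [|t2 [s2 [h2 ht2 hq2]]] := IH p' _ s1 hi1; first lia.
exists ((xcost x).+2 + t1 + t2), s2; split=> //; last lia.
exact: XWhileT hx hd hx0 h1 h2.
Qed.

Definition V a := EV a (EN 0).
Definition RVr a := RV a (EN 0).

Definition hset a x := HI a (EN 0) x.
Definition rset_ a x := HR a (EN 0) x.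

Definition hfor v (N : iexp) c :=
  HSeq (hset v (XI (EN 0)))
       (HWhile (XI (EL (V v) N)) (HSeq c (hset v (XI (EB IAdd (V v) (EN 1)))))).

(** The overhead of the test and of the counter in one iteration; 50 is generous. *)
Definition forc (v : nat) (N : iexp) : nat := icost N + 50.

(** The invariant must be insensitive to the counter cell, which is set and incremented outside of
    the body; the index [i] takes its place. *)
Lemma wp_for (Inv : nat -> ast -> Prop) n k v N c s :
  idep N < 126 -> v < 64 -> 0 < Lim -> Lim <= W -> n < W ->
  v \notin imods c ->
  (forall i s, i <= n -> Inv i s -> iok W Lim s N /\ ieval s N = n) ->
  (forall i j s, Inv i s -> Inv i (iupd s v 0 j)) ->
  (forall i s, i < n -> s.1 v 0 = i -> Inv i s -> wp c k (Inv i.+1) s) ->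
  Inv 0 s -> wp (hfor v N c) (n * (k + forc v N) + forc v N)
    (fun s' => Inv n s' /\ framed (v :: imods c) (rmods c) s s') s.
Proof.
move=> hN hv l0 lW hn hvc hinv hst hb h0.
apply: (wpW (k := n * (k + forc v N) + forc v N) (Q := fun s' => Inv n s' /\ framed (imods (hfor v N c)) (rmods (hfor v N c)) s s')) => //; last first.
  move=> s' [hi hf]; split=> //; apply: framedW hf => a //=.
    by rewrite !(inE, mem_cat); case: (a == v); case: (a \in imods c).
  by rewrite cats0.
apply: wp_frame; rewrite /hfor.
apply: (wpW (k := hcost (hset v (XI (EN 0))) + (n * (k + forc v N) + (xcost (XI (EL (V v) N))).+2)) (Q := Inv n)).
- apply: (wp_seq (Q1 := fun s' => Inv 0 s' /\ s'.1 v 0 = 0)).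
    apply: wp_lf => /=; first by rewrite hv.
    have W0 : 0 < W by lia.
    by split=> //=; split; [exact: hst|rewrite /upd !eqxx].
  move=> s1 [h1 hv1].
  apply: (@wp_while (fun p s => exists2 i, i <= n & [/\ Inv i s, s.1 v 0 = i & p = (n - i) * (k + forc v N)])).
  + by rewrite /=; lia.
  + by exists 0 => //; rewrite subn0.
  + move=> {s s1 h0 h1 hv1} p s [i hi [hI hvi ->]].
    have [okN vN] := hinv i s hi hI.
    split; first by rewrite /= nidsE; do !split => //; lia.
    rewrite /= hvi vN eqb0 -leqNgt; case: leqP => hin.
      by have <- : i = n by lia.
    exists (k + hcost (hset v (XI (EB IAdd (V v) (EN 1))))), ((n - i.+1) * (k + forc v N)).
    split; last first.
      rewrite (_ : n - i = (n - i.+1).+1) ?mulSn /forc /=; lia.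
    apply: (wp_seq (Q1 := fun s' => Inv i.+1 s' /\ s'.1 v 0 = i)).
      apply: (wpW (k := k) (Q := fun s' => Inv i.+1 s' /\ framed (imods c) (rmods c) s s')) => //.
        by apply: wp_frame; apply: hb.
      by move=> s' [h [hf _]]; rewrite hf.
    move=> s' [hI' hv'].
    apply: wp_lf => /=; first by rewrite hv.
    rewrite /= nidsE hv'; split=> //; try lia.
      by do !split => //; lia.
    exists i.+1 => //; split=> //; first exact: hst.
    by rewrite /= /upd !eqxx addn1.
- by rewrite /forc /=; lia.
- by [].
Qed.

End Wp.

(** * Sorting *)

(* Array identifiers; a scalar variable is the entry 0 of an array. *)
Definition iN := 0%N. Definition iM := 1%N. Definition iNM := 2%N.
Definition iOff := 3%N. Definition iP := 4%N. Definition iQ := 5%N.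
Definition iI := 6%N. Definition iJ := 7%N. Definition iJ2 := 8%N.
Definition iZ := 9%N. Definition iAg := 10%N. Definition aCode := 11%N.
Definition aAgg := 12%N. Definition iTot := 13%N. Definition iBest := 14%N.
Definition aId := 15%N. Definition aId2 := 16%N. Definition iW := 17%N.
Definition iL := 18%N. Definition iMid := 19%N. Definition iHi := 20%N.
Definition ii := 21%N. Definition jj := 22%N. Definition kk := 23%N.
Definition iG := 24%N. Definition iH := 25%N. Definition iE := 26%N.
Definition iK := 27%N.

Definition rIN := 0%N. Definition rKey := 1%N. Definition rKey2 := 2%N.
Definition rPC := 3%N. Definition rC := 4%N. Definition rS := 5%N.
Definition rT := 6%N. Definition rBC := 7%N. Definition rBS := 8%N.
Definition rBT := 9%N. Definition rX1 := 10%N. Definition rX2 := 11%N.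
Definition rU := 12%N. Definition rD := 13%N.

Definition incr v := hset v (XI (EB IAdd (V v) (EN 1))).

(** Truncated subtraction yields the minimum, see [minnB]. *)
Definition emin e1 e2 := EB ISub e2 (EB ISub e2 e1).

Definition move_pair v :=
  HSeq (HI aId2 (V kk) (XI (EV aId (V v))))
 (HSeq (HR rKey2 (V kk) (RV rKey (V v))) (incr v)).

(** Operators do not short-circuit, so the keys at [ii] and [jj] are read even when a block is
    exhausted; both indices stay below [Lim]. On ties the left block goes first, as in
    [merge leT]. *)
Definition merge_step :=
  HSeq (HIf (XB IMul (XI (EL (V ii) (V iMid)))
               (XB ISub (XI (EN 1))
                  (XB IMul (XI (EL (V jj) (V iHi)))
                     (XL (RV rKey (V jj)) (RV rKey (V ii))))))
          (move_pair ii) (move_pair jj))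
       (incr kk).

Definition merge_init :=
  HSeq (hset iMid (XI (emin (EB IAdd (V iL) (V iW)) (V iK))))
 (HSeq (hset iHi (XI (emin (EB IAdd (V iMid) (V iW)) (V iK))))
 (HSeq (hset ii (XI (V iL)))
 (HSeq (hset jj (XI (V iMid))) (hset kk (XI (V iL)))))).

Definition merge_block :=
  HSeq merge_init
 (HSeq (HWhile (XI (EL (V kk) (V iHi))) merge_step) (hset iL (XI (V iHi)))).

Definition copy_back :=
  hfor kk (V iK)
   (HSeq (HI aId (V kk) (XI (EV aId2 (V kk))))
         (HR rKey (V kk) (RV rKey2 (V kk)))).

Definition merge_pass :=
  HSeq (hset iL (XI (EN 0)))
 (HSeq (HWhile (XI (EL (V iL) (V iK))) merge_block)
 (HSeq copy_back (hset iW (XI (EB IAdd (V iW) (V iW)))))).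

Definition sort_code :=
  HSeq (hset iW (XI (EN 1))) (HWhile (XI (EL (V iW) (V iK))) merge_pass).

Ltac wok := rewrite /= ?nidsE /upd /=; do ?split => //; try lia.
Ltac wstep := apply: And4; [by wok | by wok | by wok | ].

Section Slice.
Variable R : realType.
Local Open Scope nat_scope.

Definition leT (x y : R * nat) := (x.1 <= y.1)%R.

Lemma leT_total : total leT. Proof. by move=> x y; apply: le_total. Qed.
Lemma leT_trans : transitive leT. Proof. by move=> x y z; apply: le_trans. Qed.

Definition slice (T : Type) (f : nat -> T) i j := [seq f x | x <- index_iota i j].

Lemma sliceS (T : Type) (f : nat -> T) i j : i < j ->
  slice f i j = f i :: slice f i.+1 j.
Proof. by move=> ij; rewrite /slice /index_iota -[j - i]subnSK. Qed.

Lemma slice_rcons (T : Type) (f : nat -> T) i j : i <= j ->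
  slice f i j.+1 = rcons (slice f i j) (f j).
Proof.
by move=> ij; rewrite /slice /index_iota subSn // -addn1 iotaD map_cat /= subnKC // cats1.
Qed.

Lemma slice_nil (T : Type) (f : nat -> T) i j : j <= i -> slice f i j = [::].
Proof. by move=> ij; rewrite /slice /index_iota (_ : j - i = 0) //; lia. Qed.

Lemma slice_cat (T : Type) (f : nat -> T) i j k : i <= j -> j <= k ->
  slice f i k = slice f i j ++ slice f j k.
Proof.
move=> ij jk; rewrite /slice /index_iota -map_cat.
by rewrite (_ : k - i = (j - i) + (k - j)) ?iotaD ?subnKC //; lia.
Qed.

Lemma eq_slice (T : Type) (f g : nat -> T) i j :
  (forall x, i <= x < j -> f x = g x) -> slice f i j = slice g i j.
Proof. by move=> h; apply/eq_in_map => x; rewrite mem_index_iota; apply: h. Qed.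

Lemma merge_slice_r (A : nat -> R * nat) i j mid hi : j < hi ->
  (i < mid -> ~~ leT (A i) (A j)) ->
  merge leT (slice A i mid) (slice A j hi)
    = A j :: merge leT (slice A i mid) (slice A j.+1 hi).
Proof.
move=> jhi h; rewrite (sliceS _ jhi); case: (ltnP i mid) => im.
  by rewrite (sliceS _ im) /= (negbTE (h im)).
by rewrite (slice_nil _ im); case: (slice A j.+1 hi).
Qed.

Lemma merge_slice_l (A : nat -> R * nat) i j mid hi : i < mid ->
  (j < hi -> leT (A i) (A j)) ->
  merge leT (slice A i mid) (slice A j hi)
    = A i :: merge leT (slice A i.+1 mid) (slice A j hi).
Proof.
move=> im h; rewrite (sliceS _ im); case: (ltnP j hi) => jh.
  by rewrite (sliceS _ jh) /= (h jh).
by rewrite (slice_nil _ jh); case: (slice A i.+1 mid).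
Qed.

End Slice.

Arguments leT {R}.

Section Sort.
Variables (R : realType) (W Lim : nat).
Local Open Scope nat_scope.
Notation ast := (ast R).
Notation wp := (@wp R W Lim).
Implicit Types (s : ast).
Hypothesis LW : Lim.*2 < W.

Definition arr s (j : nat) : R * nat := (s.2 rKey j, s.1 aId j).
Definition arr2 s (j : nat) : R * nat := (s.2 rKey2 j, s.1 aId2 j).

(** What has been written, followed by the merge of what remains, is the merge of the two blocks.
    The entries below [l] belong to blocks merged earlier in the pass. *)
Definition merge_inv (A : nat -> R * nat) l mid hi s0 s :=
  exists i j, [/\ [/\ l <= i, i <= mid, mid <= j & j <= hi],
    [/\ s.1 ii 0 = i, s.1 jj 0 = j & s.1 kk 0 = i + j - mid],
    [/\ s.1 iMid 0 = mid, s.1 iHi 0 = hi & arr s =1 A],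
    slice (arr2 s) l (i + j - mid) ++ merge leT (slice A i mid) (slice A j hi)
      = merge leT (slice A l mid) (slice A mid hi) &
    forall x, x < l -> arr2 s x = arr2 s0 x].

Lemma merge_step_ok A l mid hi s0 s : hi < Lim -> l <= mid -> mid <= hi ->
  merge_inv A l mid hi s0 s -> s.1 kk 0 < hi ->
  wp merge_step (hcost merge_step)
    (fun s' => merge_inv A l mid hi s0 s' /\ s'.1 kk 0 = (s.1 kk 0).+1) s.
Proof.
move=> hL lm mh [i [j [[h1 h2 h3 h4] [e1 e2 e3] [e4 e5 eA] em ex]]] hk.
have hW : hi.+1 < W by lia.
apply: wp_lf => //=; rewrite nidsE; split.
  by do !split => //; try lia; case: (_ < _)%R; lia.
case: ifPn => hc; do 3!wstep.
- wstep; split; last by rewrite /= /upd /= addn1.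
  have /andP[jhi ji] : (j < hi) && ((i == mid) || (s.2 rKey j < s.2 rKey i)%R).
    move: hc; rewrite e1 e2 e4 e5; case: (_ < _)%R; lia.
  have kl : l <= s.1 kk 0 by lia.
  have jm1 : i + j.+1 - mid = (i + j - mid).+1 by lia.
  exists i, j.+1; rewrite /iupd /rupd /upd /=; split.
  + by split=> //; lia.
  + by rewrite e1 e2 e3 jm1 !addn1.
  + by [].
  + rewrite jm1 slice_rcons -?e3 // -em -cats1 -catA; congr (_ ++ _).
      by rewrite e3; apply: eq_slice => x hx; rewrite /arr2 /= !ifF //; lia.
    rewrite (merge_slice_r (j := j)) // => [|im]; last first.
      by move: ji; rewrite (ltn_eqF im) /= -!eA /leT /arr /= ltNge.
    by rewrite -eA /arr2 /arr /= !eqxx e2.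
  + move=> x hx; rewrite -ex // /arr2 /= !ifF //; lia.
- wstep; split; last by rewrite /= /upd /= addn1.
  have /andP[im ji] : (i < mid) && ((j == hi) || ~~ (s.2 rKey j < s.2 rKey i)%R).
    move: hc; rewrite e1 e2 e4 e5; case: (_ < _)%R; lia.
  have kl : l <= s.1 kk 0 by lia.
  have jm1 : i.+1 + j - mid = (i + j - mid).+1 by lia.
  exists i.+1, j; rewrite /iupd /rupd /upd /=; split.
  + by split=> //; lia.
  + by rewrite e1 e2 e3 jm1 !addn1.
  + by [].
  + rewrite jm1 slice_rcons -?e3 // -em -cats1 -catA; congr (_ ++ _).
      by rewrite e3; apply: eq_slice => x hx; rewrite /arr2 /= !ifF //; lia.
    rewrite (merge_slice_l (i := i)) // => [|jh]; last first.
      by move: ji; rewrite (ltn_eqF jh) /= -!eA /leT /arr /= leNgt.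
    by rewrite -eA /arr2 /arr /= !eqxx e1.
  + move=> x hx; rewrite -ex // /arr2 /= !ifF //; lia.
Qed.

Definition block_cost :=
  hcost merge_init + (xcost (XI (EL (V kk) (V iHi)))).+2 + hcost (hset iL (XI (V iHi))).
Definition step_cost := (xcost (XI (EL (V kk) (V iHi)))).+2 + hcost merge_step.

Definition pass_inv (A : nat -> R * nat) (w K l : nat) s :=
  [/\ [/\ l <= K, s.1 iL 0 = l & l = K \/ exists c, l = c * w.*2],
    [/\ s.1 iW 0 = w, s.1 iK 0 = K & arr s =1 A],
    perm_eq (slice (arr2 s) 0 l) (slice A 0 l) &
    forall c, sorted leT (slice (arr2 s) (c * w.*2) (minn (c.+1 * w.*2) l))].

Lemma minnB a b : b - (b - a) = minn a b.
Proof. lia. Qed.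

(** The cost is a constant plus a multiple of the progress [l' - l], so that the blocks of a pass
    add up to a linear cost. *)
Lemma merge_block_ok A w K l s : 0 < w <= K -> K < Lim -> l < K ->
  (forall c, sorted leT (slice A (c * w) (minn (c.+1 * w) K))) ->
  pass_inv A w K l s ->
  exists2 l', l < l' &
   wp merge_block (block_cost + (l' - l) * step_cost) (pass_inv A w K l') s.
Proof.
move=> hw hK hl hA [[_ eL hc] [eW eK eA] hp hs].
pose mid := minn (l + w) K; pose hi := minn (mid + w) K.
exists hi; first by rewrite /hi /mid; lia.
have hW : K.*2 < W by lia.
apply: (wpW (k := hcost merge_init + ((hi - l) * step_cost +
    (xcost (XI (EL (V kk) (V iHi)))).+2 + hcost (hset iL (XI (V iHi)))))
    (Q := pass_inv A w K hi)) => //; last first.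
  by rewrite /block_cost; lia.
have lm : l <= mid by rewrite /mid; lia.
have mh : mid <= hi by rewrite /hi /mid; lia.
have hiK : hi <= K by rewrite /hi; lia.
pose I0 s' := [/\ merge_inv A l mid hi s s', s'.1 iL 0 = l, s'.1 iW 0 = w & s'.1 iK 0 = K].
have nc x : x \notin imods merge_step -> forall s' k (Q : ast -> Prop), wp merge_step k Q s' ->
    wp merge_step k (fun s'' => Q s'' /\ s''.1 x 0 = s'.1 x 0) s'.
  move=> hx s' k Q /wp_frame h; apply: wpW h _ _ => // s'' [hq [hf _]].
  by rewrite hf.
apply: (wp_seq (Q1 := fun s' => I0 s' /\ s'.1 kk 0 = l)).
  apply: wp_lf => //; rewrite /merge_init /hset /emin.
  do 5!wstep.
  have em : s.1 iK 0 - (s.1 iK 0 - (s.1 iL 0 + s.1 iW 0)) = mid.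
    by rewrite eK eL eW minnB.
  have eh : s.1 iK 0 - (s.1 iK 0 - (mid + s.1 iW 0)) = hi.
    by rewrite eK eW minnB.
  split; last by [].
  split=> //; exists l, mid; rewrite /iupd /upd /= em eh addnK eL; split=> //.
  by rewrite slice_nil.
move=> s1 [[hm hiL hiW hiK1] hk1].
apply: (wp_seq (Q1 := fun s' => I0 s' /\ s'.1 kk 0 = hi)).
  apply: (@wp_while _ _ _ (fun p s' => exists k, [/\ p = (hi - k) * step_cost, I0 s', s'.1 kk 0 = k & k <= hi])) => //.
    by exists l; split=> //; lia.
  move=> p s2 [k [-> [hm2 l2 w2 k2] hkk khi]].
  have ehi : s2.1 iHi 0 = hi by case: hm2 => i [j [_ _ []]].
  split; first by wok.
  rewrite /= hkk ehi eqb0 -leqNgt; case: leqP => [h|h].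
    by split=> //; lia.
  exists (hcost merge_step), ((hi - k.+1) * step_cost); split; last first.
    by rewrite -[in X in _ <= X]subnSK // mulSn /step_cost /=; lia.
  have hkk2 : s2.1 kk 0 < hi by rewrite hkk.
  have /wp_frame := merge_step_ok (leq_ltn_trans hiK hK) lm mh hm2 hkk2.
  move=> /wpW; apply=> // s3 [[hm3 hk3] [hf _]].
  by exists k.+1; split; rewrite ?hk3 ?hkk //; split=> //; rewrite hf.
move=> s2 [[hm2 l2 w2 k2] hk2].
case: hm2 => i [j [[h1 h2 h3 h4] [e1 e2 e3] [e4 e5 eA2] em ex]].
apply: wp_lf => //; rewrite /hset; wstep.
have [ei ej] : i = mid /\ j = hi by lia.
move: em; rewrite ei ej addKn (slice_nil A (leqnn mid)) (slice_nil A (leqnn hi)) cats0 => em.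
case: hc => [|[c0 lc]]; first by lia.
have em2 : slice (arr2 s2) 0 hi = slice (arr2 s) 0 l ++ merge leT (slice A l mid) (slice A mid hi).
  rewrite -em (slice_cat _ (j := l)) //; last by lia.
  by congr (_ ++ _); apply: eq_slice => x hx; apply: ex.
split.
- split=> //=.
  have [->|hn] := eqVneq hi K; [by left|right; exists c0.+1].
  by move: hn; rewrite /hi /mid mulSn lc; lia.
- by [].
- rewrite em2 [in X in perm_eq _ X](slice_cat _ (j := l)) //; last by lia.
  by rewrite perm_cat // perm_merge [in X in perm_eq _ X](slice_cat _ (j := mid)).
- move=> c; rewrite [slice _ _ _](_ : _ = slice (arr2 s2) (c * w.*2) (minn (c.+1 * w.*2) hi)) //.
  case: (ltngtP c c0) => hcc.
  + have hle : c.+1 * w.*2 <= l by rewrite lc leq_mul2r hcc orbT.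
    have -> : minn (c.+1 * w.*2) hi = minn (c.+1 * w.*2) l by lia.
    rewrite (_ : slice (arr2 s2) _ _ = slice (arr2 s) (c * w.*2) (minn (c.+1 * w.*2) l)) //.
    by apply: eq_slice => x hx; apply: ex; lia.
  + rewrite slice_nil //.
    have : c0.+1 * w.*2 <= c * w.*2 by rewrite leq_mul2r hcc orbT.
    by rewrite mulSn -lc /hi /mid; lia.
  (* The new block merges the blocks [c0.*2] and [c0.*2.+1] of width [w], the second of which may be
     short or empty. *)
  + have -> : minn (c.+1 * w.*2) hi = hi by rewrite hcc mulSn -lc /hi /mid; lia.
    rewrite hcc -lc em merge_sorted //; first exact: leT_total.
      have := hA c0.*2.
      rewrite (_ : c0.*2 * w = l); last by rewrite lc; lia.
      by rewrite (_ : minn (c0.*2.+1 * w) K = mid) // mulSn /mid lc; lia.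
    case: (ltnP (l + w) K) => hlw; last first.
      by rewrite slice_nil // /hi /mid; lia.
    have := hA c0.*2.+1.
    rewrite (_ : c0.*2.+1 * w = mid); last by rewrite mulSn /mid lc; lia.
    by rewrite (_ : minn (c0.*2.+2 * w) K = hi) // !mulSn /hi /mid lc; lia.
Qed.

Lemma copy_back_ok s K : s.1 iK 0 = K -> K < Lim ->
  wp copy_back (K * (hcost (HSeq (HI aId (V kk) (XI (EV aId2 (V kk))))
         (HR rKey (V kk) (RV rKey2 (V kk)))) + forc kk (V iK)) + forc kk (V iK))
   (fun s' => [/\ forall x, x < K -> arr s' x = arr2 s x, s'.1 iK 0 = K & s'.1 iW 0 = s.1 iW 0]) s.
Proof.
move=> eK hK.
pose Inv i s' := [/\ forall x, x < i -> arr s' x = arr2 s x, arr2 s' =1 arr2 s,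
  s'.1 iK 0 = K & s'.1 iW 0 = s.1 iW 0].
have lW : Lim <= W by lia.
have KW : K < W by lia.
have L0 : 0 < Lim by lia.
apply: wpW; first apply: (@wp_for R W Lim Inv K _ kk (V iK) _ _ _ _ L0 lW KW) => //.
- by move=> i s1 hi [h1 h2 h3 h4]; wok.
- move=> i s1 hi hk [h1 h2 h3 h4].
  apply: wp_lf => //; do 2!wstep.
  split=> //= x hx; rewrite /arr /rupd /iupd /upd /= hk.
  rewrite -h2; case: (x =P i) => [->|xi] //.
  by rewrite -[LHS]/(arr s1 x) h1 ?h2 //; lia.
- by [].
- by move=> s' [[h1 h2 h3 h4] _].
Qed.

Definition pass_cost (K : nat) :=
  hcost (hset iL (XI (EN 0))) + ((K * (block_cost + step_cost +
    (xcost (XI (EL (V iL) (V iK)))).+2) + (xcost (XI (EL (V iL) (V iK)))).+2) +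
  ((K * (hcost (HSeq (HI aId (V kk) (XI (EV aId2 (V kk))))
         (HR rKey (V kk) (RV rKey2 (V kk)))) + forc kk (V iK)) + forc kk (V iK)) +
  hcost (hset iW (XI (EB IAdd (V iW) (V iW)))))).

Definition sorted_blocks (A : nat -> R * nat) w K :=
  forall c, sorted leT (slice A (c * w) (minn (c.+1 * w) K)).

Lemma merge_pass_ok w K s : 0 < w < K -> K < Lim ->
  s.1 iW 0 = w -> s.1 iK 0 = K -> sorted_blocks (arr s) w K ->
  wp merge_pass (pass_cost K) (fun s' => [/\ s'.1 iW 0 = w.*2, s'.1 iK 0 = K,
     sorted_blocks (arr s') w.*2 K &
     perm_eq (slice (arr s') 0 K) (slice (arr s) 0 K)]) s.
Proof.
move=> hw hK eW eK hs; rewrite /pass_cost.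
apply: (wp_seq (Q1 := pass_inv (arr s) w K 0)).
  apply: wp_lf => //; rewrite /hset; wstep; split=> //.
  by split=> //=; right; exists 0.
move=> s1 h1.
apply: (wp_seq (Q1 := pass_inv (arr s) w K K)).
  apply: (@wp_while _ _ _ (fun p s' => exists l, p = (K - l) * (block_cost + step_cost +
    (xcost (XI (EL (V iL) (V iK)))).+2) /\ pass_inv (arr s) w K l s')) => //.
    by exists 0; rewrite subn0.
  move=> p s2 [l [-> h2]]; have [[lK l2 _] [w2 k2 _] _ _] := h2.
  split; first by wok.
  rewrite /= l2 k2 eqb0 -leqNgt; case: leqP => [h|h].
    have lK2 : l = K by lia.
    by rewrite lK2 in h2.
  have hw2 : 0 < w <= K by lia.
  have [l' ll hwp] := @merge_block_ok (arr s) w K l s2 hw2 hK h hs h2.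
  have [t [s3 [ht htk h3]]] := hwp.
  have l'K : l' <= K by case: h3 => [[]].
  exists (block_cost + (l' - l) * step_cost), ((K - l') * (block_cost + step_cost +
    (xcost (XI (EL (V iL) (V iK)))).+2)); split.
    by apply: wpW hwp _ _ => // s4 h4; exists l'.
  rewrite (_ : K - l = (l' - l) + (K - l')); last by lia.
  rewrite mulnDl [in X in _ <= X]addnC addnC leq_add2l.
  have [d hd] : exists d, l' - l = d.+1 by exists (l' - l).-1; lia.
  rewrite hd; move: (block_cost) (step_cost) => B C; rewrite /=; lia.
move=> s2 [[_ _ _] [w2 k2 _] hp hss].
apply: (wp_seq (copy_back_ok k2 hK)) => s3 [h3 k3 w3].
apply: wp_lf => //; rewrite /hset; wstep; split.
- by rewrite /= /upd /= w3 w2 addnn.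
- by [].
- move=> c; rewrite (_ : slice _ _ _ = slice (arr2 s2) (c * w.*2) (minn (c.+1 * w.*2) K)) //.
  by apply: eq_slice => x hx; rewrite -[LHS]/(arr s3 x) h3 //; lia.
- rewrite (_ : slice (arr _) 0 K = slice (arr2 s2) 0 K) //.
  by apply: eq_slice => x hx; rewrite -[LHS]/(arr s3 x) h3.
Qed.

Definition sort_cost (E K : nat) :=
  hcost (hset iW (XI (EN 1))) + (E * (pass_cost K + (xcost (XI (EL (V iW) (V iK)))).+2)
    + (xcost (XI (EL (V iW) (V iK)))).+2).

(** The block width doubles in each pass, so [E] passes suffice once [K <= 2 ^ E]. *)
Lemma sort_ok E K s : K <= 2 ^ E -> K < Lim -> s.1 iK 0 = K ->
  wp sort_code (sort_cost E K) (fun s' => [/\ s'.1 iK 0 = K,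
     sorted leT (slice (arr s') 0 K) &
     perm_eq (slice (arr s') 0 K) (slice (arr s) 0 K)]) s.
Proof.
move=> hE hK eK; rewrite /sort_cost.
apply: (wp_seq (Q1 := fun s' => [/\ s'.1 iW 0 = 1, s'.1 iK 0 = K & arr s' = arr s])).
  by apply: wp_lf => //; rewrite /hset; wstep.
move=> s1 [w1 k1 a1].
apply: (@wp_while _ _ _ (fun p s' => exists e, [/\ e <= E, p = (E - e) * (pass_cost K +
   (xcost (XI (EL (V iW) (V iK)))).+2), s'.1 iW 0 = 2 ^ e, s'.1 iK 0 = K &
   sorted_blocks (arr s') (2 ^ e) K /\ perm_eq (slice (arr s') 0 K) (slice (arr s) 0 K)])) => //.
  exists 0; split=> //; first by rewrite subn0.
  rewrite a1; split=> // c; rewrite expn0 !muln1.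
  case: (ltnP c K) => h; last by rewrite slice_nil //; lia.
  by rewrite (_ : minn _ _ = c.+1) ?slice_rcons ?slice_nil //; lia.
move=> p s2 [e [heE -> w2 k2 [hs hp]]]; split; first by wok.
rewrite /= w2 k2 eqb0 -leqNgt; case: leqP => [h|h].
  split=> //; have := hs 0; rewrite mul0n (_ : minn _ _ = K) //; lia.
have heE' : e < E by rewrite -(@ltn_exp2l 2) //; apply: leq_trans hE.
exists (pass_cost K), ((E - e.+1) * (pass_cost K + (xcost (XI (EL (V iW) (V iK)))).+2)).
split; last first.
  by rewrite -[in X in _ <= X]subnSK // mulSn; move: (pass_cost K) => B; rewrite /=; lia.
have := @merge_pass_ok (2 ^ e) K s2 _ hK w2 k2 hs; rewrite expn_gt0 h => /(_ isT).
move=> /wpW; apply=> // s3 [w3 k3 hs3 hp3].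
exists e.+1; split=> //; first by rewrite w3 expnS mul2n.
split; first by rewrite expnS mul2n.
exact: perm_trans hp3 hp.
Qed.

End Sort.

(** * Sweeping a curve of configurations *)

Section Code.
Variable R : realType.
Implicit Types (p q x : R * R).

(** Twice the signed area of the triangle p q x, positive when [x] is to the left of the line from
    [p] to [q]. *)
Definition crossp p q x := (q.1 - p.1) * (x.2 - p.2) - (q.2 - p.2) * (x.1 - p.1).

Definition between (u v w : R) := (u <= w <= v) || (v <= w <= u).

Definition on_edge p q x :=
  [&& crossp p q x == 0, between p.1 q.1 x.1 & between p.2 q.2 x.2].

(* The half-open convention [p.2 <= x.2 < q.2] makes a vertex on the rightward
   ray count once when the polygon crosses the ray there, and 0 or 2 times
   otherwise. *)
Definition ray_edge p q x :=
  ((p.2 <= x.2 < q.2) && (0 < crossp p q x)) ||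
  ((q.2 <= x.2 < p.2) && (crossp p q x < 0)).

(** Encoded so that the sum over the [m] edges tells everything: it is at least [m.*2] iff some edge
    contains the point, since the ray contributes at most [m]; otherwise its parity is that of the
    crossed edges. Such a sum can be updated edge by edge. *)
Definition ecode (m : nat) p q x : nat :=
  if on_edge p q x then m.*2 else ray_edge p q x.

(* A configuration is the triple (cos, sin, t) of a rotation about a + t d. *)
Definition img (a d : R * R) (k : R * R * R) (v : R * R) : R * R :=
  let r1 := a.1 + k.2 * d.1 in
  let r2 := a.2 + k.2 * d.2 in
  (r1 + (k.1.1 * (v.1 - r1) - k.1.2 * (v.2 - r2)),
   r2 + (k.1.1 * (v.2 - r2) + k.1.2 * (v.1 - r1))).

Definition quad (pc : nat -> R) (k : nat) (u : R) :=
  pc (3 * k)%N + u * (pc (3 * k).+1 + u * pc (3 * k).+2).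

(** Where the curve is undefined or leaves the segment, a fixed valid configuration takes its place,
    so that all real [u] can be swept. *)
Definition confu (pc : nat -> R) (u : R) : R * R * R :=
  if (quad pc 4 u == 0) || (quad pc 3 u / quad pc 4 u < 0) ||
     (1 < quad pc 3 u / quad pc 4 u)
  then (1, 0, 0)
  else (quad pc 0 u / quad pc 2 u, quad pc 1 u / quad pc 2 u,
        quad pc 3 u / quad pc 4 u).

End Code.

(** The input is kept in the array [rIN] from the index [iOff] on: this offset places the copies
    above all cells of the original input, so that copying never overwrites a coordinate not yet
    read. *)
Definition inp e := RV rIN (EB IAdd (V iOff) e).
Definition eA1 := inp (EN 0). Definition eA2 := inp (EN 1).
Definition eB1 := inp (EN 2). Definition eB2 := inp (EN 3).
Definition eS1 e := inp (EB IAdd (EN 4) (EB IMul (EN 2) e)).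
Definition eS2 e := inp (EB IAdd (EN 5) (EB IMul (EN 2) e)).
Definition eP1 e := inp (EB IAdd (EN 4) (EB IMul (EN 2) (EB IAdd (V iN) e))).
Definition eP2 e := inp (EB IAdd (EN 5) (EB IMul (EN 2) (EB IAdd (V iN) e))).

Definition radd := RB RAdd. Definition rsub := RB RSub.
Definition rmul := RB RMul. Definition rdiv := RB RDiv.
Definition eD1 := rsub eB1 eA1. Definition eD2 := rsub eB2 eA2.

Definition xnot x := XB ISub (XI (EN 1)) x.
Definition xand x y := XB IMul x y.
Definition xor x y := xnot (xand (xnot x) (xnot y)).
Definition xle x y := xnot (XL y x).
Definition xbetween u v w := xor (xand (xle u w) (xle w v)) (xand (xle v w) (xle w u)).

Definition set_ij :=
  HSeq (hset iI (XI (EB IDiv (V iQ) (V iM))))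
 (HSeq (hset iJ (XI (EB IMod (V iQ) (V iM))))
       (hset iJ2 (XI (EB IMod (EB IAdd (V iJ) (EN 1)) (V iM))))).

Definition ptp1 := eP1 (V iJ). Definition ptp2 := eP2 (V iJ).
Definition ptq1 := eP1 (V iJ2). Definition ptq2 := eP2 (V iJ2).

Definition set_x :=
  let r1 := radd eA1 (rmul (RVr rT) eD1) in
  let r2 := radd eA2 (rmul (RVr rT) eD2) in
  let v1 := rsub (eS1 (V iI)) r1 in
  let v2 := rsub (eS2 (V iI)) r2 in
  HSeq (rset_ rX1 (radd r1 (rsub (rmul (RVr rC) v1) (rmul (RVr rS) v2))))
 (HSeq (rset_ rX2 (radd r2 (radd (rmul (RVr rC) v2) (rmul (RVr rS) v1))))
       (rset_ rD (rsub (rmul (rsub ptq1 ptp1) (rsub (RVr rX2) ptp2))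
                       (rmul (rsub ptq2 ptp2) (rsub (RVr rX1) ptp1))))).

Definition xon :=
  xand (XE (RVr rD) (RN 0))
    (xand (xbetween ptp1 ptq1 (RVr rX1)) (xbetween ptp2 ptq2 (RVr rX2))).

Definition xray :=
  xor (xand (xand (xle ptp2 (RVr rX2)) (XL (RVr rX2) ptq2)) (XL (RN 0) (RVr rD)))
      (xand (xand (xle ptq2 (RVr rX2)) (XL (RVr rX2) ptp2)) (XL (RVr rD) (RN 0))).

Definition set_z :=
  hset iZ (XB IAdd (XB IMul xon (XI (EB IMul (EN 2) (V iM))))
                   (XB IMul (xnot xon) xray)).

(** The disjunction [cont] in 0/1 arithmetic: 1 minus the product of the negations. *)
Definition xcont e :=
  XB ISub (XI (EN 1))
   (XB IMul (XI (EL e (EB IMul (EN 2) (V iM))))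
            (XB ISub (XI (EN 1)) (XI (EB IMod e (EN 2))))).

(** A change of one code affects the verdict on one point only: its old verdict leaves the total
    before the sum of the point is corrected, and the new one enters afterwards. This takes constant
    time. *)
Definition set_agg :=
  HSeq (hset iAg (XI (EV aAgg (V iI))))
 (HSeq (hset iTot (XB ISub (XI (V iTot)) (xcont (V iAg))))
 (HSeq (hset iAg (XI (EB IAdd (EB ISub (V iAg) (EV aCode (V iQ))) (V iZ))))
 (HSeq (HI aAgg (V iI) (XI (V iAg)))
 (HSeq (HI aCode (V iQ) (XI (V iZ)))
       (hset iTot (XB IAdd (XI (V iTot)) (xcont (V iAg)))))))).

Definition upd_atom := HSeq set_ij (HSeq set_x (HSeq set_z set_agg)).

Section Sweep.
Variables (R : realType) (n m : nat) (W Lim : nat).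
Variables (S P : seq (R * R)) (a b : R * R).
Local Open Scope nat_scope.
Hypotheses (n0 : 0 < n) (m3 : 2 < m).
(** The longest lists are those of the 32nm events. The quadratic term of [hW] makes room for the
    sums of codes, which are at most [m.*2 * m]. *)
Hypothesis hLim : Lim = 64 * (n * m).
Hypothesis hW : 16 * (n * m) ^ 2 + 256 * (n * m) < W.
Notation ast := (ast R).
Notation wp := (@wp R W Lim).
Implicit Types (s : ast).

Let d : R * R := (b.1 - a.1, b.2 - a.2)%R.
Notation off := (6 * (n * m)).

Record Env s : Prop := {
  EnvN : s.1 iN 0 = n; EnvM : s.1 iM 0 = m; EnvNM : s.1 iNM 0 = n * m;
  EnvOff : s.1 iOff 0 = off; EnvK : s.1 iK 0 = 32 * (n * m);
  EnvA1 : s.2 rIN (off + 0) = a.1; EnvA2 : s.2 rIN (off + 1) = a.2;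
  EnvB1 : s.2 rIN (off + 2) = b.1; EnvB2 : s.2 rIN (off + 3) = b.2;
  EnvS1 : forall i, i < n -> s.2 rIN (off + (4 + 2 * i)) = (nth (0, 0)%R S i).1;
  EnvS2 : forall i, i < n -> s.2 rIN (off + (5 + 2 * i)) = (nth (0, 0)%R S i).2;
  EnvP1 : forall j, j < m -> s.2 rIN (off + (4 + 2 * (n + j))) = (nth (0, 0)%R P j).1;
  EnvP2 : forall j, j < m -> s.2 rIN (off + (5 + 2 * (n + j))) = (nth (0, 0)%R P j).2 }.

Lemma Env_framed li lr s s' : framed li lr s s' ->
  all (fun x => x \notin li) [:: iN; iM; iNM; iOff; iK] && (rIN \notin lr) ->
  Env s -> Env s'.
Proof.
move=> [h1 h2] /andP[/= /and5P[k1 k2 k3 k4 /andP[k5 _]] k6] [*].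
by split; rewrite ?(h1 _ k1, h1 _ k2, h1 _ k3, h1 _ k4, h1 _ k5, h2 _ k6).
Qed.

Lemma wp_env c k Q s :
  all (fun x => x \notin imods c) [:: iN; iM; iNM; iOff; iK] && (rIN \notin rmods c) ->
  Env s -> wp c k Q s ->
  wp c k (fun s' => [/\ Env s', Q s' & framed (imods c) (rmods c) s s']) s.
Proof.
move=> h hE /wp_frame hw; apply: wpW hw _ _ => // s' [hq hf]; split=> //.
exact: Env_framed hf h hE.
Qed.

Lemma dims : [/\ n <= n * m, m <= n * m, 3 <= n * m & n + m <= n * m + 1].
Proof. split; nia. Qed.

Lemma bounds : [/\ 64 * (n * m) = Lim, 256 * (n * m) < W, 0 < W & 4 * m ^ 2 + 4 * m < W].
Proof. have [h1 h2 h3 h4] := dims; split; nia. Qed.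

Lemma set_ij_ok s : Env s -> s.1 iQ 0 < n * m ->
  wp set_ij (hcost set_ij) (fun s' => [/\ s'.1 iI 0 = s.1 iQ 0 %/ m,
     s'.1 iJ 0 = s.1 iQ 0 %% m & s'.1 iJ2 0 = (s.1 iQ 0 %% m).+1 %% m]) s.
Proof.
move=> hE hq; have [h1 h2 h3 h4] := dims; have [h5 h6 h7 h8] := bounds.
have m0 : 0 < m by lia.
have eM := EnvM hE.
have l1 : s.1 iQ 0 %/ m <= s.1 iQ 0 by exact: leq_div.
have l2 : s.1 iQ 0 %% m < m by exact: ltn_pmod.
have l3 : (s.1 iQ 0 %% m).+1 %% m < m by exact: ltn_pmod.
apply: wp_lf => //; rewrite /set_ij /hset.
do 3![apply: And4; [by wok | by wok | by rewrite /= ?nidsE /upd /= ?eM ?addn1; do !split => //; lia | ]].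
by rewrite /= /upd /= eM addn1.
Qed.

Definition cconf s : R * R * R := (s.2 rC 0, s.2 rS 0, s.2 rT 0).

Notation Sat i := (nth (0, 0)%R S i).
Notation Pat j := (nth (0, 0)%R P j).

Ltac facts hE :=
  have [h1 h2 h3 h4] := dims; have [h5 h6 h7 h8] := bounds;
  have eN := EnvN hE; have eM := EnvM hE; have eNM := EnvNM hE;
  have eOff := EnvOff hE; have eK := EnvK hE.

Lemma set_x_ok s i j j2 : Env s -> s.1 iI 0 = i -> s.1 iJ 0 = j ->
  s.1 iJ2 0 = j2 -> i < n -> j < m -> j2 < m ->
  wp set_x (hcost set_x) (fun s' =>
    [/\ (s'.2 rX1 0, s'.2 rX2 0) = img a d (cconf s) (Sat i) &
        s'.2 rD 0 = crossp (Pat j) (Pat j2) (img a d (cconf s) (Sat i))]) s.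
Proof.
move=> hE eI eJ eJ2 hi hj hj2; facts hE.
apply: wp_lf => //; rewrite /set_x /rset_ /hset.
wstep. wstep. wstep.
rewrite /= /upd /= eN eOff eI eJ eJ2.
rewrite (EnvA1 hE) (EnvA2 hE) (EnvB1 hE) (EnvB2 hE) (EnvS1 hE) // (EnvS2 hE) //.
by rewrite (EnvP1 hE) // (EnvP2 hE) // (EnvP1 hE) // (EnvP2 hE).
Qed.

Definition xbool s x (u : bool) := xok W Lim s x /\ xeval s x = u.

Lemma xbool_not s x u : xbool s x u -> xbool s (xnot x) (~~ u).
Proof.
have [b1 b2 b3 b4] := bounds; have [b5 b6 b7 b8] := dims; move=> [? e]; rewrite /xbool /= e.
by split; [split=> //; case: u {e}; lia|case: u {e}].
Qed.

Lemma xbool_and s x y u v : xbool s x u -> xbool s y v -> xbool s (xand x y) (u && v).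
Proof.
have [b1 b2 b3 b4] := bounds; have [b5 b6 b7 b8] := dims; move=> [? e] [? e']; rewrite /xbool /= e e'.
by split; [split=> //; case: u {e}; case: v {e'}; lia|case: u {e}; case: v {e'}].
Qed.

Lemma xbool_or s x y u v : xbool s x u -> xbool s y v -> xbool s (xor x y) (u || v).
Proof.
move=> /xbool_not hx /xbool_not hy.
by rewrite -[u || v]negbK negb_or; apply/xbool_not/xbool_and.
Qed.

Definition rval s x r := rok W Lim s x /\ reval s x = r.

Lemma xbool_lt s x y u v : rval s x u -> rval s y v -> xbool s (XL x y) (u < v)%R.
Proof. by move=> [? <-] [? <-]. Qed.

Lemma xbool_eq s x y u v : rval s x u -> rval s y v -> xbool s (XE x y) (u == v)%R.
Proof. by move=> [? <-] [? <-]. Qed.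

Lemma xbool_le s x y u v : rval s x u -> rval s y v -> xbool s (xle x y) (u <= v)%R.
Proof. by move=> hx hy; rewrite leNgt; apply/xbool_not/xbool_lt. Qed.

Lemma xbool_between s x y z u v w : rval s x u -> rval s y v -> rval s z w ->
  xbool s (xbetween x y z) (between u v w).
Proof. by move=> *; apply: xbool_or; apply: xbool_and; apply: xbool_le. Qed.

Lemma set_z_ok s j j2 x : Env s -> s.1 iJ 0 = j -> s.1 iJ2 0 = j2 ->
  j < m -> j2 < m -> (s.2 rX1 0, s.2 rX2 0) = x ->
  s.2 rD 0 = crossp (Pat j) (Pat j2) x ->
  wp set_z (hcost set_z) (fun s' => s'.1 iZ 0 = ecode m (Pat j) (Pat j2) x) s.
Proof.
move=> hE eJ eJ2 hj hj2 eX eD; facts hE.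
have ep1 : rval s ptp1 (Pat j).1 by split; [wok|rewrite /= eN eOff eJ (EnvP1 hE)].
have ep2 : rval s ptp2 (Pat j).2 by split; [wok|rewrite /= eN eOff eJ (EnvP2 hE)].
have eq1 : rval s ptq1 (Pat j2).1 by split; [wok|rewrite /= eN eOff eJ2 (EnvP1 hE)].
have eq2 : rval s ptq2 (Pat j2).2 by split; [wok|rewrite /= eN eOff eJ2 (EnvP2 hE)].
have ex1 : rval s (RVr rX1) x.1 by split; [wok|rewrite -eX].
have ex2 : rval s (RVr rX2) x.2 by split; [wok|rewrite -eX].
have eDD : rval s (RVr rD) (crossp (Pat j) (Pat j2) x) by split; [wok|].
have e0 : rval s (RN 0) 0%R by [].
have [okon hon] : xbool s xon (on_edge (Pat j) (Pat j2) x).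
  by apply: xbool_and; [apply: xbool_eq|apply: xbool_and; apply: xbool_between].
have [okray hray] : xbool s xray (ray_edge (Pat j) (Pat j2) x).
  apply: xbool_or; (apply: xbool_and; [apply: xbool_and; [exact: xbool_le|exact: xbool_lt]|exact: xbool_lt]).
have [oknot hnot] : xbool s (xnot xon) (~~ on_edge (Pat j) (Pat j2) x).
  exact: xbool_not.
have hz : xeval s (XB IAdd (XB IMul xon (XI (EB IMul (EN 2) (V iM))))
            (XB IMul (xnot xon) xray)) = ecode m (Pat j) (Pat j2) x.
  rewrite -[LHS]/(xeval s xon * (2 * s.1 iM 0) + xeval s (xnot xon) * xeval s xray).
  rewrite hon hnot hray eM /ecode; case: ifP => _ /=; [lia|by case: ray_edge].
have cM : ecode m (Pat j) (Pat j2) x <= m.*2.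
  by rewrite /ecode; case: ifP => // _; case: ray_edge; lia.
apply: wp_lf => //; rewrite /set_z /hset.
apply: And4.
- by wok.
- by wok.
- split; last by rewrite -[_ < _]/(xeval s (XB IAdd (XB IMul xon (XI (EB IMul (EN 2) (V iM))))
            (XB IMul (xnot xon) xray)) < W) hz; lia.
  + split=> //; first by wok.
    rewrite -[_ < _]/(xeval s xon * (2 * s.1 iM 0) < W) hon eM; case: (on_edge _ _ _); lia.
  + split=> //.
    rewrite -[_ < _]/(xeval s (xnot xon) * xeval s xray < W) hnot hray.
    by case: (on_edge _ _ _); case: ray_edge; lia.
- by rewrite hz.
Qed.

Definition cont (A : nat) : bool := (m.*2 <= A) || odd A.

(** Consistency of the sums and of the total with the stored codes, whatever configuration these
    codes belong to. *)
Record cons s : Prop := {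
  consA : forall i, i < n -> s.1 aAgg i = \sum_(j < m) s.1 aCode (i * m + j);
  consT : s.1 iTot 0 = \sum_(i < n) cont (s.1 aAgg i);
  consC : forall q, q < n * m -> s.1 aCode q <= m.*2 }.

Lemma set_agg_ok s i q : Env s -> cons s -> s.1 iI 0 = i -> s.1 iQ 0 = q ->
  q < n * m -> i = q %/ m -> s.1 iZ 0 <= m.*2 ->
  wp set_agg (hcost set_agg) (fun s' => cons s' /\
    s'.1 aCode = fun q' => if q' == q then s.1 iZ 0 else s.1 aCode q') s.
Proof.
move=> hE [hA hT hC] eI eQ hq iq hz; facts hE.
have m0 : 0 < m by lia.
have hi : i < n by rewrite iq ltn_divLR.
have hj : q %% m < m by rewrite ltn_mod.
have qE : q = i * m + q %% m by rewrite iq -divn_eq.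
have hAi := hA i hi.
have sE : \sum_(j < m) s.1 aCode (i * m + j) = s.1 aCode q +
    \sum_(j < m | j != Ordinal hj) s.1 aCode (i * m + j).
  by rewrite (bigD1 (Ordinal hj)) //= -qE.
have hcq : s.1 aCode q <= s.1 aAgg i by rewrite hAi sE leq_addr.
have hAb : s.1 aAgg i <= m.*2 * m.
  have <- : \sum_(j < m) m.*2 = m.*2 * m by rewrite sum_nat_const card_ord mulnC.
  rewrite hAi leq_sum // => j _.
  by apply: hC; have := ltn_ord j; nia.
have hA4 : s.1 aAgg i + m.*2 < W by move: hAb; nia.
have tE : \sum_(k < n) cont (s.1 aAgg k) = cont (s.1 aAgg i) +
    \sum_(k < n | k != Ordinal hi) cont (s.1 aAgg k).
  by rewrite (bigD1 (Ordinal hi)).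
have tB : \sum_(k < n | k != Ordinal hi) cont (s.1 aAgg k) <= n.
  have e1 : \sum_(k < n) 1 = n by rewrite sum_nat_const card_ord muln1.
  rewrite (bigD1 (Ordinal hi)) //= in e1.
  apply: leq_trans (_ : \sum_(k < n | k != Ordinal hi) 1 <= _); last exact: leq_trans (leq_addl 1 _) (eq_leq e1).
  by apply: leq_sum => k _; case: cont.
have contE A : 1 - (A < 2 * m) * (1 - A %% 2) = cont A.
  by rewrite /cont modn2 mul2n ltnNge; case: leqP; case: odd.
have [A' hA1] : exists A', A' = s.1 aAgg i - s.1 aCode q + s.1 iZ 0 by eexists.
have [T0 hT0] : exists T0, T0 = \sum_(k < n | k != Ordinal hi) cont (s.1 aAgg k) by eexists.
rewrite -hT0 in tE tB.
have hT' : s.1 iTot 0 = cont (s.1 aAgg i) + T0 by rewrite hT tE.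
have cA : cont (s.1 aAgg i) <= 1 by case: cont.
have cA' : cont A' <= 1 by case: cont.
have hA' : A' <= s.1 aAgg i + m.*2 by lia.
have tE' : \sum_(k < n) cont (if (k : nat) == i then A' else s.1 aAgg k) = T0 + cont A'.
  rewrite (bigD1 (Ordinal hi)) //= eqxx addnC hT0; congr (_ + _).
  by apply: eq_bigr => k; rewrite -val_eqE /= => /negbTE ->.
have T1W : T0 + 1 < W by lia.
Ltac wstepA eI eQ eM contE :=
  apply: And4; [by wok | by rewrite /= /upd /= ?eI ?eQ; lia |
   by rewrite /= ?nidsE /upd /= ?eI ?eQ ?eM ?contE; do !split => //; try lia |].
apply: wp_lf => //; rewrite /set_agg /hset.
do 6!(wstepA eI eQ eM contE).
rewrite /iupd /upd /= eI eQ eM !contE -!hA1; split; last first.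
  by apply: funext => q'; case: (q' == q).
split.
- move=> i' hi' /=; case: eqP => [->|ii'].
    rewrite hA1 hAi sE addKn [RHS](bigD1 (Ordinal hj)) //= -qE eqxx addnC.
    congr (_ + _); apply: eq_bigr => j; rewrite -val_eqE /= => /negbTE jq.
    by rewrite ifF // {1}qE eqn_add2l.
  rewrite hA //; apply: eq_bigr => j _; rewrite ifF //; apply/eqP => jq.
  by apply: ii'; rewrite iq -jq divnMDl // divn_small // addn0.
- by rewrite /= tE' hT'; lia.
- by move=> q' hq' /=; case: eqP => // _; apply: hC.
Qed.

Definition cd (q : nat) k : nat :=
  ecode m (Pat (q %% m)) (Pat ((q %% m).+1 %% m)) (img a d k (Sat (q %/ m))).

Lemma cd_le q k : cd q k <= m.*2.
Proof. by rewrite /cd /ecode; case: ifP => // _; case: ray_edge; lia. Qed.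

Lemma cons_framed li lr s s' : framed li lr s s' ->
  all (fun x => x \notin li) [:: aAgg; aCode; iTot] -> cons s -> cons s'.
Proof.
move=> [h1 _] /= /and4P[k1 k2 k3 _] [*].
by split; rewrite ?(h1 _ k1, h1 _ k2, h1 _ k3).
Qed.

Lemma upd_atom_ok s q : Env s -> cons s -> s.1 iQ 0 = q -> q < n * m ->
  wp upd_atom (hcost upd_atom) (fun s' => [/\ Env s', cons s',
     s'.1 aCode = fun q' => if q' == q then cd q (cconf s) else s.1 aCode q' &
     framed (imods upd_atom) (rmods upd_atom) s s']) s.
Proof.
move=> hE hc eQ hq.
have m0 : 0 < m by lia.
have hi : q %/ m < n by rewrite ltn_divLR.
have hj : q %% m < m by rewrite ltn_mod.
have hj2 : (q %% m).+1 %% m < m by rewrite ltn_mod.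
suff h : wp upd_atom (hcost upd_atom) (fun s' => cons s' /\
     s'.1 aCode = fun q' => if q' == q then cd q (cconf s) else s.1 aCode q') s.
  by apply: wpW (wp_env _ hE h) _ _ => // s' [? [? ?] ?].
have hq' : s.1 iQ 0 < n * m by rewrite eQ.
apply: (wp_seq (wp_env _ hE (set_ij_ok hE hq'))) => // s1 [hE1 [e1 e2 e3] f1].
have hc1 := cons_framed f1 isT hc; rewrite eQ in e1 e2 e3.
apply: (wp_seq (wp_env _ hE1 (set_x_ok hE1 e1 e2 e3 hi hj hj2))) => // s2 [hE2 [e4 e5] f2].
have hc2 := cons_framed f2 isT hc1.
have k1 : s2.1 iI 0 = q %/ m by rewrite (f2.1 iI).
have k2 : s2.1 iJ 0 = q %% m by rewrite (f2.1 iJ).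
have k3 : s2.1 iJ2 0 = (q %% m).+1 %% m by rewrite (f2.1 iJ2).
apply: (wp_seq (wp_env _ hE2 (set_z_ok hE2 k2 k3 hj hj2 e4 e5))) => // s3 [hE3 e6 f3].
have hc3 := cons_framed f3 isT hc2.
have cc : cconf s1 = cconf s.
  by rewrite /cconf (f1.2 rC) // (f1.2 rS) // (f1.2 rT).
rewrite cc -/(cd q (cconf s)) in e6.
have k4 : s3.1 iI 0 = q %/ m by rewrite (f3.1 iI).
have k5 : s3.1 iQ 0 = q by rewrite (f3.1 iQ) // (f2.1 iQ) // (f1.1 iQ).
have hz : s3.1 iZ 0 <= m.*2 by rewrite e6 cd_le.
apply: wpW (set_agg_ok hE3 hc3 k4 k5 hq (erefl _) hz) _ _ => // s4 [hc4 ->].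
split=> //; rewrite e6; apply: funext => q'; case: ifP => // _.
by rewrite (f3.1 aCode) // (f2.1 aCode) // (f1.1 aCode).
Qed.

End Sweep.

(** * Sweep over the sorted events *)

Definition check :=
  HIf (XI (EL (V iBest) (V iTot)))
    (HSeq (hset iBest (XI (V iTot)))
    (HSeq (rset_ rBC (RVr rC)) (HSeq (rset_ rBS (RVr rS)) (rset_ rBT (RVr rT)))))
    HSkip.

Definition equad (k : nat) :=
  radd (RV rPC (EN (3 * k)))
    (rmul (RVr rU) (radd (RV rPC (EN (3 * k).+1))
                         (rmul (RVr rU) (RV rPC (EN (3 * k).+2))))).

Definition junk_conf :=
  HSeq (rset_ rC (RN 1)) (HSeq (rset_ rS (RN 0)) (rset_ rT (RN 0))).

Definition setconf :=
  HIf (XE (equad 4) (RN 0)) junk_conf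
   (HSeq (rset_ rT (rdiv (equad 3) (equad 4)))
   (HIf (xor (XL (RVr rT) (RN 0)) (XL (RN 1) (RVr rT))) junk_conf
     (HSeq (rset_ rC (rdiv (equad 0) (equad 2)))
           (rset_ rS (rdiv (equad 1) (equad 2)))))).

Definition visit_step :=
  HSeq (hset iQ (XI (EV aId (V iE)))) (HSeq upd_atom (incr iE)).

Definition visit :=
  HSeq (hset iE (XI (V iG))) (HWhile (XI (EL (V iE) (V iH))) visit_step).

Definition probe := HSeq setconf (HSeq visit check).

Definition scan :=
  HSeq (rset_ rU (RV rKey (V iG)))
 (HSeq (hset iH (XI (V iG)))
       (HWhile (XB IMul (XI (EL (V iH) (V iK))) (XE (RV rKey (V iH)) (RVr rU)))
          (incr iH))).

Definition next_u :=
  HIf (XI (EL (V iH) (V iK)))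
    (rset_ rU (rdiv (radd (RVr rU) (RV rKey (V iH))) (RN 2)))
    (rset_ rU (radd (RVr rU) (RN 1))).

(** Simultaneous events are treated as one group. Their atoms (pairs of a point and an edge) are
    recomputed at the event value and again in the gap after it; all other atoms keep their codes at
    both places. *)
Definition sweep_step :=
  HSeq scan (HSeq probe (HSeq next_u (HSeq probe (hset iG (XI (V iH)))))).

(** The first probe is taken before all events and visits the whole event list, in which every atom
    occurs, so it initialises all codes. *)
Definition sweep_init :=
  HSeq (rset_ rU (rsub (RV rKey (EN 0)) (RN 1)))
 (HSeq (hset iG (XI (EN 0))) (hset iH (XI (V iK)))).

Definition sweep :=
  HSeq sweep_init (HSeq probe (HWhile (XI (EL (V iG) (V iK))) sweep_step)).

Section Sweep2.
Variables (R : realType) (n m : nat) (W Lim : nat).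
Variables (S P : seq (R * R)) (a b : R * R).
Local Open Scope nat_scope.
Hypotheses (n0 : 0 < n) (m3 : 2 < m).
Hypothesis hLim : Lim = 64 * (n * m).
Hypothesis hW : 16 * (n * m) ^ 2 + 256 * (n * m) < W.
Notation ast := (ast R).
Notation wp := (@wp R W Lim).
Notation Env := (Env n m S P a b).
Notation cons := (@cons R n m).
Notation cd := (cd m S P a b).
Implicit Types (s : ast).
Notation K := (32 * (n * m)).
Let bnd := bounds n0 m3 hLim hW.
Let dim := dims n0 m3 hLim hW.

Ltac facts2 hE :=
  have [h1 h2 h3 h4] := dim; have [h5 h6 h7 h8] := bnd;
  have eN := EnvN hE; have eM := EnvM hE; have eNM := EnvNM hE;
  have eOff := EnvOff hE; have eK := EnvK hE.

Definition cnt k : nat := \sum_(i < n) cont m (\sum_(j < m) cd (i * m + j) k).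

Definition validk (k : R * R * R) :=
  (k.1.1 ^+ 2 + k.1.2 ^+ 2 = 1)%R /\ (0 <= k.2 <= 1)%R.

Definition bconf s : R * R * R := (s.2 rBC 0, s.2 rBS 0, s.2 rBT 0).

(** An inequality, so that it holds with [iBest = 0] before any configuration has been counted. *)
Definition bestinv s := s.1 iBest 0 <= cnt (bconf s) /\ validk (bconf s).

Definition right s k := forall q, q < n * m -> s.1 aCode q = cd q k.

Lemma right_tot s k : cons s -> right s k -> s.1 iTot 0 = cnt k.
Proof.
move=> [hA hT _] hr; rewrite hT; apply: eq_bigr => i _; rewrite hA //.
congr (cont _ _ : nat); apply: eq_bigr => j _; apply: hr.
by have := ltn_ord i; have := ltn_ord j; nia.
Qed.

(** The stored codes determine the count. This transfers the result of one probe to the whole gap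
    that it represents. *)
Lemma right_cnt s k k' : right s k -> right s k' -> cnt k = cnt k'.
Proof.
move=> h h'; apply: eq_bigr => i _; congr (cont _ _ : nat); apply: eq_bigr => j _.
have hq : i * m + j < n * m by have := ltn_ord i; have := ltn_ord j; nia.
by rewrite -h // -h'.
Qed.

Lemma cnt_le k : cnt k <= n.
Proof.
have e1 : \sum_(i < n) 1 = n by rewrite sum_nat_const card_ord muln1.
rewrite -[X in _ <= X]e1.
by apply: leq_sum => i _; case: cont.
Qed.

Lemma check_ok s : Env s -> cons s -> right s (cconf s) -> validk (cconf s) ->
  bestinv s ->
  wp check (hcost check) (fun s' => [/\ bestinv s', cnt (cconf s) <= s'.1 iBest 0 &
     s.1 iBest 0 <= s'.1 iBest 0]) s.
Proof.
move=> hE hc hr hv hb; facts2 hE.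
have tE := right_tot hc hr; have cn := cnt_le (cconf s).
apply: wp_lf => //; rewrite /check /rset_ /hset; split; first by wok.
rewrite /= tE eqb0 -leqNgt; case: (leqP (cnt (cconf s)) (s.1 iBest 0)) => [h|h] //.
do 4!wstep.
rewrite /bestinv /bconf /iupd /rupd /upd /=.
by split=> //; exact: ltnW.
Qed.

Lemma equad_ok s k : k < 5 ->
  rval W Lim s (equad k) (quad (s.2 rPC) k (s.2 rU 0)).
Proof.
move=> hk; have [h1 h2 h3 h4] := dim; have [h5 h6 h7 h8] := bnd.
by split=> //; wok.
Qed.

Lemma setconf_ok s : Env s -> (forall u, quad (s.2 rPC) 2 u <> 0%R) ->
  wp setconf (hcost setconf)
    (fun s' => cconf s' = confu (s.2 rPC) (s.2 rU 0)) s.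
Proof.
move=> hE hw; facts2 hE.
apply: wp_lf => //; rewrite /setconf /confu.
have q4 := @equad_ok s 4 isT; have q3 := @equad_ok s 3 isT.
have z0 : rval W Lim s (RN 0) 0%R by [].
have [ok1 e1] := xbool_eq q4 z0.
split=> //; rewrite {1}e1; case: (quad _ 4 _ =P 0%R) => h4z.
  rewrite [orb _ _]/= /junk_conf /rset_; do 3!wstep.
  by rewrite /cconf /rupd /upd /= .
have [okT3 eT3] := q3; have [okT4 eT4] := q4.
rewrite [if _ then _ else _]/=.
split.
- by wok.
- by wok.
- by split=> //; rewrite eT4.
rewrite [reval s _](_ : _ = quad (s.2 rPC) 3 (s.2 rU 0) / quad (s.2 rPC) 4 (s.2 rU 0))%R; last first.
  by rewrite -eT3 -eT4.
set t := (_ / _)%R; rewrite [ieval _ _]/=.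
set s1 := rupd s rT 0 t.
have rT1 : rval W Lim s1 (RVr rT) t by split; [wok|rewrite /= /upd].
have zz0 : rval W Lim s1 (RN 0) 0%R by [].
have zz1 : rval W Lim s1 (RN 1) 1%R by [].
have [ok2 e2] : xbool W Lim s1 (xor (XL (RVr rT) (RN 0)) (XL (RN 1) (RVr rT))) ((t < 0) || (1 < t))%R.
  by apply: (xbool_or n0 m3 hLim hW); apply: xbool_lt.
split=> //; rewrite {1}e2; case hb: ((t < 0) || (1 < t))%R.
  rewrite /junk_conf /rset_; do 3!wstep.
  by rewrite /cconf /rupd /upd /=.
have r0 := @equad_ok s1 0 isT; have r1 := @equad_ok s1 1 isT.
have r2 := @equad_ok s1 2 isT.
have [okr0 er0] := r0; have [okr1 er1] := r1; have [okr2 er2] := r2.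
have q2 : reval s1 (equad 2) <> 0%R by rewrite er2.
rewrite /rset_; split.
- by wok.
- by wok.
- by split.
split.
- by wok.
- by wok.
- split=> //; wok.
rewrite /cconf /rupd /upd /=.
by [].
Qed.

Lemma visit_ok s g h : Env s -> cons s -> s.1 iG 0 = g -> s.1 iH 0 = h ->
  g <= h <= K -> (forall e, e < K -> s.1 aId e < n * m) ->
  wp visit (hcost (hset iE (XI (V iG))) + ((h - g) *
     ((xcost (XI (EL (V iE) (V iH)))).+2 + hcost visit_step) +
     (xcost (XI (EL (V iE) (V iH)))).+2))
   (fun s' => [/\ Env s', cons s', forall q, s'.1 aCode q =
      if q \in slice (s.1 aId) g h then cd q (cconf s) else s.1 aCode q &
      framed (imods visit) (rmods visit) s s']) s.
Proof.
move=> hE hc eG eH ghK hid.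
suff hw : wp visit (hcost (hset iE (XI (V iG))) + ((h - g) *
     ((xcost (XI (EL (V iE) (V iH)))).+2 + hcost visit_step) +
     (xcost (XI (EL (V iE) (V iH)))).+2)) (fun s' => cons s' /\ forall q, s'.1 aCode q =
      if q \in slice (s.1 aId) g h then cd q (cconf s) else s.1 aCode q) s.
  by apply: wpW (wp_env _ hE hw) _ _ => // s' [? [? ?] ?].
facts2 hE.
pose I0 e s' := [/\ Env s', cons s', forall q, s'.1 aCode q =
      (if q \in slice (s.1 aId) g e then cd q (cconf s) else s.1 aCode q),
      s'.1 iE 0 = e & [/\ s'.1 iH 0 = h, s'.1 aId = s.1 aId & cconf s' = cconf s]].
have w1 : wp (hset iE (XI (V iG))) (hcost (hset iE (XI (V iG)))) (fun s' => s'.1 iE 0 = g) s.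
  by apply: wp_lf => //; rewrite /hset; wstep.
apply: (wp_seq (wp_env _ hE w1)) => // s1 [hE1 e1 f1].
have h1' : I0 g s1.
  split=> //; first exact: cons_framed f1 isT hc.
    by move=> q; rewrite slice_nil // (f1.1 aCode).
  by split; rewrite ?(f1.1 iH) ?(f1.1 aId) // /cconf (f1.2 rC) // (f1.2 rS) // (f1.2 rT).
apply: (@wp_while _ _ _ (fun p s' => exists e, [/\ g <= e, e <= h, p = (h - e) *
   ((xcost (XI (EL (V iE) (V iH)))).+2 + hcost visit_step) & I0 e s'])) => //.
  by exists g; split=> //; lia.
move=> p s2 [e [ge eh -> [hE2 hc2 hcd2 eE2 [eH2 eid2 ek2]]]].
split; first by wok.
rewrite /= eE2 eH2 eqb0 -leqNgt; case: leqP => he.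
  by have <- : e = h by lia.
exists (hcost visit_step), ((h - e.+1) * ((xcost (XI (EL (V iE) (V iH)))).+2 + hcost visit_step)).
split; last first.
  by rewrite -[in X in _ <= X](subnSK he) mulSn.
have ide : s.1 aId e < n * m by apply: hid; lia.
have w3 : wp (hset iQ (XI (EV aId (V iE)))) (hcost (hset iQ (XI (EV aId (V iE)))))
    (fun s' => s'.1 iQ 0 = s.1 aId e) s2.
  by apply: wp_lf => //; rewrite /hset; wstep; rewrite /= /upd /= eE2 eid2.
apply: (wp_seq (wp_env _ hE2 w3)) => // s3 [hE3 eQ3 f3].
have hc3 := cons_framed f3 isT hc2.
apply: (wp_seq (upd_atom_ok n0 m3 hLim hW hE3 hc3 eQ3 ide)) => s4 [hE4 hc4 hcd4 f4].
have w5 : wp (incr iE) (hcost (incr iE)) (fun s' => s'.1 iE 0 = e.+1) s4.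
  apply: wp_lf => //; rewrite /incr /hset.
  have e4 : s4.1 iE 0 = e by rewrite (f4.1 iE) // (f3.1 iE).
  by wstep; rewrite /= /upd /= e4 addn1.
apply: wpW (wp_env _ hE4 w5) _ _ => // s5 [hE5 eE5 f5].
have cc3 : cconf s3 = cconf s by rewrite -ek2 /cconf (f3.2 rC) // (f3.2 rS) // (f3.2 rT).
exists e.+1; split=> //; first by lia.
split=> //; first exact: cons_framed f5 isT hc4.
- move=> q; rewrite (f5.1 aCode) // hcd4 cc3 slice_rcons // mem_rcons inE.
  by case: eqP => [->|_] //; rewrite (f3.1 aCode).
- split.
  + by rewrite (f5.1 iH) // (f4.1 iH) // (f3.1 iH).
  + by rewrite (f5.1 aId) // (f4.1 aId) // (f3.1 aId).
  + by rewrite -cc3 /cconf (f5.2 rC) // (f5.2 rS) // (f5.2 rT) // (f4.2 rC) // (f4.2 rS) // (f4.2 rT).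
Qed.

Definition visit_cost (k : nat) := hcost (hset iE (XI (V iG))) + (k *
     ((xcost (XI (EL (V iE) (V iH)))).+2 + hcost visit_step) +
     (xcost (XI (EL (V iE) (V iH)))).+2).

Definition probe_cost (k : nat) := hcost setconf + (visit_cost k + hcost check).

Lemma confu_valid pc u : (quad pc 0 u ^+ 2 + quad pc 1 u ^+ 2 = quad pc 2 u ^+ 2)%R ->
  (quad pc 2 u <> 0)%R -> validk (confu pc u).
Proof.
move=> h1 /eqP h2; rewrite /confu; case: ifP => [_|/norP[/norP[_ h3] h4]].
  by split; rewrite /= ?lexx ?ler01 //; ring.
split; rewrite /=; last by rewrite !leNgt h3 h4.
by rewrite !expr_div_n -mulrDl h1 divff // expf_neq0.
Qed.

(** Only the atoms of the visited group are recomputed; the assumption on the others will come from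
    the constancy of codes between events. *)
Lemma probe_ok s g h : Env s -> cons s -> bestinv s ->
  s.1 iG 0 = g -> s.1 iH 0 = h -> g <= h <= K ->
  (forall e, e < K -> s.1 aId e < n * m) ->
  (forall u, (quad (s.2 rPC) 0 u ^+ 2 + quad (s.2 rPC) 1 u ^+ 2 = quad (s.2 rPC) 2 u ^+ 2)%R) ->
  (forall u, quad (s.2 rPC) 2 u <> 0%R) ->
  (forall q, q < n * m -> q \notin slice (s.1 aId) g h ->
     s.1 aCode q = cd q (confu (s.2 rPC) (s.2 rU 0))) ->
  wp probe (probe_cost (h - g)) (fun s' => [/\ [/\ Env s', cons s' & bestinv s'],
     right s' (confu (s.2 rPC) (s.2 rU 0)),
     cnt (confu (s.2 rPC) (s.2 rU 0)) <= s'.1 iBest 0,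
     s.1 iBest 0 <= s'.1 iBest 0 & framed (imods probe) (rmods probe) s s']) s.
Proof.
move=> hE hc hb eG eH ghK hid hcs hw hcode.
set k := confu _ _.
suff h1 : wp probe (probe_cost (h - g)) (fun s' => [/\ cons s', bestinv s', right s' k,
    cnt k <= s'.1 iBest 0 & s.1 iBest 0 <= s'.1 iBest 0]) s.
  by apply: wpW (wp_env _ hE h1) _ _ => // s' [? [? ? ? ? ?] ?]; split.
apply: (wp_seq (wp_env _ hE (setconf_ok hE hw))) => // s1 [hE1 ek f1].
have hc1 := cons_framed f1 isT hc.
have eG1 : s1.1 iG 0 = g by rewrite (f1.1 iG).
have eH1 : s1.1 iH 0 = h by rewrite (f1.1 iH).
have id1 e : e < K -> s1.1 aId e < n * m by rewrite (f1.1 aId) //; exact: hid.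
apply: (wp_seq (visit_ok hE1 hc1 eG1 eH1 ghK id1)) => s2 [hE2 hc2 hcd2 f2].
have ek2 : cconf s2 = k.
  by rewrite /cconf (f2.2 rC) // (f2.2 rS) // (f2.2 rT).
have hr2 : right s2 k.
  move=> q hq; rewrite hcd2 ek; case: ifPn => //.
  by rewrite (f1.1 aId) // (f1.1 aCode) //; exact: hcode.
have hb2 : bestinv s2.
  case: hb; rewrite /bestinv /bconf (f2.1 iBest) // (f1.1 iBest) //.
  by rewrite !(f2.2 rBC, f2.2 rBS, f2.2 rBT, f1.2 rBC, f1.2 rBS, f1.2 rBT).
have hv : validk (cconf s2) by rewrite ek2; apply: confu_valid.
rewrite -ek2 in hr2.
apply: wpW (wp_frame (check_ok hE2 hc2 hr2 hv hb2)) _ _ => // s3 [[hb3 k3 m3'] f3].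
rewrite ek2 in k3 hr2.
split=> //.
- exact: cons_framed f3 isT hc2.
- by move=> q hq; rewrite (f3.1 aCode) // hr2.
- by move: m3'; rewrite (f2.1 iBest) // (f1.1 iBest).
Qed.

Definition scan_cost (k : nat) :=
  hcost (rset_ rU (RV rKey (V iG))) + (hcost (hset iH (XI (V iG))) +
   (k * ((xcost (XB IMul (XI (EL (V iH) (V iK))) (XE (RV rKey (V iH)) (RVr rU)))).+2 +
       hcost (incr iH)) +
     (xcost (XB IMul (XI (EL (V iH) (V iK))) (XE (RV rKey (V iH)) (RVr rU)))).+2)).

Lemma scan_ok s g h : Env s -> s.1 iG 0 = g -> g < h <= K ->
  (forall e, g <= e < h -> s.2 rKey e = s.2 rKey g) ->
  (h < K -> s.2 rKey h <> s.2 rKey g) ->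
  wp scan (scan_cost (h - g)) (fun s' => s'.2 rU 0 = s.2 rKey g /\ s'.1 iH 0 = h) s.
Proof.
move=> hE eG ghK heq hne; facts2 hE.
have w1 : wp (rset_ rU (RV rKey (V iG))) (hcost (rset_ rU (RV rKey (V iG))))
    (fun s' => s'.2 rU 0 = s.2 rKey g) s.
  by apply: wp_lf => //; rewrite /rset_; wstep; rewrite /= /upd /= eG.
apply: (wp_seq (wp_env _ hE w1)) => // s1 [hE1 u1 f1].
have w2 : wp (hset iH (XI (V iG))) (hcost (hset iH (XI (V iG))))
    (fun s' => s'.1 iH 0 = g) s1.
  apply: wp_lf => //; rewrite /hset.
  have eG1 : s1.1 iG 0 = g by rewrite (f1.1 iG).
  by wstep; rewrite /= /upd /= eG1.
apply: (wp_seq (wp_env _ hE1 w2)) => // s2 [hE2 u2 f2].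
apply: (@wp_while _ _ _ (fun p s' => exists e, [/\ g <= e <= h, p = (h - e) *
   ((xcost (XB IMul (XI (EL (V iH) (V iK))) (XE (RV rKey (V iH)) (RVr rU)))).+2 +
       hcost (incr iH)), Env s', s'.1 iH 0 = e & s'.2 rU 0 = s.2 rKey g /\ s'.2 rKey = s.2 rKey])) => //.
  exists g; split=> //; first by lia.
  by rewrite (f2.2 rU) // (f2.2 rKey) // (f1.2 rKey).
move=> p s3 [e [he -> hE3 eH3 [eU3 eK3]]].
have eKK := EnvK hE3.
split.
  do !split; wok; case: (_ == _); lia.
rewrite /= eH3 eKK eU3 eK3.
case: (leqP h e) => hhe.
  have eh : e = h by lia.
  rewrite eh ifT //.
  case: (leqP K h) => hKh; first by [].
  by move/eqP/negbTE: (hne hKh) => ->; rewrite muln0.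
rewrite (heq e) ?eqxx; last by lia.
rewrite (_ : (e < K) = true); last by lia.
exists (hcost (incr iH)), ((h - e.+1) * ((xcost (XB IMul (XI (EL (V iH) (V iK))) (XE (RV rKey (V iH)) (RVr rU)))).+2 +
       hcost (incr iH))).
split; last by rewrite -[in X in _ <= X](subnSK hhe) mulSn.
have w4 : wp (incr iH) (hcost (incr iH)) (fun s' => s'.1 iH 0 = e.+1) s3.
  by apply: wp_lf => //; rewrite /incr /hset; wstep; rewrite /= /upd /= eH3 addn1.
apply: wpW (wp_env _ hE3 w4) _ _ => // s4 [hE4 e4 f4].
exists e.+1; split=> //; first by lia.
by rewrite (f4.2 rU) // (f4.2 rKey).
Qed.

Lemma next_u_ok s h v : Env s -> s.1 iH 0 = h -> h <= K -> s.2 rU 0 = v ->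
  wp next_u (hcost next_u) (fun s' => s'.2 rU 0 =
    (if (h < K)%N then (v + s.2 rKey h) / 2 else v + 1)%R) s.
Proof.
move=> hE eH hK eU; facts2 hE.
apply: wp_lf => //; rewrite /next_u /rset_; split; first by wok.
rewrite [xeval _ _]/= eH eK; case: (h < K) => /=.
  split=> //; first by lia.
    split; [by wok| |]; last by apply/eqP; rewrite pnatr_eq0.
    by [].
  by rewrite /upd /= eH eU.
by split=> //; [lia|wok|rewrite /upd /= eU].
Qed.

Lemma group_end (key : nat -> R) (N g : nat) : g < N ->
  (forall x y, x <= y -> y < N -> (key x <= key y)%R) ->
  exists h, [/\ g < h <= N, forall e, g <= e < h -> key e = key g &
                h < N -> (key g < key h)%R].
Proof.
move=> gN hs.
have hex : exists e, (g <= e) && ((e == N) || (key e != key g)).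
  by exists N; rewrite eqxx (ltnW gN).
case: (ex_minnP hex) => h /andP[gh hh] hmin.
have gh' : g < h.
  rewrite ltn_neqAle gh andbT; apply/eqP => e; move: hh; rewrite -e eqxx.
  by rewrite orbF => /eqP; lia.
have hN : h <= N by apply: hmin; rewrite eqxx (ltnW gN).
exists h; split; first by rewrite gh' hN.
  move=> e /andP[ge eh]; apply/eqP; apply: contraLR eh => hne.
  by rewrite -leqNgt; apply: hmin; rewrite ge hne orbT.
move=> hlt; rewrite lt_neqAle hs // ?(ltnW gh') // andbT eq_sym.
by move: hh; rewrite (ltn_eqF hlt).
Qed.

(** Groups are nonempty, so the fixed part of a probe can be charged to the events of its group, and
    the probes of a sweep add up to a linear cost. *)
Lemma probe_cost_le k : 0 < k -> probe_cost k <= k * probe_cost 1.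
Proof.
move=> k0; rewrite /probe_cost /visit_cost mul1n.
move: (hcost setconf) (hcost check) (hcost (hset _ _)) ((xcost _).+2) (hcost visit_step).
clear -k0 => A B C D E; nia.
Qed.

Lemma scan_cost_le k : 0 < k -> scan_cost k <= k * scan_cost 1.
Proof.
move=> k0; rewrite /scan_cost mul1n.
move: (hcost (rset_ _ _)) (hcost (hset _ _)) ((xcost _).+2) (hcost (incr _)).
clear -k0 => A B C D; nia.
Qed.

Definition step_cost2 := scan_cost 1 + (probe_cost 1 + (hcost next_u +
   (probe_cost 1 + hcost (hset iG (XI (V iH)))))).

Definition sweep_cost :=
  hcost sweep_init + (probe_cost K + (K * (step_cost2 + (xcost (XI (EL (V iG) (V iK)))).+2)
     + (xcost (XI (EL (V iG) (V iK)))).+2)).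

Section Constancy.
Variables (pc key : nat -> R) (ids : nat -> nat).
Hypothesis hconst : forall q u v, q < n * m -> (u <= v)%R ->
  (forall e, e < K -> ids e = q -> ~~ (u <= key e <= v)%R) ->
  cd q (confu pc u) = cd q (confu pc v).
Hypothesis hsort : forall x y, x <= y -> y < K -> (key x <= key y)%R.

(** The gap before the event [g]: an open interval, unbounded at either end of the event list. *)
Definition cell g u := (g > 0 -> (key g.-1 < u)%R) /\ (g < K -> (u < key g)%R).

Lemma cell_const g u v q : g <= K -> q < n * m -> cell g u -> cell g v ->
  cd q (confu pc u) = cd q (confu pc v).
Proof.
move=> gK hq; wlog uv : u v / (u <= v)%R.
  by move=> h hu hv; case/orP: (le_total u v) => uv; [|symmetry]; apply: h.
move=> [u1 u2] [v1 v2]; apply: hconst => // e eK _; apply/negP => /andP[h1 h2].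
case: (ltnP e g) => eg.
  have := u1 (leq_ltn_trans (leq0n _) eg); apply/negP; rewrite -leNgt.
  apply: le_trans h1 _; apply: hsort; lia.
have := v2 (leq_ltn_trans eg eK); apply/negP; rewrite -leNgt.
by apply: le_trans h2; apply: hsort.
Qed.

Lemma cell_le g u v q : g <= K -> q < n * m -> (u <= v)%R ->
  (g > 0 -> (key g.-1 < u)%R) -> (forall e, g <= e < K -> (v < key e)%R \/ ids e <> q) ->
  cd q (confu pc u) = cd q (confu pc v).
Proof.
move=> gK hq uv h1 h2; apply: hconst => // e eK eq; apply/negP => /andP[k1 k2].
case: (ltnP e g) => eg.
  have := h1 (leq_ltn_trans (leq0n _) eg); apply/negP; rewrite -leNgt.
  apply: le_trans k1 _; apply: hsort; lia.
have [|h3|//] := h2 e; first by rewrite eg eK.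
by move: k2; rewrite leNgt h3.
Qed.

(** Codes are right in the gap before [g], which is nonempty because groups are never split, and
    every parameter before the event [g] is accounted for. [B0] is the best count of the earlier
    curves. *)
Definition sweep_inv (B0 g : nat) s :=
  [/\ [/\ Env s, cons s & bestinv s],
      [/\ s.1 iG 0 = g, s.1 aId = ids, s.2 rKey = key & s.2 rPC = pc],
      (forall u, cell g u -> right s (confu pc u)),
      (0 < g < K -> (key g.-1 < key g)%R) /\
      (forall u, (g < K -> (u < key g)%R) -> cnt (confu pc u) <= s.1 iBest 0) &
      B0 <= s.1 iBest 0].

Hypothesis hid : forall e, e < K -> ids e < n * m.
Hypothesis hcs : forall u, (quad pc 0 u ^+ 2 + quad pc 1 u ^+ 2 = quad pc 2 u ^+ 2)%R.
Hypothesis hw : forall u, quad pc 2 u <> 0%R.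

Lemma sweep_step_ok B0 g s : g < K -> sweep_inv B0 g s ->
  exists2 h, g < h <= K &
    wp sweep_step ((h - g) * step_cost2) (sweep_inv B0 h) s.
Proof.
move=> gK [[hE hc hb] [eG eid ekey epc] hcell [hgap hbest] hB].
have [h [ghK heq hne]] := group_end gK hsort.
exists h => //.
have hg0 : 0 < h - g by lia.
apply: (@wpW _ _ _ _ (scan_cost (h - g) + (probe_cost (h - g) + (hcost next_u +
   (probe_cost (h - g) + hcost (hset iG (XI (V iH)))))))
   _ (sweep_inv B0 h)) => //; last first.
  have := scan_cost_le hg0; have := probe_cost_le hg0; rewrite /step_cost2.
  move: (scan_cost (h - g)) (scan_cost 1) (probe_cost (h - g)) (probe_cost 1).
  move: (hcost next_u) (hcost _) hg0; move: (h - g) => D.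
  by clear; move=> *; nia.
have hne' : h < K -> s.2 rKey h <> s.2 rKey g.
  by rewrite ekey => /hne h1 h2; rewrite h2 ltxx in h1.
rewrite -ekey in heq.
apply: (wp_seq (wp_env _ hE (scan_ok hE eG ghK heq hne'))) => // s1 [hE1 [eU1 eH1] f1].
set v := s.2 rKey g in eU1.
have hc1 := cons_framed f1 isT hc.
have hb1 : bestinv s1.
  case: hb; rewrite /bestinv /bconf (f1.1 iBest) //.
  by rewrite (f1.2 rBC) // (f1.2 rBS) // (f1.2 rBT).
have eG1 : s1.1 iG 0 = g by rewrite (f1.1 iG).
have eid1 : s1.1 aId = ids by rewrite (f1.1 aId).
have ekey1 : s1.2 rKey = key by rewrite (f1.2 rKey).
have epc1 : s1.2 rPC = pc by rewrite (f1.2 rPC).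
have ghK2 : g <= h <= K by lia.
have vE : v = key g by rewrite /v ekey.
(* A parameter in the gap before the group, where the stored codes are right. An atom outside of the
   group has no event from [um] to [v], so its code is still right at [v]. *)
have [um [um1 um2]] : exists um, cell g um /\ (um < v)%R.
  case: (posnP g) => [g0|g0].
    exists (v - 1)%R; split; last by lra.
    by split=> [|_]; [rewrite g0|rewrite -vE; lra].
  have hk : (key g.-1 < key g)%R by apply: hgap; lia.
  exists ((key g.-1 + v) / 2)%R; rewrite vE; split; last by lra.
  by split=> _; lra.
have notin e q : g <= e < h -> q \notin slice ids g h -> ids e <> q.
  move=> he hq eq; move: hq; rewrite -eq => /negP; apply.
  by apply/mapP; exists e => //; rewrite mem_index_iota.
have [hp1 hp2] : (forall e, e < K -> s1.1 aId e < n * m) /\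
   (forall q, q < n * m -> q \notin slice (s1.1 aId) g h ->
     s1.1 aCode q = cd q (confu (s1.2 rPC) (s1.2 rU 0))).
  rewrite eid1 epc1 eU1; split=> // q hq hnq.
  rewrite (f1.1 aCode) // (hcell um um1 q hq).
  apply: (@cell_le g) => //; [exact: ltnW|exact: ltW|by case: um1|].
  move=> e /andP[ge eK]; case: (ltnP e h) => eh; first by right; apply: notin => //; lia.
  left; rewrite vE; apply: (lt_le_trans (hne (leq_ltn_trans eh eK))).
  exact: hsort.
have hcs1 : forall u, (quad (s1.2 rPC) 0 u ^+ 2 + quad (s1.2 rPC) 1 u ^+ 2 = quad (s1.2 rPC) 2 u ^+ 2)%R.
  by rewrite epc1.
have hw1 : forall u, quad (s1.2 rPC) 2 u <> 0%R by rewrite epc1.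
apply: (wp_seq (probe_ok hE1 hc1 hb1 eG1 eH1 ghK2 hp1 hcs1 hw1 hp2)) => s2 [[hE2 hc2 hb2]].
rewrite eU1 epc1 => hr2 hbest2 hB2 f2.
have eU2 : s2.2 rU 0 = v by rewrite (f2.2 rU).
have eH2 : s2.1 iH 0 = h by rewrite (f2.1 iH).
have hK : h <= K by lia.
apply: (wp_seq (wp_env _ hE2 (next_u_ok hE2 eH2 hK eU2))) => // s3 [hE3 eU3 f3].
have ekey2 : s2.2 rKey = key by rewrite (f2.2 rKey).
rewrite ekey2 in eU3.
set up := (if (h < K)%N then _ else _) in eU3.
have heq2 e : g <= e < h -> key e = v by rewrite -ekey => /heq.
have hlast : key h.-1 = v by apply: heq2; lia.
have hnev : h < K -> (v < key h)%R by rewrite vE.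
have [up1 up2] : cell h up /\ (v < up)%R.
  rewrite /up /cell hlast; case: (ltnP h K) => hKK.
    by have := hnev hKK; do !split => //; lra.
  by do !split => //; lra.
have hc3 := cons_framed f3 isT hc2.
have hb3 : bestinv s3.
  case: hb2; rewrite /bestinv /bconf (f3.1 iBest) //.
  by rewrite (f3.2 rBC) // (f3.2 rBS) // (f3.2 rBT).
have eG3 : s3.1 iG 0 = g by rewrite (f3.1 iG) // (f2.1 iG).
have eH3 : s3.1 iH 0 = h by rewrite (f3.1 iH).
have eid3 : s3.1 aId = ids by rewrite (f3.1 aId) // (f2.1 aId).
have epc3 : s3.2 rPC = pc by rewrite (f3.2 rPC) // (f2.2 rPC).
have ekey3 : s3.2 rKey = key by rewrite (f3.2 rKey).
have [hp3 hp4] : (forall e, e < K -> s3.1 aId e < n * m) /\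
   (forall q, q < n * m -> q \notin slice (s3.1 aId) g h ->
     s3.1 aCode q = cd q (confu (s3.2 rPC) (s3.2 rU 0))).
  rewrite eid3 epc3 eU3; split=> // q hq hnq.
  rewrite (f3.1 aCode) // hr2 //.
  apply: (@cell_le g) => //; [exact: ltnW|exact: ltW| |].
    by move=> g0; rewrite vE; apply: hgap; rewrite g0.
  move=> e /andP[ge eK]; case: (ltnP e h) => eh; first by right; apply: notin => //; lia.
  left; have hKK := leq_ltn_trans eh eK.
  by case: up1 => _ /(_ hKK) /lt_le_trans; apply; apply: hsort.
have hcs3 : forall u, (quad (s3.2 rPC) 0 u ^+ 2 + quad (s3.2 rPC) 1 u ^+ 2 = quad (s3.2 rPC) 2 u ^+ 2)%R.
  by rewrite epc3.
have hw3 : forall u, quad (s3.2 rPC) 2 u <> 0%R by rewrite epc3.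
apply: (wp_seq (probe_ok hE3 hc3 hb3 eG3 eH3 ghK2 hp3 hcs3 hw3 hp4)) => s4 [[hE4 hc4 hb4]].
rewrite eU3 epc3 => hr4 hbest4 hB4 f4.
have w5 : wp (hset iG (XI (V iH))) (hcost (hset iG (XI (V iH)))) (fun s' => s'.1 iG 0 = h) s4.
  have [h1 h2 h3 h4] := dim; have [h5 h6 h7 h8] := bnd.
  by apply: wp_lf => //; rewrite /hset; wstep; rewrite /= /upd /= (f4.1 iH) // eH3.
apply: wpW (wp_env _ hE4 w5) _ _ => // s5 [hE5 eG5 f5].
have eb5 : s5.1 iBest 0 = s4.1 iBest 0 by rewrite (f5.1 iBest).
have b35 : s2.1 iBest 0 <= s5.1 iBest 0 by rewrite eb5 -(f3.1 iBest).
have b05 : s.1 iBest 0 <= s5.1 iBest 0.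
  by apply: leq_trans b35; rewrite -(f1.1 iBest).
have hr5 u : cell h u -> right s5 (confu pc u).
  move=> hu q hq; rewrite (f5.1 aCode) // hr4 //.
  exact: (@cell_const h).
split.
- split=> //; first exact: cons_framed f5 isT hc4.
  case: hb4; rewrite /bestinv /bconf eb5.
  by rewrite (f5.2 rBC) // (f5.2 rBS) // (f5.2 rBT).
- split=> //.
  + by rewrite (f5.1 aId) // (f4.1 aId).
  + by rewrite (f5.2 rKey) // (f4.2 rKey).
  + by rewrite (f5.2 rPC) // (f4.2 rPC).
- exact: hr5.
- split; first by move=> /andP[_ hKK]; rewrite hlast; apply: hnev.
  (* Before [v] the bound is already known, beyond it one probe speaks for the whole gap, and at [v]
     itself there was a probe. *)
  move=> u hu; case: (ltgtP u v) => huv.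
  + by apply: leq_trans b05; apply: hbest => _; rewrite -vE.
  + have cu : cell h u by split=> // _; rewrite hlast.
    by rewrite (right_cnt (hr5 _ cu) (hr5 _ up1)) eb5.
  + by apply: leq_trans b35; rewrite huv.
- exact: leq_trans b05.
Qed.

End Constancy.

Lemma sweep_ok s : Env s -> cons s -> bestinv s ->
  sorted leT (slice (arr s) 0 K) ->
  (forall e, e < K -> s.1 aId e < n * m) ->
  (forall q, q < n * m -> exists2 e, e < K & s.1 aId e = q) ->
  (forall u, (quad (s.2 rPC) 0 u ^+ 2 + quad (s.2 rPC) 1 u ^+ 2 = quad (s.2 rPC) 2 u ^+ 2)%R) ->
  (forall u, quad (s.2 rPC) 2 u <> 0%R) ->
  (forall q u v, q < n * m -> (u <= v)%R ->
    (forall e, e < K -> s.1 aId e = q -> ~~ (u <= s.2 rKey e <= v)%R) ->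
    cd q (confu (s.2 rPC) u) = cd q (confu (s.2 rPC) v)) ->
  wp sweep sweep_cost (fun s' => [/\ [/\ Env s', cons s' & bestinv s'],
     forall u, cnt (confu (s.2 rPC) u) <= s'.1 iBest 0,
     s.1 iBest 0 <= s'.1 iBest 0 & framed (imods sweep) (rmods sweep) s s']) s.
Proof.
move=> hE hc hb hsorted hid hall hcs hw hconst; facts2 hE.
have hsort x y : x <= y -> y < K -> (s.2 rKey x <= s.2 rKey y)%R.
  move=> xy yK; have hs := sorted_leq_nth (@leT_trans R) (fun z => lexx z.1) (arr s 0) hsorted.
  have xK := leq_ltn_trans xy yK.
  have := hs x y; rewrite !inE /slice !size_map size_iota subn0 => /(_ xK yK xy).
  rewrite !(nth_map 0) ?size_iota ?subn0 // !nth_iota ?subn0 //.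
have K0 : 0 < K by lia.
set pc := s.2 rPC; set key := s.2 rKey.
suff h : wp sweep sweep_cost (fun s' => [/\ [/\ Env s', cons s' & bestinv s'],
     forall u, cnt (confu pc u) <= s'.1 iBest 0 & s.1 iBest 0 <= s'.1 iBest 0]) s.
  by apply: wpW (wp_frame h) _ _ => // s' [[? ? ?] ?].
have w1 : wp sweep_init (hcost sweep_init) (fun s' => [/\ s'.2 rU 0 = (key 0 - 1)%R,
    s'.1 iG 0 = 0 & s'.1 iH 0 = K]) s.
  by apply: wp_lf => //; rewrite /sweep_init /rset_ /hset; do 3!wstep.
apply: (wp_seq (wp_env _ hE w1)) => // s1 [hE1 [eU1 eG1 eH1] f1].
have hc1 := cons_framed f1 isT hc.
have hb1 : bestinv s1.
  case: hb; rewrite /bestinv /bconf (f1.1 iBest) //.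
  by rewrite (f1.2 rBC) // (f1.2 rBS) // (f1.2 rBT).
have eid1 : s1.1 aId = s.1 aId by rewrite (f1.1 aId).
have epc1 : s1.2 rPC = pc by rewrite (f1.2 rPC).
have hid1 : forall e, e < K -> s1.1 aId e < n * m by rewrite eid1.
have hcs1 : forall u, (quad (s1.2 rPC) 0 u ^+ 2 + quad (s1.2 rPC) 1 u ^+ 2 = quad (s1.2 rPC) 2 u ^+ 2)%R.
  by rewrite epc1.
have hw1 : forall u, quad (s1.2 rPC) 2 u <> 0%R by rewrite epc1.
have hn1 q : q < n * m -> q \notin slice (s1.1 aId) 0 K ->
     s1.1 aCode q = cd q (confu (s1.2 rPC) (s1.2 rU 0)).
  move=> /hall[e he <-]; rewrite eid1 => /negP[]; apply/mapP; exists e => //.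
  by rewrite mem_index_iota.
have g0K : 0 <= K <= K by rewrite leqnn.
have pE := probe_ok hE1 hc1 hb1 eG1 eH1 g0K hid1 hcs1 hw1 hn1.
rewrite subn0 in pE.
apply: (wp_seq pE) => s2 [[hE2 hc2 hb2]]; rewrite eU1 epc1 => hr2 hbest2 hB2 f2.
pose inv := sweep_inv pc key (s.1 aId) (s.1 iBest 0).
have B02 : s.1 iBest 0 <= s2.1 iBest 0 by rewrite -(f1.1 iBest).
have c0 : cell key 0 (key 0 - 1)%R by split=> // _; lra.
have hcell0 u : cell key 0 u -> right s2 (confu pc u).
  by move=> hu q hq; rewrite hr2 //; apply: (@cell_const pc key (s.1 aId) _ _ 0).
have inv0 : inv 0 s2.
  split=> //.
  - split.
    + by rewrite (f2.1 iG).
    + by rewrite (f2.1 aId).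
    + by rewrite (f2.2 rKey) // (f1.2 rKey).
    + by rewrite (f2.2 rPC).
  - split=> // u hu; rewrite (right_cnt (hcell0 u _) hr2) //.
apply: (@wp_while _ _ _ (fun p s' => exists g, [/\ g <= K, p = (K - g) *
   (step_cost2 + (xcost (XI (EL (V iG) (V iK)))).+2) & inv g s'])) => //.
  by exists 0; rewrite subn0.
move=> p s3 [g [gK -> hinv]].
have [[hE3 hc3 hb3] [eG3 _ _ _] _ [_ hbest3] hB3] := hinv.
have eK3 := EnvK hE3.
split; first by wok.
rewrite /= eG3 eK3 eqb0 -leqNgt; case: (leqP K g) => hg.
  by split=> // u; apply: hbest3; rewrite ltnNge hg.
have [h ghK hwp] := @sweep_step_ok pc key (s.1 aId) hconst hsort hid hcs hw _ g s3 hg hinv.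
exists ((h - g) * step_cost2), ((K - h) * (step_cost2 + (xcost (XI (EL (V iG) (V iK)))).+2)).
split.
  by apply: wpW hwp _ _ => // s4 hi4; exists h; split=> //; lia.
have [x hx] : exists x, h - g = x.+1 by exists (h - g).-1; lia.
have -> : K - g = (K - h) + x.+1 by lia.
have key_le C D Z y : D.+2 + y.+1 * C + Z * (C + D.+2) <= (Z + y.+1) * (C + D.+2).
  by clear; nia.
by rewrite hx; exact: (key_le step_cost2 (xcost (XI (EL (V iG) (V iK)))) (K - h) x).
Qed.

End Sweep2.

(** * Events of a curve *)

Section EventPolynomials.
Variable R : realType.
Implicit Types (p q v x a d : R * R) (pc : nat -> R).

Definition qpoly pc k : {poly R} :=
  Poly [:: pc (3 * k)%N; pc (3 * k).+1; pc (3 * k).+2].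

Lemma horner_qpoly pc k u : (qpoly pc k).[u] = quad pc k u.
Proof. by rewrite horner_Poly /= /quad; ring. Qed.

Definition hqE := (horner_qpoly, hornerD, hornerN, hornerM, hornerZ).

Definition den pc := qpoly pc 2 * qpoly pc 4.

(** The image of [v] has the coordinates [num1 / den] and [num2 / den]. Over this common denominator
    everything is a sum of products of two quadratics, hence of degree at most 4. *)
Definition num1 pc a d v :=
  a.1 *: den pc +
  (qpoly pc 4 * ((v.1 - a.1) *: qpoly pc 0 - (v.2 - a.2) *: qpoly pc 1) +
   qpoly pc 3 * (d.1 *: qpoly pc 2 + (d.2 *: qpoly pc 1 - d.1 *: qpoly pc 0))).

Definition num2 pc a d v :=
  a.2 *: den pc +
  (qpoly pc 4 * ((v.2 - a.2) *: qpoly pc 0 + (v.1 - a.1) *: qpoly pc 1) +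
   qpoly pc 3 * (d.2 *: qpoly pc 2 - (d.2 *: qpoly pc 0 + d.1 *: qpoly pc 1))).

(** The first three polynomials decide whether the position on the segment is defined and lies in
    [0, 1], the next four compare the coordinates of the image with those of [p] and [q], and the
    last one gives its orientation, which stays of degree 4 because [crossp] is affine in the
    point. *)
Definition evpolys pc a d v p q : seq {poly R} :=
  let fx c := num1 pc a d v - c *: den pc in
  let fy c := num2 pc a d v - c *: den pc in
  [:: qpoly pc 4; qpoly pc 3; qpoly pc 3 - qpoly pc 4;
      fx p.1; fy p.2; fx q.1; fy q.2;
      (q.1 - p.1) *: fy p.2 - (q.2 - p.2) *: fx p.1].

(** A nonzero polynomial changes sign only at a root. The zero polynomial has constant sign, so it
    needs no event. *)
Lemma sgr_root (p : {poly R}) (u v : R) : u <= v ->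
  (p != 0 -> forall y : R, root p y -> ~~ (u <= y <= v)) ->
  Num.sg p.[u] = Num.sg p.[v].
Proof.
move=> uv; have [->|p0 /(_ isT) h] := eqVneq p 0; first by rewrite !horner0.
apply: (@polyrcf.polyrN0_itv R `[u, v] p); rewrite ?in_itv /= ?lexx ?uv //.
by move=> x; rewrite in_itv /= => hx; apply/negP => /h; rewrite hx.
Qed.

Lemma sgrDiv (x y : R) : Num.sg (x / y) = Num.sg x * Num.sg y.
Proof. by rewrite sgrM sgrV. Qed.

Lemma ecode_sg m p q x x' :
  Num.sg (x.1 - p.1) = Num.sg (x'.1 - p.1) ->
  Num.sg (x.2 - p.2) = Num.sg (x'.2 - p.2) ->
  Num.sg (x.1 - q.1) = Num.sg (x'.1 - q.1) ->
  Num.sg (x.2 - q.2) = Num.sg (x'.2 - q.2) ->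
  Num.sg (crossp p q x) = Num.sg (crossp p q x') ->
  ecode m p q x = ecode m p q x'.
Proof.
have le_sg (s t s' t' : R) : Num.sg (s - t) = Num.sg (s' - t') -> (t <= s) = (t' <= s').
  by move=> h; rewrite -subr_ge0 -sgr_ge0 h sgr_ge0 subr_ge0.
have le_sg2 (s t s' t' : R) : Num.sg (s - t) = Num.sg (s' - t') -> (s <= t) = (s' <= t').
  by move=> h; rewrite -subr_le0 -sgr_le0 h sgr_le0 subr_le0.
move=> /[dup] /le_sg h1 /le_sg2 k1 /[dup] /le_sg h2 /le_sg2 k2.
move=> /[dup] /le_sg h3 /le_sg2 k3 /[dup] /le_sg h4 /le_sg2 k4 h5.
rewrite /ecode /on_edge /ray_edge /between.
rewrite -(sgr_eq0 (crossp p q x)) -(sgr_gt0 (crossp p q x)) -(sgr_lt0 (crossp p q x)).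
by rewrite h5 sgr_eq0 sgr_gt0 sgr_lt0 !ltNge h1 h2 h3 h4 k1 k2 k3 k4.
Qed.

Section Const.
Variables (pc : nat -> R) (a d v p q : R * R) (m : nat) (u1 u2 : R).
Hypothesis hw : forall u, quad pc 2 u <> 0.
Hypothesis u12 : u1 <= u2.
Hypothesis hroots : forall f, f \in evpolys pc a d v p q -> f != 0 ->
  forall y : R, root f y -> ~~ (u1 <= y <= u2).

Let hs f : f \in evpolys pc a d v p q -> Num.sg f.[u1] = Num.sg f.[u2].
Proof. by move=> hf; apply: sgr_root => // f0 x; apply: hroots. Qed.

Lemma img_num u : quad pc 4 u <> 0 ->
  img a d (quad pc 0 u / quad pc 2 u, quad pc 1 u / quad pc 2 u,
           quad pc 3 u / quad pc 4 u) v
  = ((num1 pc a d v).[u] / (den pc).[u], (num2 pc a d v).[u] / (den pc).[u]).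
Proof.
move=> h4; have h2 := hw (u := u).
by rewrite /img /num1 /num2 /den !hqE /=; congr pair; field; apply/andP; split; apply/eqP.
Qed.

Lemma ecode_const :
  ecode m p q (img a d (confu pc u1) v) = ecode m p q (img a d (confu pc u2) v).
Proof.
have s4 : Num.sg (quad pc 4 u1) = Num.sg (quad pc 4 u2).
  by rewrite -!horner_qpoly; apply: hs; rewrite !inE eqxx.
have s3 : Num.sg (quad pc 3 u1) = Num.sg (quad pc 3 u2).
  by rewrite -!horner_qpoly; apply: hs; rewrite !inE eqxx ?orbT.
have s34 : Num.sg (quad pc 3 u1 - quad pc 4 u1) = Num.sg (quad pc 3 u2 - quad pc 4 u2).
  have := hs (f := qpoly pc 3 - qpoly pc 4); rewrite !hqE; apply.
  by rewrite !inE eqxx ?orbT.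
(* The denominator of the cosine and the sine has no real root, so it needs no event either. *)
have s2 : Num.sg (quad pc 2 u1) = Num.sg (quad pc 2 u2).
  rewrite -!horner_qpoly; apply: sgr_root => // _ x /rootP.
  by rewrite horner_qpoly => /hw.
have sden : Num.sg (den pc).[u1] = Num.sg (den pc).[u2].
  by rewrite /den !hqE !sgrM s2 s4.
rewrite /confu.
have c1 : (quad pc 4 u1 == 0) = (quad pc 4 u2 == 0) by rewrite -sgr_eq0 s4 sgr_eq0.
have c2 : (quad pc 3 u1 / quad pc 4 u1 < 0) = (quad pc 3 u2 / quad pc 4 u2 < 0).
  by rewrite -sgr_lt0 sgrDiv s3 s4 -sgrDiv sgr_lt0.
rewrite -c1 -c2; case: eqP => //= n4; have n4' : quad pc 4 u2 <> 0 by apply/eqP; rewrite -c1; apply/eqP.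
have c3 : (1 < quad pc 3 u1 / quad pc 4 u1) = (1 < quad pc 3 u2 / quad pc 4 u2).
  have e u : quad pc 4 u <> 0 -> quad pc 3 u / quad pc 4 u - 1 = (quad pc 3 u - quad pc 4 u) / quad pc 4 u.
    by move=> /eqP hu; field.
  by rewrite -!(subr_gt0 1) !e // -sgr_gt0 sgrDiv s34 s4 -sgrDiv sgr_gt0.
rewrite -c3; case: ifP => // _.
rewrite !img_num //.
have dn u : quad pc 4 u <> 0 -> (den pc).[u] != 0.
  by move=> /eqP h; rewrite /den !hqE mulf_neq0 //; apply/eqP/hw.
have sub (f : {poly R}) c u : quad pc 4 u <> 0 ->
    f.[u] / (den pc).[u] - c = (f - c *: den pc).[u] / (den pc).[u].
  move=> /dn; move: (den pc) => D hd; rewrite hornerD hornerN hornerZ; by field.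
have sg1 f c : f - c *: den pc \in evpolys pc a d v p q ->
    Num.sg (f.[u1] / (den pc).[u1] - c) = Num.sg (f.[u2] / (den pc).[u2] - c).
  by move=> hf; rewrite !sub // !sgrDiv sden (hs hf).
apply: ecode_sg => /=; try by apply: sg1; rewrite !inE eqxx ?orbT.
pose f := (q.1 - p.1) *: (num2 pc a d v - p.2 *: den pc) -
          (q.2 - p.2) *: (num1 pc a d v - p.1 *: den pc).
have fE u : quad pc 4 u <> 0 -> crossp p q ((num1 pc a d v).[u] / (den pc).[u],
     (num2 pc a d v).[u] / (den pc).[u]) = f.[u] / (den pc).[u].
  move=> /dn; rewrite /crossp /f; move: (num1 _ _ _ _) (num2 _ _ _ _) (den pc) => A B D hd.
  by rewrite !(hornerD, hornerN, hornerZ) /=; field.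
by rewrite !fE // !sgrDiv sden (@hs f) // !inE eqxx ?orbT.
Qed.

End Const.
End EventPolynomials.

(** Polynomials as lists of coefficient expressions. Their arithmetic is carried out when the
    program is built; the machine only evaluates the resulting explicit formulas. *)
Fixpoint sadd (l1 l2 : seq rexp) : seq rexp :=
  match l1, l2 with
  | [::], l => l
  | l, [::] => l
  | x :: l1, y :: l2 => radd x y :: sadd l1 l2
  end.

Definition sscale (c : rexp) (l : seq rexp) := map (rmul c) l.
Definition ssub l1 l2 := sadd l1 (sscale (rsub (RN 0) (RN 1)) l2).

Fixpoint smul (l1 l2 : seq rexp) : seq rexp :=
  match l1 with
  | [::] => [::]
  | x :: l1 => sadd (sscale x l2) (RN 0 :: smul l1 l2)
  end.

Definition sq k := [:: RV rPC (EN (3 * k)); RV rPC (EN (3 * k).+1); RV rPC (EN (3 * k).+2)].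
Definition sden := smul (sq 2) (sq 4).
Definition sv1 := rsub (eS1 (V iI)) eA1.
Definition sv2 := rsub (eS2 (V iI)) eA2.

Definition snum1 :=
  sadd (sscale eA1 sden)
   (sadd (smul (sq 4) (ssub (sscale sv1 (sq 0)) (sscale sv2 (sq 1))))
         (smul (sq 3) (sadd (sscale eD1 (sq 2)) (ssub (sscale eD2 (sq 1)) (sscale eD1 (sq 0)))))).

Definition snum2 :=
  sadd (sscale eA2 sden)
   (sadd (smul (sq 4) (sadd (sscale sv2 (sq 0)) (sscale sv1 (sq 1))))
         (smul (sq 3) (ssub (sscale eD2 (sq 2)) (sadd (sscale eD2 (sq 0)) (sscale eD1 (sq 1)))))).

(** All polynomials get 5 coefficients, hence 4 slots for roots, whatever their actual degree. *)
Definition spad l := sadd l (nseq 5 (RN 0)).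

Definition spolys : seq (seq rexp) :=
  let fx c := ssub snum1 (sscale c sden) in
  let fy c := ssub snum2 (sscale c sden) in
  [:: sq 4; sq 3; ssub (sq 3) (sq 4);
      fx ptp1; fy ptp2; fx ptq1; fy ptq2;
      ssub (sscale (rsub ptq1 ptp1) (fy ptp2)) (sscale (rsub ptq2 ptp2) (fx ptp1))].

(* Each pair of a point and an edge has 8 polynomials with at most 4 roots each.
   The slots that hold no root contain 0, a harmless additional event. *)
Definition slot r := EB IAdd (EB IMul (EN 32) (V iQ)) (EN (4 * r)).

Definition roots_at r := HRoots (spad (nth [::] spolys r)) rKey (slot r).

Definition atom_events :=
  HSeq set_ij (HSeq (roots_at 0) (HSeq (roots_at 1) (HSeq (roots_at 2)
 (HSeq (roots_at 3) (HSeq (roots_at 4) (HSeq (roots_at 5)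
 (HSeq (roots_at 6) (roots_at 7)))))))).

Definition gen_keys := hfor iQ (V iNM) atom_events.
Definition gen_ids := hfor kk (V iK) (HI aId (V kk) (XI (EB IDiv (V kk) (EN 32)))).
Definition gen_events := HSeq gen_keys gen_ids.

Section SyntacticPolynomials.
Variables (R : realType) (W Lim : nat) (s : ast R).
Implicit Types l : seq rexp.

Definition speval l : {poly R} := Poly (map (reval s) l).

Definition roks l := foldr (fun e Q => rok W Lim s e /\ Q) True l.

Definition sval l (f : {poly R}) := roks l /\ speval l = f.

Lemma speval_cons x l : speval (x :: l) = speval l * 'X + (reval s x)%:P.
Proof. by rewrite /speval /= cons_poly_def. Qed.

Lemma sval_add l1 l2 f1 f2 : sval l1 f1 -> sval l2 f2 -> sval (sadd l1 l2) (f1 + f2).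
Proof.
move=> [h1 <-] [h2 <-] {f1 f2}; elim: l1 l2 h1 h2 => [|x l1 IH] [|y l2] /=.
- by rewrite add0r.
- by rewrite /speval /= add0r.
- by rewrite [speval [::]]/speval /= addr0.
- move=> [okx /IH h1] [oky /h1[h3 h4]]; split=> //=.
  by rewrite !speval_cons h4 /= polyCD; ring.
Qed.

Lemma sval_scale c l v f : rval W Lim s c v -> sval l f -> sval (sscale c l) (v *: f).
Proof.
move=> [okc <-] [h <-]; elim: l h => [|x l IH] /=.
  by rewrite /sval /speval /= scaler0.
move=> [okx /IH[h1 h2]]; split=> //=.
by rewrite !speval_cons h2 /= polyCM -!mul_polyC; ring.
Qed.

Lemma sval_sub l1 l2 f1 f2 : sval l1 f1 -> sval l2 f2 -> sval (ssub l1 l2) (f1 - f2).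
Proof.
move=> h1 h2; rewrite -scaleN1r; apply: sval_add => //; apply: sval_scale => //.
by split=> //=; rewrite sub0r.
Qed.

Lemma sval_mul l1 l2 f1 f2 : sval l1 f1 -> sval l2 f2 -> sval (smul l1 l2) (f1 * f2).
Proof.
move=> [h1 <-] hl2 {f1}; elim: l1 h1 => [|x l1 IH] /=.
  by move=> _; split=> //; rewrite /speval /= mul0r.
move=> [okx /IH[h3 h4]]; rewrite speval_cons mulrDl addrC mul_polyC.
apply: sval_add; first exact: sval_scale.
by split=> //; rewrite speval_cons h4 /= addr0; ring.
Qed.

Lemma sval_pad l f : sval l f -> sval (spad l) f.
Proof.
move=> h; rewrite -[f]addr0; apply: sval_add => //; split=> //.
by elim: 5%N => [|k IH] //; rewrite speval_cons IH /=; ring.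
Qed.

End SyntacticPolynomials.

Section Events.
Variables (R : realType) (n m : nat) (W Lim : nat).
Variables (S P : seq (R * R)) (a b : R * R).
Local Open Scope nat_scope.
Hypotheses (n0 : 0 < n) (m3 : 2 < m).
Hypothesis hLim : Lim = 64 * (n * m).
Hypothesis hW : 16 * (n * m) ^ 2 + 256 * (n * m) < W.
Notation ast := (ast R).
Notation wp := (@wp R W Lim).
Notation Env := (Env n m S P a b).
Implicit Types (s : ast).
Notation K := (32 * (n * m)).
Let bnd := bounds n0 m3 hLim hW.
Let dim := dims n0 m3 hLim hW.
Notation Sat i := (nth (0, 0)%R S i).
Notation Pat j := (nth (0, 0)%R P j).
Let d : R * R := (b.1 - a.1, b.2 - a.2)%R.

Definition atom_polys pc q : seq {poly R} :=
  evpolys pc a d (Sat (q %/ m)) (Pat (q %% m)) (Pat ((q %% m).+1 %% m)).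

Ltac facts3 hE :=
  have [h1 h2 h3 h4] := dim; have [h5 h6 h7 h8] := bnd;
  have eN := EnvN hE; have eM := EnvM hE; have eNM := EnvNM hE;
  have eOff := EnvOff hE; have eK := EnvK hE.

Definition at_atom q s := [/\ s.1 iQ 0 = q, s.1 iI 0 = q %/ m,
  s.1 iJ 0 = q %% m & s.1 iJ2 0 = (q %% m).+1 %% m].

Lemma sval_q s k : Env s -> k < 5 -> sval W Lim s (sq k) (qpoly (s.2 rPC) k).
Proof. by move=> hE hk; facts3 hE; split=> //; rewrite /roks; wok. Qed.

Lemma rvalB s x y u v : rval W Lim s x u -> rval W Lim s y v ->
  rval W Lim s (rsub x y) (u - v).
Proof. by move=> [? <-] [? <-]. Qed.

Lemma sval_polys s q r : Env s -> at_atom q s -> q < n * m -> r < 8 ->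
  sval W Lim s (nth [::] spolys r) (nth 0%R (atom_polys (s.2 rPC) q) r).
Proof.
move=> hE [eQ eI eJ eJ2] hq hr; facts3 hE.
have m0 : 0 < m by lia.
have hi : q %/ m < n by rewrite ltn_divLR.
have hj : q %% m < m by rewrite ltn_mod.
have hj2 : (q %% m).+1 %% m < m by rewrite ltn_mod.
have ep1 : rval W Lim s ptp1 (Pat (q %% m)).1 by split; [wok|rewrite /= eN eOff eJ (EnvP1 hE)].
have ep2 : rval W Lim s ptp2 (Pat (q %% m)).2 by split; [wok|rewrite /= eN eOff eJ (EnvP2 hE)].
have eq1 : rval W Lim s ptq1 (Pat ((q %% m).+1 %% m)).1.
  by split; [wok|rewrite /= eN eOff eJ2 (EnvP1 hE)].
have eq2 : rval W Lim s ptq2 (Pat ((q %% m).+1 %% m)).2.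
  by split; [wok|rewrite /= eN eOff eJ2 (EnvP2 hE)].
have ea1 : rval W Lim s eA1 a.1 by split; [wok|rewrite /= eOff (EnvA1 hE)].
have ea2 : rval W Lim s eA2 a.2 by split; [wok|rewrite /= eOff (EnvA2 hE)].
have eb1 : rval W Lim s eB1 b.1 by split; [wok|rewrite /= eOff (EnvB1 hE)].
have eb2 : rval W Lim s eB2 b.2 by split; [wok|rewrite /= eOff (EnvB2 hE)].
have es1 : rval W Lim s (eS1 (V iI)) (Sat (q %/ m)).1.
  by split; [wok|rewrite /= eOff eI (EnvS1 hE)].
have es2 : rval W Lim s (eS2 (V iI)) (Sat (q %/ m)).2.
  by split; [wok|rewrite /= eOff eI (EnvS2 hE)].
have ev1 := rvalB es1 ea1; have ev2 := rvalB es2 ea2.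
have ed1 := rvalB eb1 ea1; have ed2 := rvalB eb2 ea2.
have q0 := @sval_q s 0 hE isT; have q1 := @sval_q s 1 hE isT.
have q2 := @sval_q s 2 hE isT; have q3 := @sval_q s 3 hE isT.
have q4 := @sval_q s 4 hE isT.
have hden : sval W Lim s sden (den (s.2 rPC)) by apply: sval_mul.
have hn1 : sval W Lim s snum1 (num1 (s.2 rPC) a d (Sat (q %/ m))).
  apply: sval_add; first exact: sval_scale.
  apply: sval_add; apply: sval_mul => //.
    by apply: sval_sub; apply: sval_scale.
  by apply: sval_add; [apply: sval_scale|apply: sval_sub; apply: sval_scale].
have hn2 : sval W Lim s snum2 (num2 (s.2 rPC) a d (Sat (q %/ m))).
  apply: sval_add; first exact: sval_scale.
  apply: sval_add; apply: sval_mul => //.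
    by apply: sval_add; apply: sval_scale.
  by apply: sval_sub; [apply: sval_scale|apply: sval_add; apply: sval_scale].
have hfx c v : rval W Lim s c v -> sval W Lim s (ssub snum1 (sscale c sden)) (num1 (s.2 rPC) a d (Sat (q %/ m)) - v *: den (s.2 rPC))%R.
  by move=> hc; apply: sval_sub => //; apply: sval_scale.
have hfy c v : rval W Lim s c v -> sval W Lim s (ssub snum2 (sscale c sden)) (num2 (s.2 rPC) a d (Sat (q %/ m)) - v *: den (s.2 rPC))%R.
  by move=> hc; apply: sval_sub => //; apply: sval_scale.
case: r hr => [|[|[|[|[|[|[|[|//]]]]]]]] _.
- exact: q4.
- exact: q3.
- exact: sval_sub.
- exact: hfx.
- exact: hfy.
- exact: hfx.
- exact: hfy.
- by apply: sval_sub; apply: sval_scale; [exact: rvalB|exact: hfy|exact: rvalB|exact: hfx].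
Qed.

Lemma hchk_roots : all (fun r => hchk (roots_at r)) (iota 0 8).
Proof. by vm_compute. Qed.

Lemma size_spolys : all (fun r => size (spad (nth [::] spolys r)) == 5) (iota 0 8).
Proof. by vm_compute. Qed.

Definition has_roots (f : {poly R}) (key : nat -> R) (base : nat) :=
  f != 0%R -> forall x, root f x -> exists2 e, base <= e < base + 4 & key e = x.

Lemma roots_at_ok s q r : Env s -> at_atom q s -> q < n * m -> r < 8 ->
  wp (roots_at r) (hcost (roots_at r)) (fun s' =>
    has_roots (nth 0%R (atom_polys (s.2 rPC) q) r) (s'.2 rKey) (32 * q + 4 * r) /\
    forall e, ~~ (32 * q + 4 * r <= e < 32 * q + 4 * r + 4) -> s'.2 rKey e = s.2 rKey e) s.
Proof.
move=> hE hat hq hr; facts3 hE.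
have [ok pE] := sval_pad (sval_polys hE hat hq hr).
have [eQ _ _ _] := hat.
set f := nth 0%R _ r in pE *.
have sz : size (spad (nth [::] spolys r)) = 5.
  by apply/eqP; apply: (allP size_spolys); rewrite mem_iota.
have hck : hchk (roots_at r) by apply: (allP hchk_roots); rewrite mem_iota.
apply: wp_lf; first by rewrite hck.
rewrite /roots_at; set l := spad _ in sz ok pE *.
have sl : ieval s (slot r) = 32 * q + 4 * r by rewrite /= eQ.
split.
- by rewrite /slot; wok.
- by rewrite sl sz; lia.
- exact: ok.
rewrite sl /rput /rootsl sz size_mkseq -/(speval s l) pE.
split; last first.
  by move=> e he /=; rewrite ifN.
move=> f0 x xr.
have : x \in polyrcf.rootsR f.
  by rewrite -(polyrcf.roots_on_rootsR f0) in_itv /=.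
move=> /(nthP 0%R)[k hk <-].
have k4 : k < 4.
  apply: leq_trans hk _; apply: leq_trans (size_rootsR f) _.
  have : size f <= 5 by rewrite -pE /speval (leq_trans (size_Poly _)) // size_map sz.
  by case: (size f) => //.
exists (32 * q + 4 * r + k); first by lia.
rewrite /= ifT; last by lia.
by rewrite addKn nth_mkseq.
Qed.

End Events.

(** * Complete treatment of one curve *)

Definition path := HSeq gen_events (HSeq sort_code sweep).

Section Path.
Variables (R : realType) (n m : nat) (W Lim : nat).
Variables (S P : seq (R * R)) (a b : R * R).
Local Open Scope nat_scope.
Hypotheses (n0 : 0 < n) (m3 : 2 < m).
Hypothesis hLim : Lim = 64 * (n * m).
Hypothesis hW : 16 * (n * m) ^ 2 + 256 * (n * m) < W.
Notation ast := (ast R).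
Notation wp := (@wp R W Lim).
Notation Env := (Env n m S P a b).
Notation cons := (@cons R n m).
Notation cd := (cd m S P a b).
Notation cnt := (@cnt R n m S P a b).
Notation bestinv := (@bestinv R n m S P a b).
Notation atom_polys := (@atom_polys R m S P a b).
Implicit Types (s : ast).
Notation K := (32 * (n * m)).
Let bnd := bounds n0 m3 hLim hW.
Let dim := dims n0 m3 hLim hW.

Ltac facts4 hE :=
  have [h1 h2 h3 h4] := dim; have [h5 h6 h7 h8] := bnd;
  have eN := EnvN hE; have eM := EnvM hE; have eNM := EnvNM hE;
  have eOff := EnvOff hE; have eK := EnvK hE.

Definition events_upto pc key0 q r s :=
  [/\ Env s, at_atom m q s, s.2 rPC = pc,
      (forall e, ~~ (32 * q <= e < 32 * q + 4 * r) -> s.2 rKey e = key0 e) &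
      forall r', r' < r ->
        has_roots (nth 0%R (atom_polys pc q) r') (s.2 rKey) (32 * q + 4 * r')].

Lemma has_roots_eq (f : {poly R}) k k' base :
  (forall e, base <= e < base + 4 -> k e = k' e) -> has_roots f k base ->
  has_roots f k' base.
Proof.
by move=> h hf f0 x /(hf f0)[e he <-]; exists e => //; rewrite h.
Qed.

Lemma roots_at_step pc key0 q r s : q < n * m -> r < 8 ->
  events_upto pc key0 q r s ->
  wp (roots_at r) (hcost (roots_at r)) (events_upto pc key0 q r.+1) s.
Proof.
move=> hq hr [hE hat epc hk hrt].
apply: wpW (wp_env _ hE (roots_at_ok n0 m3 hLim hW hE hat hq hr)) _ _ => //.
move=> s' [hE' [h1 h2] f].
have [e1 e2 e3 e4] := hat.
split=> //.
- by split; rewrite ?(f.1 iQ) ?(f.1 iI) ?(f.1 iJ) ?(f.1 iJ2).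
- by rewrite (f.2 rPC).
- by move=> e he; rewrite h2 ?hk //; lia.
- move=> r'; rewrite ltnS leq_eqVlt => /orP[/eqP ->|rr].
    by rewrite -epc.
  apply: has_roots_eq (hrt r' rr) => e he; rewrite h2 //; lia.
Qed.

Lemma atom_events_ok s q : Env s -> s.1 iQ 0 = q -> q < n * m ->
  wp atom_events (hcost atom_events) (events_upto (s.2 rPC) (s.2 rKey) q 8) s.
Proof.
move=> hE eQ hq; have hq' : s.1 iQ 0 < n * m by rewrite eQ.
apply: (wp_seq (Q1 := events_upto (s.2 rPC) (s.2 rKey) q 0)).
  apply: wpW (wp_env _ hE (set_ij_ok n0 m3 hLim hW hE hq')) _ _ => //.
  move=> s' [hE' [e1 e2 e3] f]; rewrite eQ in e1 e2 e3.
  split=> //; first by split=> //; rewrite (f.1 iQ).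
    by rewrite (f.2 rPC).
  by move=> e _; rewrite (f.2 rKey).
move=> s0 h0; apply: (wp_seq (roots_at_step (r := 0) hq isT h0)) => {s0 h0}.
move=> s1 h1; apply: (wp_seq (roots_at_step (r := 1) hq isT h1)) => {s1 h1}.
move=> s2 h2; apply: (wp_seq (roots_at_step (r := 2) hq isT h2)) => {s2 h2}.
move=> s3 h3; apply: (wp_seq (roots_at_step (r := 3) hq isT h3)) => {s3 h3}.
move=> s4 h4; apply: (wp_seq (roots_at_step (r := 4) hq isT h4)) => {s4 h4}.
move=> s5 h5; apply: (wp_seq (roots_at_step (r := 5) hq isT h5)) => {s5 h5}.
move=> s6 h6; apply: (wp_seq (roots_at_step (r := 6) hq isT h6)) => {s6 h6}.
by move=> s7 h7; apply: roots_at_step.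
Qed.

Definition gen_keys_cost :=
  n * m * (hcost atom_events + forc iQ (V iNM)) + forc iQ (V iNM).
Definition gen_ids_cost :=
  K * (hcost (HI aId (V kk) (XI (EB IDiv (V kk) (EN 32)))) + forc kk (V iK)) + forc kk (V iK).

Lemma gen_events_ok s : Env s ->
  wp gen_events (gen_keys_cost + gen_ids_cost) (fun s' => [/\ Env s',
     forall e, e < K -> s'.1 aId e = e %/ 32,
     forall q f, q < n * m -> f \in atom_polys (s.2 rPC) q -> f != 0%R ->
       forall x, root f x -> exists e, [/\ e < K, s'.1 aId e = q & s'.2 rKey e = x] &
     framed (imods gen_events) (rmods gen_events) s s']) s.
Proof.
move=> hE; facts4 hE.
set pc := s.2 rPC.
suff h : wp gen_events (gen_keys_cost + gen_ids_cost) (fun s' =>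
     (forall e, e < K -> s'.1 aId e = e %/ 32) /\
     forall q f, q < n * m -> f \in atom_polys (s.2 rPC) q -> f != 0%R ->
       forall x, root f x -> exists e, [/\ e < K, s'.1 aId e = q & s'.2 rKey e = x]) s.
  by apply: wpW (wp_env _ hE h) _ _ => // s' [? [? ?] ?].
have nmW : n * m < W by lia.
have KW : K < W by lia.
have L0 : 0 < Lim by lia.
have LW : Lim <= W by lia.
pose Inv q s' := [/\ Env s', s'.2 rPC = pc & forall q' r, q' < q -> r < 8 ->
   has_roots (nth 0%R (atom_polys pc q') r) (s'.2 rKey) (32 * q' + 4 * r)].
apply: wp_seq.
  apply: (@wp_for R W Lim Inv (n * m) (hcost atom_events) iQ (V iNM) _ _ _ _ L0 LW nmW) => //.
  - by move=> i s' hi [hE' _ _]; have eNM' := EnvNM hE'; wok.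
  - by move=> i j s' [hE' hp hr]; split=> //; case: hE'; split.
  - move=> i s' hi ei [hE' hp hr].
    apply: (wpW (atom_events_ok hE' ei hi) (leqnn _)) => s'' [hE'' _ hp'' hk'' hr''].
    split; [exact: hE''|by rewrite hp''|].
    move=> q' r; rewrite ltnS leq_eqVlt => /orP[/eqP ->|qq] hr8.
      by rewrite -hp; apply: hr''.
    apply: has_roots_eq (hr q' r qq hr8) => e he; rewrite hk'' //; lia.
move=> s1 [[hE1 hp1 hr1] f1].
pose Inv2 i s' := [/\ Env s', s'.2 rKey = s1.2 rKey & forall e, e < i -> s'.1 aId e = e %/ 32].
suff hw : wp gen_ids gen_ids_cost (Inv2 K) s1.
  apply: wpW hw _ _ => // s2 [hE2 hk2 hid2]; split=> [//|q f hq hf f0 x xr].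
  have /(nthP 0%R)[r hr fr] := hf.
  have [e he ke] : exists2 e, 32 * q + 4 * r <= e < 32 * q + 4 * r + 4 & s1.2 rKey e = x.
    by apply: hr1 => //; rewrite fr.
  have hr8 : r < 8 by [].
  exists e; split; first by lia.
    rewrite hid2; last by lia.
    by lia.
  by rewrite hk2.
apply: wpW; first apply: (@wp_for R W Lim Inv2 K (hcost (HI aId (V kk) (XI (EB IDiv (V kk) (EN 32))))) kk (V iK) _ s1 _ _ L0 LW KW) => //; last 2 first.
- exact: leqnn.
- by move=> s2 [].
- by move=> i s' hi [hE' _ _]; have eK' := EnvK hE'; wok.
- by move=> i j s' [hE' hp hr]; split=> //; case: hE'; split.
- move=> i s' hi ei [hE' hp hr].
  have hdiv : i %/ 32 <= i by exact: leq_div.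
  have w : wp (HI aId (V kk) (XI (EB IDiv (V kk) (EN 32)))) (hcost (HI aId (V kk) (XI (EB IDiv (V kk) (EN 32)))))
     (fun s'' => s''.2 rKey = s1.2 rKey /\ forall e, e < i.+1 -> s''.1 aId e = e %/ 32) s'.
    apply: wp_lf => //; wstep; split=> // e he.
    rewrite /= /upd /= ei; case: (e =P i) => [-> //|ne].
    by apply: hr; lia.
  by apply: wpW (wp_env _ hE' w) _ _ => // s'' [? [? ?] _].
Qed.

Definition path_cost E := gen_keys_cost + gen_ids_cost + (sort_cost E K + sweep_cost n m).

Lemma path_ok E s : K <= 2 ^ E -> Env s -> cons s -> bestinv s ->
  (forall u, (quad (s.2 rPC) 0 u ^+ 2 + quad (s.2 rPC) 1 u ^+ 2 = quad (s.2 rPC) 2 u ^+ 2)%R) ->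
  (forall u, quad (s.2 rPC) 2 u <> 0%R) ->
  wp path (path_cost E) (fun s' => [/\ [/\ Env s', cons s' & bestinv s'],
     forall u, cnt (confu (s.2 rPC) u) <= s'.1 iBest 0,
     s.1 iBest 0 <= s'.1 iBest 0 & framed (imods path) (rmods path) s s']) s.
Proof.
move=> hE2 hE hc hb hcs hw; facts4 hE.
set pc := s.2 rPC.
suff h : wp path (path_cost E) (fun s' => [/\ [/\ Env s', cons s' & bestinv s'],
     forall u, cnt (confu pc u) <= s'.1 iBest 0 & s.1 iBest 0 <= s'.1 iBest 0]) s.
  by apply: wpW (wp_frame h) _ _ => // s' [[? ? ?] ?].
apply: (wp_seq (gen_events_ok hE)) => s1 [hE1 hid1 hrt1 f1].
have hc1 := cons_framed f1 isT hc.
have LW : Lim.*2 < W by lia.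
have KL : K < Lim by lia.
have eK1 := EnvK hE1.
apply: (wp_seq (wp_env _ hE1 (sort_ok LW hE2 KL eK1))) => // s2 [hE3 [_ hs2 hp2] f2].
have hc2 := cons_framed f2 isT hc1.
have eb2 : s2.1 iBest 0 = s.1 iBest 0 by rewrite (f2.1 iBest) // (f1.1 iBest).
have hb2 : bestinv s2.
  case: hb; rewrite /bestinv /bconf eb2.
  by rewrite !(f2.2 rBC, f2.2 rBS, f2.2 rBT, f1.2 rBC, f1.2 rBS, f1.2 rBT).
have epc2 : s2.2 rPC = pc by rewrite (f2.2 rPC) // (f1.2 rPC).
have m0 : 0 < n * m by lia.
have sl e : e < K -> e \in index_iota 0 K by rewrite mem_index_iota.
(* Sorting permutes the pairs of a key and an atom, so events are transported in both directions. *)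
have back e : e < K -> exists2 e', e' < K & arr s2 e = arr s1 e'.
  move=> he; have : arr s2 e \in slice (arr s2) 0 K by apply: map_f; apply: sl.
  rewrite (perm_mem hp2) => /mapP[e' he' ->]; exists e' => //.
  by move: he'; rewrite mem_index_iota.
have forth e : e < K -> exists2 e', e' < K & arr s2 e' = arr s1 e.
  move=> he; have : arr s1 e \in slice (arr s1) 0 K by apply: map_f; apply: sl.
  rewrite -(perm_mem hp2) => /mapP[e' he' ->]; exists e' => //.
  by move: he'; rewrite mem_index_iota.
rewrite -epc2 -eb2.
have hid2 e : e < K -> s2.1 aId e < n * m.
  by move=> /back[e' he' [_ ->]]; rewrite hid1 //; lia.
have hall2 q : q < n * m -> exists2 e, e < K & s2.1 aId e = q.
  move=> hq; have he : 32 * q < K by lia.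
  have [e' he' [_ e2]] := forth _ he; exists e' => //.
  by rewrite e2 hid1 // mulKn.
have hcs2 u : (quad (s2.2 rPC) 0 u ^+ 2 + quad (s2.2 rPC) 1 u ^+ 2 = quad (s2.2 rPC) 2 u ^+ 2)%R.
  by rewrite epc2.
have hw2 u : quad (s2.2 rPC) 2 u <> 0%R by rewrite epc2.
have hconst q u v : q < n * m -> (u <= v)%R ->
    (forall e, e < K -> s2.1 aId e = q -> ~~ (u <= s2.2 rKey e <= v)%R) ->
    cd q (confu (s2.2 rPC) u) = cd q (confu (s2.2 rPC) v).
  move=> hq uv hev; apply: ecode_const => // f hf f0 x xr.
  rewrite epc2 in hf.
  have [e [he ie <-]] := hrt1 q f hq hf f0 x xr.
  have [e' he' [k2 i2]] := forth e he.
  by rewrite -k2; apply: hev => //; rewrite i2.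
apply: wpW (sweep_ok n0 m3 hLim hW hE3 hc2 hb2 hs2 hid2 hall2 hcs2 hw2 hconst) _ _ => //.
by move=> s3 [? ? ? _].
Qed.

End Path.

(** * The curves *)

Section PathCoefficients.
Variable R : realType.
Implicit Types p q v a d : R * R.

(* [quad pc 0 / quad pc 2] and [quad pc 1 / quad pc 2] are the cosine and the
   sine, [quad pc 3 / quad pc 4] is the position on the segment. *)
Definition pc_start : seq R :=
  [:: 1; 0; -1;  0; 2; 0;  1; 0; 1;  0; 0; 0;  1; 0; 0].

(** The angle pi corresponds to no finite value of the tangent of the half angle; here the parameter
    is the position on the segment itself. *)
Definition pc_half_turn : seq R :=
  [:: -1; 0; 0;  0; 0; 0;  1; 0; 0;  0; 1; 0;  1; 0; 0].

(* The image of [v] lies on the line [p q] iff [quad pc 4 u * t = quad pc 3 u]. *)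
Definition pc_contact p q v a d : seq R :=
  let e1 := q.1 - p.1 in
  let e2 := q.2 - p.2 in
  let v1 := v.1 - a.1 in
  let v2 := v.2 - a.2 in
  let k := e1 * (a.2 - p.2) - e2 * (a.1 - p.1) in
  let l := e1 * v2 - e2 * v1 in
  [:: 1; 0; -1;  0; 2; 0;  1; 0; 1;
      0 - (k + l); 0 - 2 * (e1 * v1 + e2 * v2); 0 - (k - l);
      0; 0 - 2 * (e1 * d.1 + e2 * d.2); 2 * (e1 * d.2 - e2 * d.1)].

End PathCoefficients.

Fixpoint setpc (k : nat) (l : seq rexp) : hcom :=
  match l with
  | [::] => HSkip
  | x :: l => HSeq (HR rPC (EN k) x) (setpc k.+1 l)
  end.

Definition rm1 := rsub (RN 0) (RN 1).

Definition epc_start :=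
  [:: RN 1; RN 0; rm1; RN 0; RN 2; RN 0; RN 1; RN 0; RN 1; RN 0; RN 0; RN 0; RN 1; RN 0; RN 0].
Definition epc_half_turn :=
  [:: rm1; RN 0; RN 0; RN 0; RN 0; RN 0; RN 1; RN 0; RN 0; RN 0; RN 1; RN 0; RN 1; RN 0; RN 0].

Definition ee1 := rsub ptq1 ptp1.
Definition ee2 := rsub ptq2 ptp2.
Definition ek := rsub (rmul ee1 (rsub eA2 ptp2)) (rmul ee2 (rsub eA1 ptp1)).
Definition el := rsub (rmul ee1 sv2) (rmul ee2 sv1).
Definition epc_contact :=
  [:: RN 1; RN 0; rm1; RN 0; RN 2; RN 0; RN 1; RN 0; RN 1;
      rsub (RN 0) (radd ek el);
      rsub (RN 0) (rmul (RN 2) (radd (rmul ee1 sv1) (rmul ee2 sv2)));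
      rsub (RN 0) (rsub ek el);
      RN 0;
      rsub (RN 0) (rmul (RN 2) (radd (rmul ee1 eD1) (rmul ee2 eD2)));
      rmul (RN 2) (rsub (rmul ee1 eD2) (rmul ee2 eD1))].

Definition init_best :=
  HSeq (rset_ rBC (RN 1)) (HSeq (rset_ rBS (RN 0)) (rset_ rBT (RN 0))).

Definition contact_step :=
  HSeq (hset iQ (XI (V iP))) (HSeq set_ij (HSeq (setpc 0 epc_contact) path)).

(** [RA rm1] is pi, the arc cosine of -1. The arc cosine of the best cosine gives the angle up to
    reflection, and the sign of the sine settles which of the two it is. *)
Definition finish :=
  HSeq (rset_ rX1 (radd eA1 (rmul (RVr rBT) eD1)))
 (HSeq (rset_ rX2 (radd eA2 (rmul (RVr rBT) eD2)))
       (HIf (XL (RVr rBS) (RN 0))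
          (rset_ rU (rsub (rmul (RN 2) (RA rm1)) (RA (RVr rBC))))
          (rset_ rU (RA (RVr rBC))))).

Definition main_code :=
  HSeq init_best
 (HSeq (setpc 0 epc_start) (HSeq path
 (HSeq (setpc 0 epc_half_turn) (HSeq path
 (HSeq (hfor iP (V iNM) contact_step) finish))))).

Section Main.
Variables (R : realType) (n m : nat) (W Lim : nat).
Variables (S P : seq (R * R)) (a b : R * R).
Local Open Scope nat_scope.
Hypotheses (n0 : 0 < n) (m3 : 2 < m).
Hypothesis hLim : Lim = 64 * (n * m).
Hypothesis hW : 16 * (n * m) ^ 2 + 256 * (n * m) < W.
Notation ast := (ast R).
Notation wp := (@wp R W Lim).
Notation Env := (Env n m S P a b).
Notation cons := (@cons R n m).
Notation cnt := (@cnt R n m S P a b).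
Notation bestinv := (@bestinv R n m S P a b).
Implicit Types (s : ast).
Notation K := (32 * (n * m)).
Let bnd := bounds n0 m3 hLim hW.
Let dim := dims n0 m3 hLim hW.
Notation Sat i := (nth (0, 0)%R S i).
Notation Pat j := (nth (0, 0)%R P j).
Let d : R * R := (b.1 - a.1, b.2 - a.2)%R.

Ltac facts5 hE :=
  have [h1 h2 h3 h4] := dim; have [h5 h6 h7 h8] := bnd;
  have eN := EnvN hE; have eM := EnvM hE; have eNM := EnvNM hE;
  have eOff := EnvOff hE; have eK := EnvK hE.

Lemma wpc_mono c (Q Q' : ast -> Prop) s : (forall s', Q s' -> Q' s') ->
  wpc W Lim c Q s -> wpc W Lim c Q' s.
Proof.
elim: c Q Q' s => [|a' ie x|a' ie x|l a' ie|c1 IH1 c2 IH2|x c1 IH1 c2 IH2|//] Q Q' s h /=.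
- exact: h.
- by move=> [? ? ? /h].
- by move=> [? ? ? /h].
- by move=> [? ? ? /h].
- by apply: IH1 => s'; apply: IH2.
- by move=> [? hx]; split=> //; case: ifP hx => _; [apply: IH2|apply: IH1].
Qed.

(** Coefficients are written one after the other, so each expression must have its value in every
    state that differs from the initial one in [rPC] only. *)
Lemma setpc_ok k l (vs : seq R) s : k + size l <= 15 -> hchk (setpc k l) -> size vs = size l ->
  (forall s', framed [::] [:: rPC] s s' -> forall j, j < size l ->
     rval W Lim s' (nth (RN 0) l j) (nth 0%R vs j)) ->
  wpc W Lim (setpc k l) (fun s' => framed [::] [:: rPC] s s' /\
     (forall j, j < k -> s'.2 rPC j = s.2 rPC j) /\
     forall j, j < size l -> s'.2 rPC (k + j) = nth 0%R vs j) s.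
Proof.
have [h5 h6 h7 h8] := bnd; have [h1 h2 h3 h4] := dim.
elim: l vs k s => [|x l IH] vs k s hk hc hsz hv; first by split.
case: vs hsz hv => // v vs [hsz] hv.
have [okx ex] := hv s (framed_refl _ _ _) 0 isT.
split.
- by rewrite /=; rewrite /= in hk; lia.
- by rewrite /=; rewrite /= in hk; lia.
- exact: okx.
rewrite ex; set s1 := rupd _ _ _ _.
have f1 : framed [::] [:: rPC] s s1.
  split=> // c; rewrite inE => /negbTE hcc.
  by apply: funext => i; rewrite /s1 /rupd /upd /= hcc.
apply: (wpc_mono _ (IH vs k.+1 s1 _ _ _ _)) => //.
- move=> s' [f2 [k2 v2]]; split; first exact: framed_trans f1 f2.
  split=> [j jk|[|j] hj].
  + rewrite k2; last by lia.
    by rewrite /s1 /rupd /upd /= ifN //; lia.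
  + rewrite addn0 k2 //.
    by rewrite /s1 /rupd /upd /= !eqxx.
  + by rewrite -addSnnS v2.
- by rewrite /= in hk *; lia.
- by case/andP: hc.
- move=> s' f' j hj; apply: (hv s' _ j.+1) => //; exact: framed_trans f1 f'.
Qed.

Lemma hchk_setpc : [/\ hchk (setpc 0 epc_start) && loopfree (setpc 0 epc_start),
  hchk (setpc 0 epc_half_turn) && loopfree (setpc 0 epc_half_turn) &
  hchk (setpc 0 epc_contact) && loopfree (setpc 0 epc_contact)].
Proof. by split; vm_compute. Qed.

Definition agree15 (pc : nat -> R) (vs : seq R) := forall j, j < 15 -> pc j = nth 0%R vs j.

Lemma quad_agree pc vs k u : agree15 pc vs -> k < 5 -> quad pc k u = quad (nth 0%R vs) k u.
Proof. by move=> h hk; rewrite /quad !h //; lia. Qed.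

Lemma confu_agree pc vs u : agree15 pc vs -> confu pc u = confu (nth 0%R vs) u.
Proof. by move=> h; rewrite /confu !(quad_agree _ h). Qed.

Lemma setpc_wp l vs s : hchk (setpc 0 l) && loopfree (setpc 0 l) -> size l = 15 ->
  size vs = 15 -> Env s ->
  (forall s', framed [::] [:: rPC] s s' -> Env s' -> forall j, j < 15 ->
     rval W Lim s' (nth (RN 0) l j) (nth 0%R vs j)) ->
  wp (setpc 0 l) (hcost (setpc 0 l)) (fun s' => [/\ Env s', agree15 (s'.2 rPC) vs &
     framed [::] [:: rPC] s s']) s.
Proof.
move=> hc hl hvs hE hv; apply: wp_lf => //; case/andP: hc => hc _.
apply: (wpc_mono _ (setpc_ok (vs := vs) _ hc _ _)); rewrite ?hl ?hvs //.
  move=> s' [f [_ h]]; split=> //; exact: Env_framed f isT hE.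
move=> s' f j hj; apply: hv => //; exact: Env_framed f isT hE.
Qed.

Definition good_pc (pc : nat -> R) :=
  (forall u, (quad pc 0 u ^+ 2 + quad pc 1 u ^+ 2 = quad pc 2 u ^+ 2)%R) /\
  (forall u, quad pc 2 u <> 0%R).

Lemma circle_pc l : size l = 6 ->
  good_pc (nth 0%R ([:: 1; 0; -1;  0; 2; 0;  1; 0; 1]%R ++ l)).
Proof.
move=> _; split=> u; rewrite /quad /=; first by ring.
by move=> h; have := sqr_ge0 u; nra.
Qed.

Lemma good_half_turn : good_pc (nth 0%R (pc_half_turn R)).
Proof. by split=> u; rewrite /quad /=; [ring|lra]. Qed.

Lemma run_path E pcl s : K <= 2 ^ E -> [/\ Env s, cons s & bestinv s] ->
  agree15 (s.2 rPC) pcl -> good_pc (nth 0%R pcl) ->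
  wp path (path_cost n m E) (fun s' => [/\ [/\ Env s', cons s' & bestinv s'],
     forall u, cnt (confu (nth 0%R pcl) u) <= s'.1 iBest 0,
     s.1 iBest 0 <= s'.1 iBest 0 & framed (imods path) (rmods path) s s']) s.
Proof.
move=> hE [hEnv hc hb] hag [hg1 hg2].
apply: wpW (path_ok n0 m3 hLim hW hE hEnv hc hb _ _) _ _ => //.
- by move=> u; rewrite !(quad_agree _ hag).
- by move=> u; rewrite !(quad_agree _ hag).
- move=> s' [h1 h2 h3 h4]; split=> // u; rewrite -(confu_agree _ hag); exact: h2.
Qed.

Definition all3 s := [/\ Env s, cons s & bestinv s].

Lemma bestinv_framed li lr s s' : framed li lr s s' -> iBest \notin li ->
  all (fun x => x \notin lr) [:: rBC; rBS; rBT] -> bestinv s -> bestinv s'.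
Proof.
move=> [h1 h2] k1 /= /and4P[k2 k3 k4 _].
by rewrite /bestinv /bconf (h1 _ k1) (h2 _ k2) (h2 _ k3) (h2 _ k4).
Qed.

Lemma all3_framed li lr s s' : framed li lr s s' ->
  all (fun x => x \notin li) [:: iN; iM; iNM; iOff; iK; aAgg; aCode; iTot; iBest] ->
  all (fun x => x \notin lr) [:: rIN; rBC; rBS; rBT] -> all3 s -> all3 s'.
Proof.
move=> f /= h1 h2 [hE hc hb].
case/and5P: h1 => k1 k2 k3 k4 /and5P[k5 k6 k7 k8 /andP[k9 _]].
case/and5P: h2 => k10 k11 k12 k13 _.
split.
- by apply: Env_framed f _ hE; rewrite /= k1 k2 k3 k4 k5 k10.
- by apply: cons_framed f _ hc; rewrite /= k6 k7 k8.
- by apply: bestinv_framed f _ _ hb => //; rewrite /= k11 k12 k13.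
Qed.

Definition pcq q := pc_contact (Pat (q %% m)) (Pat ((q %% m).+1 %% m)) (Sat (q %/ m)) a d.

Lemma epc_contact_ok s q : Env s -> at_atom m q s -> q < n * m -> forall j, j < 15 ->
  rval W Lim s (nth (RN 0) epc_contact j) (nth 0%R (pcq q) j).
Proof.
move=> hE [eQ eI eJ eJ2] hq; facts5 hE.
have m0 : 0 < m by lia.
have hi : q %/ m < n by rewrite ltn_divLR.
have hj : q %% m < m by rewrite ltn_mod.
have hj2 : (q %% m).+1 %% m < m by rewrite ltn_mod.
have ep1 : rval W Lim s ptp1 (Pat (q %% m)).1 by split; [wok|rewrite /= eN eOff eJ (EnvP1 hE)].
have ep2 : rval W Lim s ptp2 (Pat (q %% m)).2 by split; [wok|rewrite /= eN eOff eJ (EnvP2 hE)].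
have eq1 : rval W Lim s ptq1 (Pat ((q %% m).+1 %% m)).1.
  by split; [wok|rewrite /= eN eOff eJ2 (EnvP1 hE)].
have eq2 : rval W Lim s ptq2 (Pat ((q %% m).+1 %% m)).2.
  by split; [wok|rewrite /= eN eOff eJ2 (EnvP2 hE)].
have ea1 : rval W Lim s eA1 a.1 by split; [wok|rewrite /= eOff (EnvA1 hE)].
have ea2 : rval W Lim s eA2 a.2 by split; [wok|rewrite /= eOff (EnvA2 hE)].
have eb1 : rval W Lim s eB1 b.1 by split; [wok|rewrite /= eOff (EnvB1 hE)].
have eb2 : rval W Lim s eB2 b.2 by split; [wok|rewrite /= eOff (EnvB2 hE)].
have es1 : rval W Lim s (eS1 (V iI)) (Sat (q %/ m)).1.
  by split; [wok|rewrite /= eOff eI (EnvS1 hE)].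
have es2 : rval W Lim s (eS2 (V iI)) (Sat (q %/ m)).2.
  by split; [wok|rewrite /= eOff eI (EnvS2 hE)].
have rA x y u v : rval W Lim s x u -> rval W Lim s y v -> rval W Lim s (radd x y) (u + v)%R.
  by move=> [? <-] [? <-].
have rB x y u v : rval W Lim s x u -> rval W Lim s y v -> rval W Lim s (rsub x y) (u - v)%R.
  by move=> [? <-] [? <-].
have rM x y u v : rval W Lim s x u -> rval W Lim s y v -> rval W Lim s (rmul x y) (u * v)%R.
  by move=> [? <-] [? <-].
have r0 : rval W Lim s (RN 0) 0%R by [].
have r1 : rval W Lim s (RN 1) 1%R by [].
have r2 : rval W Lim s (RN 2) 2%R by [].
have rm : rval W Lim s rm1 (-1)%R by rewrite -[(-1)%R]sub0r; apply: rB.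
rewrite /epc_contact /ek /el.
do 15?[case=> [_|]] => //; do ?[assumption | apply: (rB) | apply: (rA) | apply: (rM)].
Qed.

Lemma start_ok s : forall j, j < 15 ->
  rval W Lim s (nth (RN 0) epc_start j) (nth 0%R (pc_start R) j).
Proof. by do 15?[case=> [_|]] => //; split=> //=; rewrite sub0r. Qed.

Lemma half_turn_ok s : forall j, j < 15 ->
  rval W Lim s (nth (RN 0) epc_half_turn j) (nth 0%R (pc_half_turn R) j).
Proof. by do 15?[case=> [_|]] => //; split=> //=; rewrite sub0r. Qed.

Lemma contact_step_ok E q s : K <= 2 ^ E -> all3 s -> s.1 iP 0 = q -> q < n * m ->
  wp contact_step (hcost (hset iQ (XI (V iP))) + (hcost set_ij +
      (hcost (setpc 0 epc_contact) + path_cost n m E)))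
   (fun s' => [/\ all3 s', forall u, cnt (confu (nth 0%R (pcq q)) u) <= s'.1 iBest 0 &
      s.1 iBest 0 <= s'.1 iBest 0]) s.
Proof.
move=> hE h3' eP hq; have [hEnv _ _] := h3'; facts5 hEnv.
have w1 : wp (hset iQ (XI (V iP))) (hcost (hset iQ (XI (V iP)))) (fun s' => s'.1 iQ 0 = q) s.
  by apply: wp_lf => //; rewrite /hset; wstep; rewrite /= /upd /= eP.
apply: (wp_seq (wp_env _ hEnv w1)) => // s1 [hE1 eQ1 f1].
have a1 := all3_framed f1 isT isT h3'.
have hq1 : s1.1 iQ 0 < n * m by rewrite eQ1.
apply: (wp_seq (wp_env _ hE1 (set_ij_ok n0 m3 hLim hW hE1 hq1))) => // s2 [hE2 [e1 e2 e3] f2].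
have a2 := all3_framed f2 isT isT a1; rewrite eQ1 in e1 e2 e3.
have [_ _ hck] := hchk_setpc.
apply: (wp_seq (setpc_wp (vs := pcq q) hck _ _ hE2 _)) => //.
  move=> s' f' hE'; apply: epc_contact_ok => //.
  by split; rewrite ?(f'.1 iI) ?(f'.1 iJ) ?(f'.1 iJ2) ?(f'.1 iQ) // (f2.1 iQ).
move=> s3 [hE3 ag3 f3].
have a3 := all3_framed f3 isT isT a2.
have g3 : good_pc (nth 0%R (pcq q)) by exact: circle_pc.
apply: (wpW (run_path hE a3 ag3 g3) (leqnn _)) => s4 [a4 h4' h5' _].
split; [exact: a4|exact: h4'|].
by move: h5'; rewrite (f3.1 iBest) ?(f2.1 iBest) ?(f1.1 iBest).
Qed.

Definition main_cost E :=
  hcost init_best + (hcost (setpc 0 epc_start) + (path_cost n m E +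
   (hcost (setpc 0 epc_half_turn) + (path_cost n m E +
    (((n * m) * ((hcost (hset iQ (XI (V iP))) + (hcost set_ij +
      (hcost (setpc 0 epc_contact) + path_cost n m E))) + forc iP (V iNM)) + forc iP (V iNM)) +
     hcost finish))))).

Definition output_ok s := exists k : R * R * R,
  [/\ validk k,
    s.2 rX1 0 = (a.1 + k.2 * d.1)%R /\ s.2 rX2 0 = (a.2 + k.2 * d.2)%R,
    s.2 rU 0 = (if k.1.2 < 0 then 2 * pi - acos k.1.1 else acos k.1.1)%R,
    forall u, cnt (confu (nth 0%R (pc_start R)) u) <= cnt k /\
              cnt (confu (nth 0%R (pc_half_turn R)) u) <= cnt k &
    forall q u, q < n * m -> cnt (confu (nth 0%R (pcq q)) u) <= cnt k].

Lemma finish_ok s : all3 s ->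
  wp finish (hcost finish) (fun s' =>
   [/\ s'.2 rX1 0 = (a.1 + (bconf s).2 * d.1)%R, s'.2 rX2 0 = (a.2 + (bconf s).2 * d.2)%R &
    s'.2 rU 0 = (if (bconf s).1.2 < 0 then 2 * pi - acos (bconf s).1.1 else acos (bconf s).1.1)%R]) s.
Proof.
move=> [hE _ [_ [hk _]]]; facts5 hE.
have hac : (-1 <= s.2 rBC 0 <= 1)%R.
  move: hk; rewrite /bconf /=; move: (s.2 rBC 0) (s.2 rBS 0) => x y hxy.
  by have := sqr_ge0 y; move=> hy; apply/andP; split; nra.
have acos_m1 : acos (-1) = pi :> R by rewrite acosN1.
apply: wp_lf => //; rewrite /finish /rset_; wstep; wstep; split.
  by wok.
rewrite /= /upd /= eOff (EnvA1 hE) (EnvA2 hE) (EnvB1 hE) (EnvB2 hE) /bconf /= eqb0 -leNgt.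
rewrite ltNge; case: (0 <= s.2 rBS 0)%R => /=.
  by split; [wok|lia|split => //; wok|split].
split; [by wok|by lia| |by rewrite sub0r acos_m1].
do !split => //; rewrite ?nidsE //; try lia; by rewrite sub0r lexx /=; lra.
Qed.

Lemma main_ok E s : K <= 2 ^ E -> Env s -> cons s -> s.1 iBest 0 = 0 ->
  wp main_code (main_cost E) output_ok s.
Proof.
move=> hE hEnv hc hb0; facts5 hEnv.
have w0 : wp init_best (hcost init_best) (fun s' => bconf s' = (1, 0, 0)%R) s.
  by apply: wp_lf => //; rewrite /init_best /rset_; do 3!wstep.
apply: (wp_seq (wp_env _ hEnv w0)) => // s0 [hE0 e0 f0].
have a0 : all3 s0.
  split=> //; first exact: cons_framed f0 isT hc.
  rewrite /bestinv e0 (f0.1 iBest) // hb0; split=> //.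
  by split; rewrite /= ?lexx ?ler01 //; ring.
have [hk1 hk2 hk3] := hchk_setpc.
apply: (wp_seq (setpc_wp (vs := pc_start R) hk1 _ _ hE0 _)) => //.
  by move=> s' _ _; apply: start_ok.
move=> s1 [hE1 ag1 f1]; have a1 := all3_framed f1 isT isT a0.
apply: (wp_seq (run_path hE a1 ag1 _)); first exact: circle_pc.
move=> s2 [a2 hb2 _ _]; have [hE2 _ _] := a2.
apply: (wp_seq (setpc_wp (vs := pc_half_turn R) hk2 _ _ hE2 _)) => //.
  by move=> s' _ _; apply: half_turn_ok.
move=> s3 [hE3 ag3 f3]; have a3 := all3_framed f3 isT isT a2.
have eb3 : s3.1 iBest 0 = s2.1 iBest 0 by rewrite (f3.1 iBest).
apply: (wp_seq (run_path hE a3 ag3 _)); first exact: good_half_turn.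
move=> s4 [a4 hb4 hb43 _]; rewrite eb3 in hb43.
pose Inv q s' := [/\ all3 s', s4.1 iBest 0 <= s'.1 iBest 0 & forall q' u, q' < q ->
  cnt (confu (nth 0%R (pcq q')) u) <= s'.1 iBest 0].
have nmW : n * m < W by lia.
have L0 : 0 < Lim by lia.
have LW : Lim <= W by lia.
apply: wp_seq.
  apply: (@wp_for R W Lim Inv (n * m) _ iP (V iNM) contact_step s4 isT isT L0 LW nmW isT).
  - by move=> i s' hi [[hE' _ _] _]; have eNM' := EnvNM hE'; wok.
  - move=> i j s' [[hE' hc' hb'] h2' h3']; split; [|exact: h2'|exact: h3'].
    by split; [case: hE'; split|case: hc'; split|exact: hb'].
  - move=> i s' hi ei [a' h2' h3'].
    apply: (wpW (contact_step_ok hE a' ei hi) (leqnn _)) => s'' [a'' k1 k2].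
    split; [exact: a''|exact: leq_trans k2|].
    move=> q' u; rewrite ltnS leq_eqVlt => /orP[/eqP ->|qq]; first exact: k1.
    exact: leq_trans (h3' q' u qq) k2.
  - by split; [exact: a4|exact: leqnn|].
move=> s5 [[a5 hb5 hb6] _].
apply: wpW (finish_ok a5) _ _ => // s6 [k1 k2 k3].
have [_ _ [hb7 hv]] := a5.
exists (bconf s5); split=> //.
  move=> u; split.
    by apply: leq_trans hb7; apply: leq_trans hb5; apply: leq_trans hb43.
  by apply: leq_trans hb7; apply: leq_trans hb5.
by move=> q u hq; apply: leq_trans hb7; apply: hb6.
Qed.

End Main.

(** * Point location in a simple polygon *)

Section EdgeGeometry.
Variable R : realType.
Implicit Types (p q x y z : R * R).

Lemma between_frac (u v w : R) : between u v w -> u != v ->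
  0 <= (w - u) / (v - u) <= 1.
Proof.
move=> hb uv; case/orP: hb => /andP[h1 h2].
  have d0 : 0 < v - u by rewrite subr_gt0 lt_neqAle uv (le_trans h1 h2).
  by rewrite ler_pdivlMr // ler_pdivrMr // mul0r mul1r; apply/andP; split; lra.
have d0 : v - u < 0 by rewrite subr_lt0 lt_neqAle eq_sym uv (le_trans h1 h2).
by rewrite ler_ndivlMr // ler_ndivrMr // mul0r mul1r; apply/andP; split; lra.
Qed.

Lemma segmentP p q x : reflect (segment p q x) (on_edge p q x).
Proof.
apply: (iffP idP); last first.
  move=> [t]; rewrite /= in_itv /= => /andP[t0 t1] <-.
  apply/and3P; split=> /=; first by apply/eqP; rewrite /crossp /=; ring.
    by rewrite /between; case: (leP p.1 q.1) => h; apply/orP; [left|right]; apply/andP; split; nra.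
  by rewrite /between; case: (leP p.2 q.2) => h; apply/orP; [left|right]; apply/andP; split; nra.
case: p q x => p1 p2 [q1 q2] [x1 x2] /and3P[/eqP]; rewrite /crossp /= => hc hb1 hb2.
(* The parameter is read off a coordinate that varies along the segment; if none does, the segment
   is a point. *)
have [e1|n1] := eqVneq p1 q1; last first.
  have d1 : q1 - p1 != 0 by rewrite subr_eq0 eq_sym.
  exists ((x1 - p1) / (q1 - p1)); first by rewrite /= in_itv /= between_frac.
  congr pair => /=; first by field.
  apply/eqP; rewrite -subr_eq0; apply/eqP.
  have -> : p2 + (x1 - p1) / (q1 - p1) * (q2 - p2) - x2 =
    - ((q1 - p1) * (x2 - p2) - (q2 - p2) * (x1 - p1)) / (q1 - p1) by field.
  by rewrite hc oppr0 mul0r.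
have [e2|n2] := eqVneq p2 q2.
  exists 0; first by rewrite /= in_itv /= lexx ler01.
  by rewrite /= !mul0r !addr0; move: hb1 hb2; rewrite /between -e1 -e2 => hb1 hb2; congr pair; lra.
have d2 : q2 - p2 != 0 by rewrite subr_eq0 eq_sym.
exists ((x2 - p2) / (q2 - p2)); first by rewrite /= in_itv /= between_frac.
congr pair => /=; last by field.
by move: hb1; rewrite /between -e1 subrr mulr0 => hb1; lra.
Qed.

Lemma segmentC p q x : segment p q x -> segment q p x.
Proof.
move=> /segmentP /and3P[/eqP h1 h2 h3]; apply/segmentP/and3P; split.
- by apply/eqP; move: h1; rewrite /crossp; lra.
- by move: h2; rewrite /between orbC.
- by move: h3; rewrite /between orbC.
Qed.

Lemma crosspC p q x : crossp q p x = - crossp p q x.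
Proof. by rewrite /crossp; ring. Qed.

Lemma ray_edgeC p q x : ray_edge q p x = ray_edge p q x.
Proof. by rewrite /ray_edge crosspC oppr_gt0 oppr_lt0 orbC. Qed.

(** The strict conditions on a point used below all amount to the positivity of an affine form, so
    one continuity argument serves for all of them. *)
Definition aff (c : R * R * R) x := c.1.1 * x.1 + c.1.2 * x.2 + c.2.

Lemma near_aff c x : 0 < aff c x -> \forall y \near x, 0 < aff c y.
Proof.
move=> h; have hc : aff c y @[y --> x] --> aff c x.
  apply: cvgD; last exact: cvg_cst.
  apply: cvgD; (apply: cvgM; first exact: cvg_cst); [exact: cvg_fst|exact: cvg_snd].
exact: (cvgr_gt _ hc _ h).
Qed.

Lemma crossp_aff p q x : crossp p q x =
  aff (- (q.2 - p.2), q.1 - p.1, (q.2 - p.2) * p.1 - (q.1 - p.1) * p.2) x.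
Proof. by rewrite /crossp /aff /=; ring. Qed.

Lemma near_crossp_pos p q x : 0 < crossp p q x -> \forall y \near x, 0 < crossp p q y.
Proof.
rewrite crossp_aff => /near_aff h; near=> y; rewrite crossp_aff; near: y; exact: h.
Unshelve. all: by end_near. Qed.

Lemma near_crossp_neg p q x : crossp p q x < 0 -> \forall y \near x, crossp p q y < 0.
Proof.
rewrite -oppr_gt0 -crosspC => /near_crossp_pos h; near=> y.
by rewrite -oppr_gt0 -crosspC; near: y; exact: h.
Unshelve. all: by end_near. Qed.

Lemma near_lt2 (c : R) x : x.2 < c -> \forall y \near x, y.2 < c.
Proof.
move=> h; have : 0 < aff (0, -1, c) x by rewrite /aff /=; lra.
move=> /near_aff k; near=> y.
have : 0 < aff (0, -1, c) y by near: y; exact: k.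
by rewrite /aff /=; lra.
Unshelve. all: by end_near. Qed.

Lemma near_gt2 (c : R) x : c < x.2 -> \forall y \near x, c < y.2.
Proof.
move=> h; have : 0 < aff (0, 1, - c) x by rewrite /aff /=; lra.
move=> /near_aff k; near=> y.
have : 0 < aff (0, 1, - c) y by near: y; exact: k.
by rewrite /aff /=; lra.
Unshelve. all: by end_near. Qed.

Lemma near_lt1 (c : R) x : x.1 < c -> \forall y \near x, y.1 < c.
Proof.
move=> h; have : 0 < aff (-1, 0, c) x by rewrite /aff /=; lra.
move=> /near_aff k; near=> y.
have : 0 < aff (-1, 0, c) y by near: y; exact: k.
by rewrite /aff /=; lra.
Unshelve. all: by end_near. Qed.

Lemma near_gt1 (c : R) x : c < x.1 -> \forall y \near x, c < y.1.
Proof.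
move=> h; have : 0 < aff (1, 0, - c) x by rewrite /aff /=; lra.
move=> /near_aff k; near=> y.
have : 0 < aff (1, 0, - c) y by near: y; exact: k.
by rewrite /aff /=; lra.
Unshelve. all: by end_near. Qed.

Lemma near_off_edge p q x : ~ segment p q x -> \forall y \near x, ~ segment p q y.
Proof.
move=> h.
suff : \forall y \near x, ~~ on_edge p q y.
  by apply: filterS => y hy /segmentP; apply/negP.
have : ~~ on_edge p q x by apply/negP => /segmentP.
rewrite /on_edge !negb_and => /or3P[hc|hb|hb].
- case: (ltgtP (crossp p q x) 0) => [h0|h0|h0]; last by rewrite h0 eqxx in hc.
    by apply: filterS (near_crossp_neg h0) => y hy; rewrite lt_eqF.
  by apply: filterS (near_crossp_pos h0) => y hy; rewrite gt_eqF.
- have [h1|h1] : (x.1 < p.1 /\ x.1 < q.1) \/ (p.1 < x.1 /\ q.1 < x.1).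
    by move: hb; rewrite /between; lra.
  + apply: filterS2 (near_lt1 h1.1) (near_lt1 h1.2) => y k1 k2.
    have k : ~~ between p.1 q.1 y.1 by rewrite /between; lra.
    by rewrite /on_edge (negbTE k) !andbF.
  + apply: filterS2 (near_gt1 h1.1) (near_gt1 h1.2) => y k1 k2.
    have k : ~~ between p.1 q.1 y.1 by rewrite /between; lra.
    by rewrite /on_edge (negbTE k) !andbF.
- have [h1|h1] : (x.2 < p.2 /\ x.2 < q.2) \/ (p.2 < x.2 /\ q.2 < x.2).
    by move: hb; rewrite /between; lra.
  + apply: filterS2 (near_lt2 h1.1) (near_lt2 h1.2) => y k1 k2.
    have k : ~~ between p.2 q.2 y.2 by rewrite /between; lra.
    by rewrite /on_edge (negbTE k) !andbF.
  + apply: filterS2 (near_gt2 h1.1) (near_gt2 h1.2) => y k1 k2.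
    have k : ~~ between p.2 q.2 y.2 by rewrite /between; lra.
    by rewrite /on_edge (negbTE k) !andbF.
Qed.

(* The flip of [ray_edge] when [y] crosses the level of a vertex [p] that lies
   on the rightward ray from [x]. *)
Definition vflip x p y := [&& p.2 == x.2, x.1 < p.1 & p.2 <= y.2].

(** Near [x] the test changes only if an end point of the edge lies on the rightward ray from [x],
    and the change splits into one contribution per end point. Around a closed polygon the
    contributions of each vertex will cancel. *)
Lemma near_ray_edge p q x : ~ segment p q x -> \forall y \near x,
  ray_edge p q y (+) ray_edge p q x =
  (vflip x p y (+) vflip x p x) (+) (vflip x q y (+) vflip x q x).
Proof.
have hlt (c : R) z : z.2 < c -> (c <= z.2) = false by move=> h; rewrite leNgt h.
wlog pq : p q / p.2 <= q.2.
  move=> hw; case: (leP p.2 q.2) => h; first exact: hw.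
  move=> /(@contra_not _ _ (@segmentC q p x)) hs.
  have := hw q p (ltW h) hs; apply: filterS => y.
  by rewrite !(ray_edgeC p q) => ->; rewrite addbC.
move=> hs.
have noq z : (q.2 <= z.2 < p.2) = false by apply/negbTE; lra.
have rE z : ray_edge p q z = (p.2 <= z.2 < q.2) && (0 < crossp p q z).
  by rewrite /ray_edge noq orbF.
case: (ltgtP p.2 x.2) => hp.
- case: (ltgtP q.2 x.2) => hq.
  + apply: filterS2 (near_gt2 hp) (near_gt2 hq) => y k1 k2.
    by rewrite !rE /vflip (lt_eqF hp) (lt_eqF hq) /= !(ltNge _ q.2) (ltW hq) (ltW k2) !andbF.
  + have hc : crossp p q x != 0.
      apply/eqP => hc; apply: hs; apply/segmentP/and3P; split; first by rewrite hc.
        move: hc; rewrite /crossp /between => hc.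
        case: (leP p.1 q.1) => h; apply/orP; [left|right]; apply/andP; split; nra.
      by rewrite /between (ltW hp) (ltW hq).
    have [h0|h0] : (0 < crossp p q x) \/ (crossp p q x < 0).
      by case: (ltgtP (crossp p q x) 0) hc => h //; [right|left].
    * apply: filterS3 (near_gt2 hp) (near_lt2 hq) (near_crossp_pos h0) => y k1 k2 k3.
      by rewrite !rE /vflip (lt_eqF hp) (gt_eqF hq) /= (ltW hp) (ltW k1) hq k2 h0 k3.
    * apply: filterS3 (near_gt2 hp) (near_lt2 hq) (near_crossp_neg h0) => y k1 k2 k3.
      by rewrite !rE /vflip (lt_eqF hp) (gt_eqF hq) /= !(ltNge 0) (ltW h0) (ltW k3) !andbF.
  + have hx : x.1 != q.1.
      apply/eqP => e; apply: hs; apply/segmentP/and3P; split.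
      * by rewrite /crossp e hq; apply/eqP; ring.
      * by rewrite /between e; case: (leP p.1 q.1) => ?; rewrite ?lexx ?andbT //= ltW.
      * by rewrite /between hq lexx (ltW hp).
    have cE : crossp p q x = (x.2 - p.2) * (q.1 - x.1) by rewrite /crossp hq; ring.
    case: (ltgtP x.1 q.1) hx => // h1 _.
    * have h0 : 0 < crossp p q x by rewrite cE mulr_gt0 // subr_gt0.
      apply: filterS2 (near_gt2 hp) (near_crossp_pos h0) => y k1 k2.
      rewrite !rE /vflip (lt_eqF hp) /= (ltW hp) (ltW k1) h0 k2 hq eqxx h1 /= !andbT lexx.
      by rewrite !ltNge lexx; case: (x.2 <= y.2).
    * have h0 : crossp p q x < 0 by rewrite cE nmulr_llt0 ?subr_lt0 // subr_gt0.
      apply: filterS (near_crossp_neg h0) => y k2.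
      rewrite !rE /vflip (lt_eqF hp) /= hq eqxx (ltNge x.1) (ltW h1) /=.
      by rewrite !(ltNge 0) (ltW h0) (ltW k2) !andbF.
- apply: filterS (near_lt2 hp) => y k1.
  have hq : x.2 < q.2 by lra.
  by rewrite !rE /vflip (gt_eqF hp) (gt_eqF hq) /= !hlt.
- case: (ltgtP q.2 x.2) => hq; first by move: pq; lra.
  + have hx : x.1 != p.1.
      apply/eqP => e; apply: hs; apply/segmentP/and3P; split.
      * by rewrite /crossp e hp; apply/eqP; ring.
      * by rewrite /between e; case: (leP p.1 q.1) => ?; rewrite ?lexx ?andbT //= ltW.
      * by rewrite /between hp lexx (ltW hq).
    have cE : crossp p q x = (q.2 - x.2) * (p.1 - x.1) by rewrite /crossp hp; ring.
    case: (ltgtP x.1 p.1) hx => // h1 _.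
    * have h0 : 0 < crossp p q x by rewrite cE mulr_gt0 // subr_gt0.
      apply: filterS2 (near_lt2 hq) (near_crossp_pos h0) => y k1 k2.
      by rewrite !rE /vflip (gt_eqF hq) /= hq k1 h0 k2 hp eqxx h1 /= !andbT lexx addbF.
    * have h0 : crossp p q x < 0 by rewrite cE nmulr_llt0 ?subr_lt0 // subr_gt0.
      apply: filterS (near_crossp_neg h0) => y k2.
      rewrite !rE /vflip (gt_eqF hq) /= hp eqxx (ltNge x.1) (ltW h1) /=.
      by rewrite !(ltNge 0) (ltW h0) (ltW k2) !andbF.
  + have hpq : p.2 = q.2 by lra.
    (* A horizontal edge at the level of [x] that does not contain [x] lies entirely to one side of
       it, so both end points flip or neither does. *)
    have h12 : (x.1 < p.1) = (x.1 < q.1).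
      case: (ltP x.1 p.1) => u1; case: (ltP x.1 q.1) => u2 //;
        exfalso; apply: hs; apply/segmentP/and3P; split.
      * by rewrite /crossp -hpq hp; apply/eqP; ring.
      * by rewrite /between; lra.
      * by rewrite /between -hpq hp lexx.
      * by rewrite /crossp -hpq hp; apply/eqP; ring.
      * by rewrite /between; lra.
      * by rewrite /between -hpq hp lexx.
    apply: filterE => y; rewrite !rE /vflip -hpq h12.
    have nn z : (p.2 <= z.2 < p.2) = false by apply/negbTE; lra.
    by rewrite !nn /= addbb.
Qed.

End EdgeGeometry.

(** * Parity of the number of crossed edges *)

Section Parity.
Variables (R : realType) (P : seq (R * R)).
Hypothesis sP : simple_polygon P.
Implicit Types (x y z : R * R).

Lemma near_forall (I : finType) (f : I -> R * R -> Prop) x :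
  (forall i, \forall y \near x, f i y) -> \forall y \near x, forall i, f i y.
Proof. by move=> h; exact (@filter_forall _ I f (nbhs x) _ h). Qed.

Local Notation m := (size P).
Local Notation nx i := (i.+1 %% m)%N.
Local Notation bd := (boundary P).

Let m3 : (3 <= m)%N. Proof. by case: sP. Qed.

Lemma boundaryP x : bd x <-> exists i : 'I_m, edge P i x.
Proof.
split; first by move=> [i /= hi hx]; exists (Ordinal hi).
by move=> [i hx]; exists (i : nat) => //=.
Qed.

Definition par y := \big[addb/false]_(i < m) ray_edge P`_i P`_(nx i) y.

Lemma near_off_boundary x : ~ bd x -> \forall y \near x, ~ bd y.
Proof.
move=> hx.
have : \forall y \near x, forall i : 'I_m, ~ edge P i y.
  apply: (near_forall (f := fun (i : 'I_m) y => ~ edge P i y)) => i.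
  apply: near_off_edge => hs.
  by apply: hx; apply/boundaryP; exists i.
by apply: filterS => y hy /boundaryP[i]; exact: hy.
Qed.

Lemma par_near x : ~ bd x -> \forall y \near x, par y = par x.
Proof.
move=> hx.
have : \forall y \near x, forall i : 'I_m,
  ray_edge P`_i P`_(nx i) y (+) ray_edge P`_i P`_(nx i) x =
  (vflip x P`_i y (+) vflip x P`_i x) (+) (vflip x P`_(nx i) y (+) vflip x P`_(nx i) x).
  apply: (near_forall (f := fun (i : 'I_m) y =>
    ray_edge P`_i P`_(nx i) y (+) ray_edge P`_i P`_(nx i) x =
    (vflip x P`_i y (+) vflip x P`_i x) (+) (vflip x P`_(nx i) y (+) vflip x P`_(nx i) x))) => i.
  apply: near_ray_edge => hs.
  by apply: hx; apply/boundaryP; exists i.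
apply: filterS => y hy; apply/eqP; rewrite -[_ == _]negbK -negb_add; apply/negP.
rewrite negbK /par -big_split /= (eq_bigr _ (fun i _ => hy i)) big_split /=.
(* Each vertex ends one edge and starts the next one: a cyclic shift of the index matches the two
   halves. *)
have -> : \big[addb/false]_(i < m) (vflip x P`_(nx i) y (+) vflip x P`_(nx i) x) =
          \big[addb/false]_(i < m) (vflip x P`_i y (+) vflip x P`_i x).
  have mE : m = m.-1.+1 by rewrite prednK //; lia.
  by rewrite [RHS](reindex_inj (@ordS_inj m)) /=.
by rewrite addbb.
Qed.

Definition conn x y := connected_component (~` bd) x y.

Lemma segment_is_connected x y : connected (segment x y).
Proof.
apply: connected_continuous_connected; first exact: segment_connected.
apply: continuous_subspaceT => t.
have c1 (u v : R) : (u + r * v) @[r --> t] --> u + t * v.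
  by apply: cvgD; [exact: cvg_cst|apply: cvgM; [exact: cvg_id|exact: cvg_cst]].
exact: (cvg_pair (c1 x.1 (y.1 - x.1)) (c1 x.2 (y.2 - x.2))).
Qed.

Lemma conn_segment x y : (forall z, segment x y z -> ~ bd z) -> conn x y.
Proof.
move=> h; have hx : segment x y x.
  by exists 0; rewrite /= ?in_itv /= ?lexx ?ler01 // !mul0r !addr0; case: (x).
apply: (connected_component_max hx _ (@segment_is_connected x y)).
  by move=> z /h.
by exists 1; rewrite /= ?in_itv /= ?lexx ?ler01 // !mul1r !subrKC; case: (y).
Qed.

Lemma conn_sym x y : conn x y -> conn y x.
Proof. exact: connected_component_sym. Qed.

Lemma conn_trans x y z : conn x y -> conn y z -> conn x z.
Proof. exact: connected_component_trans. Qed.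

Lemma conn_off x y : conn x y -> ~ bd x /\ ~ bd y.
Proof.
by move=> h; split; [move: (conn_sym h) => h'; exact: (connected_component_sub h')|exact: (connected_component_sub h)].
Qed.

(** [par] is locally constant off the boundary, so its level set in the component is open and
    closed. *)
Lemma par_conn x y : conn x y -> par x = par y.
Proof.
move=> hxy; have hc := @component_connected _ (~` bd) x.
have op b : open [set z | ~ bd z /\ par z = b].
  rewrite openE => z [hz hb]; apply: filterS2 (near_off_boundary hz) (par_near hz).
  by move=> w h1 h2; split=> //; rewrite h2.
set C := connected_component _ _ in hc.
have hx : C x by apply: connected_component_refl; have [] := conn_off hxy.
have CE : C `&` [set z | ~ bd z /\ par z = par x] = C.
  apply: hc.
  - by exists x; split=> //; split=> //; have [] := conn_off hxy.
  - by exists [set z | ~ bd z /\ par z = par x].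
  - exists (~` [set z | ~ bd z /\ par z = ~~ par x]); first exact: open_closedC.
    apply/seteqP; split=> z /= [hz].
      by move=> [_ e]; split=> // -[_]; rewrite e; case: par.
    move=> hn; split=> //; have hz' : ~ bd z by exact: (connected_component_sub hz).
    by split=> //; apply/eqP; apply: contra_notT hn => hne; split=> //; case: par hne; case: par.
have : C y by [].
by rewrite -CE => -[_ [_ ->]].
Qed.

Definition vbound : R := \sum_(i < m) (`|(P`_i).1| + `|(P`_i).2|) + 1.

Lemma vboundP i : (i < m)%N -> `|(P`_i).1| < vbound /\ `|(P`_i).2| < vbound.
Proof.
move=> hi; rewrite /vbound (bigD1 (Ordinal hi)) //=.
set s := \sum_(_ | _) _.
have s0 : 0 <= s by apply: sumr_ge0 => k _; rewrite addr_ge0.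
by split; have := normr_ge0 (P`_i).1; have := normr_ge0 (P`_i).2; lra.
Qed.

Lemma nx_lt i : (nx i < m)%N. Proof. by rewrite ltn_mod; lia. Qed.

Lemma vbound_lt i : (i < m)%N ->
  [/\ - vbound < (P`_i).1, (P`_i).1 < vbound, - vbound < (P`_i).2 & (P`_i).2 < vbound].
Proof. by move=> /vboundP[]; rewrite !ltr_norml => /andP[? ?] /andP[? ?]. Qed.

Lemma par_far x : vbound <= `|x.1| \/ vbound <= `|x.2| -> par x = false.
Proof.
have span i : (i < m)%N -> ray_edge P`_i P`_(nx i) x -> - vbound < x.2 /\ x.2 < vbound.
  move=> hi; have [_ _ h1 h2] := vbound_lt hi; have [_ _ h3 h4] := vbound_lt (nx_lt i).
  by rewrite /ray_edge; lra.
move=> hx.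
have [hx2|hx2] := leP vbound `|x.2|.
  rewrite /par big1 // => i _; apply/negbTE/negP => /(span _ (ltn_ord i)) [h1 h2].
  by move: hx2; rewrite leNgt ltr_norml h1 h2.
have {hx} hx1 : vbound <= `|x.1| by case: hx => //; lra.
have [x0|x0] := leP 0 x.1.
  rewrite ger0_norm // in hx1.
  rewrite /par big1 // => i _; apply/negbTE/negP.
  have [h1 h1' h2 h2'] := vbound_lt (ltn_ord i); have [h3 h3' h4 h4'] := vbound_lt (nx_lt i).
  move: h1 h1' h2 h2' h3 h3' h4 h4'; rewrite /ray_edge /crossp.
  move: P`_i P`_(nx i) => [p1 p2] [q1 q2] /= *; nra.
rewrite ltr0_norm // in hx1.
(* Far to the left, the ray crosses exactly the edges whose ends lie on different sides of its
   level, and a closed walk around the polygon passes the level an even number of times. *)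
have -> : par x = \big[addb/false]_(i < m) (((P`_i).2 <= x.2) (+) ((P`_(nx i)).2 <= x.2)).
  apply: eq_bigr => i _.
  have [h1 h1' h2 h2'] := vbound_lt (ltn_ord i); have [h3 h3' h4 h4'] := vbound_lt (nx_lt i).
  move: h1 h1' h2 h2' h3 h3' h4 h4'; rewrite /ray_edge /crossp.
  move: P`_i P`_(nx i) => [p1 p2] [q1 q2] /= h1 h1' _ _ h3 h3' _ _.
  rewrite (ltNge x.2 q2) (ltNge x.2 p2).
  case: (leP p2 x.2) => h5; case: (leP q2 x.2) => h6 //=; rewrite ?orbF.
    by apply: (introT idP); nra.
  by apply: (introT idP); nra.
rewrite big_split /=.
have -> : \big[addb/false]_(i < m) ((P`_(nx i)).2 <= x.2) =
          \big[addb/false]_(i < m) ((P`_i).2 <= x.2).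
  have mE : m = m.-1.+1 by rewrite prednK //; lia.
  by rewrite [RHS](reindex_inj (@ordS_inj m)) /=.
by rewrite addbb.
Qed.

(** The component of an odd point cannot reach the zone beyond [vbound], where all points are
    even. *)
Lemma odd_bounded x : ~ bd x -> par x -> bounded_set (connected_component (~` bd) x).
Proof.
move=> hx px; exists vbound; split; first exact: num_real.
move=> B hB y hy; rewrite /= prod_normE /= ge_max; apply/andP.
have : par y by rewrite -(par_conn hy).
have [h1|h1] := leP vbound `|y.1|; first by rewrite par_far //; left.
have [h2|h2] := leP vbound `|y.2|; first by rewrite par_far //; right.
by move=> _; split; lra.
Qed.

End Parity.

(** * The two sides of an edge *)

Section Sides.
Variables (R : realType) (P : seq (R * R)).
Hypothesis sP : simple_polygon P.
Implicit Types (x y z w : R * R).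

Local Notation m := (size P).
Local Notation nx i := (i.+1 %% m)%N.
Local Notation bd := (boundary P).
Local Notation conn := (conn P).

Let m3 : (3 <= m)%N. Proof. by case: sP. Qed.

Lemma common_lt (u v : R) : 0 < u -> 0 < v -> exists h, 0 < h /\ h < u /\ h < v.
Proof.
by move=> u0 v0; exists (Num.min u v / 2); rewrite /Num.min; case: ifP => ?; do !split; lra.
Qed.

Definition box p (e : R) y := (`|y.1 - p.1| < e) && (`|y.2 - p.2| < e).

Lemma near_box p (Q : R * R -> Prop) : (\forall y \near p, Q y) ->
  exists2 e, 0 < e & forall y, box p e y -> Q y.
Proof.
move=> /nbhs_ballP[e /= e0 h]; exists e => // y /andP[h1 h2]; apply: h.
by split; rewrite /ball /= distrC.
Qed.

Lemma box_segment p e y z w : segment y z w -> box p e y -> box p e z -> box p e w.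
Proof.
move=> [t]; rewrite /= in_itv /= => /andP[t0 t1] <-; rewrite /box /=.
have cv (q u v : R) : `|u - q| < e -> `|v - q| < e -> `|u + t * (v - u) - q| < e.
  move=> hu hv; rewrite (_ : _ - q = (1 - t) * (u - q) + t * (v - q)); last by ring.
  apply: le_lt_trans (ler_normD _ _) _; rewrite !normrM (ger0_norm t0) ger0_norm ?subr_ge0 //.
  have [-> //|tn] := eqVneq t 0; first by rewrite subr0 mul1r mul0r addr0.
  have tp : 0 < t by rewrite lt_neqAle eq_sym tn.
  have : t * `|v - q| < t * e by rewrite ltr_pM2l.
  have : (1 - t) * `|u - q| <= (1 - t) * e by rewrite ler_wpM2l ?subr_ge0 // ltW.
  by lra.
by move=> /andP[a1 a2] /andP[b1 b2]; apply/andP; split; apply: cv.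
Qed.

Lemma crossp_segment p q y z w : segment y z w ->
  exists2 t, 0 <= t <= 1 & crossp p q w = (1 - t) * crossp p q y + t * crossp p q z.
Proof.
move=> [t]; rewrite /= in_itv /= => ht <-; exists t => //.
by rewrite /crossp /=; ring.
Qed.

Definition side (tau : R) i y := 0 < tau * crossp P`_i P`_(nx i) y.

Lemma side_segment tau i y z w : segment y z w -> side tau i y -> side tau i z -> side tau i w.
Proof.
move=> /(crossp_segment P`_i P`_(nx i)) [t /andP[t0 t1]]; rewrite /side => ->.
set A := crossp _ _ y; set B := crossp _ _ z => hA hB.
have -> : tau * ((1 - t) * A + t * B) = (1 - t) * (tau * A) + t * (tau * B) by ring.
have [->|tn] := eqVneq t 0; first by lra.
have tp : 0 < t by rewrite lt_neqAle eq_sym tn.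
have : 0 < t * (tau * B) by rewrite mulr_gt0.
have : 0 <= (1 - t) * (tau * A) by apply: mulr_ge0; lra.
by lra.
Qed.

(** The second premise says that [A] is convex. So is the box, hence the straight segment joins the
    two points off the boundary. *)
Lemma conn_box p e (A : R * R -> Prop) y z :
  (forall w, box p e w -> A w -> ~ bd w) ->
  (forall u v w, segment u v w -> A u -> A v -> A w) ->
  box p e y -> box p e z -> A y -> A z -> conn y z.
Proof.
move=> hA cA by_ bz Ay Az; apply: conn_segment => w hw; apply: hA.
  exact: box_segment hw by_ bz.
exact: cA hw Ay Az.
Qed.

Definition dx i := (P`_(nx i)).1 - (P`_i).1.
Definition dy i := (P`_(nx i)).2 - (P`_i).2.

(* The point at distance proportional to [h] from the point of parameter [s] of
   the edge [i], to its left if [tau = 1] and to its right if [tau = -1]. *)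
Definition off (tau : R) i s h : R * R :=
  ((P`_i).1 + s * dx i - tau * h * dy i, (P`_i).2 + s * dy i + tau * h * dx i).

Definition onp i s : R * R := ((P`_i).1 + s * dx i, (P`_i).2 + s * dy i).

Lemma nx_neq i : (i < m)%N -> nx i != i.
Proof.
move=> hi; apply/eqP => h; have [hm|hm] := ltnP i.+1 m.
  by move: h; rewrite modn_small //; lia.
have e : i.+1 = m by lia.
by move: h; rewrite e modnn; lia.
Qed.

Lemma d_neq0 i : (i < m)%N -> 0 < dx i ^+ 2 + dy i ^+ 2.
Proof.
move=> hi; have [_ hu _ _] := sP.
have hne : P`_(nx i) != P`_i by rewrite nth_uniq ?nx_lt // nx_neq.
rewrite lt_neqAle addr_ge0 ?sqr_ge0 // andbT eq_sym paddr_eq0 ?sqr_ge0 // !sqrf_eq0.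
apply: contra hne => /andP[]; rewrite !subr_eq0 => /eqP h1 /eqP h2.
by apply/eqP; case: (P`_(nx i)) h1 h2 => ? ? /= -> ->; case: (P`_i).
Qed.

Lemma edge_onp i y : edge P i y <-> exists2 s, 0 <= s <= 1 & y = onp i s.
Proof.
split.
  by move=> [s]; rewrite /= in_itv /= => h <-; exists s.
by move=> [s h ->]; exists s; rewrite /= ?in_itv.
Qed.

Lemma onp_inj i s s' : (i < m)%N -> onp i s = onp i s' -> s = s'.
Proof.
move=> hi [h1 h2]; have h := d_neq0 hi.
have e1 : (s - s') * dx i = 0 by lra.
have e2 : (s - s') * dy i = 0 by lra.
apply/eqP; rewrite -subr_eq0; apply/negPn/negP => hn.
move/eqP: e1; move/eqP: e2; rewrite !mulf_eq0 (negbTE hn) /= => /eqP e2 /eqP e1.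
by move: h; rewrite e1 e2 expr0n /= addr0 ltxx.
Qed.

Lemma onp0 i : onp i 0 = P`_i.
Proof. by rewrite /onp !mul0r !addr0; case: (P`_i). Qed.

Lemma onp1 i : onp i 1 = P`_(nx i).
Proof. by rewrite /onp /dx /dy !mul1r !subrKC; case: (P`_(nx i)). Qed.

Lemma onp_off_edge i j s : (i < m)%N -> (j < m)%N -> i != j -> 0 < s < 1 ->
  ~ edge P j (onp i s).
Proof.
move=> hi hj ij /andP[s0 s1] he.
have [_ _ hnext hdisj] := sP.
have hi' : edge P i (onp i s) by apply/edge_onp; exists s => //; rewrite !ltW.
have [e|n1] := eqVneq j (nx i).
  have : (edge P i `&` edge P (nx i)) (onp i s) by split=> //; rewrite -e.
  rewrite hnext // -onp1 => /(onp_inj hi) => es; lra.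
have [e|n2] := eqVneq i (nx j).
  have : (edge P j `&` edge P (nx j)) (onp i s) by split=> //; rewrite -e.
  by rewrite hnext // -e -onp0 => /(onp_inj hi) => es; lra.
have : (edge P i `&` edge P j) (onp i s) by [].
by rewrite hdisj.
Qed.

Lemma vertex_off_edge i j : (i < m)%N -> (j < m)%N -> j != i -> j != nx i ->
  ~ edge P j P`_(nx i).
Proof.
move=> hi hj ji jk he; have [_ hu hnext hdisj] := sP.
have hk : edge P (nx i) P`_(nx i) by apply/edge_onp; exists 0; rewrite ?onp0 ?lexx ?ler01.
have hi' : edge P i P`_(nx i) by apply/edge_onp; exists 1; rewrite ?onp1 ?lexx ?ler01.
have [e|n2] := eqVneq i (nx j); last first.
  have : (edge P i `&` edge P j) P`_(nx i) by [].
  by rewrite hdisj // eq_sym.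
have : (edge P j `&` edge P (nx j)) P`_(nx i) by split=> //; rewrite -e.
rewrite hnext // -e => /eqP; rewrite nth_uniq ?nx_lt //.
by rewrite (negbTE (nx_neq hi)).
Qed.

Lemma edge_local i s : (i < m)%N -> 0 < s < 1 -> exists2 e, 0 < e &
  forall y, box (onp i s) e y -> forall j, (j < m)%N -> j != i -> ~ edge P j y.
Proof.
move=> hi hs; apply: near_box.
have : \forall y \near onp i s, forall j : 'I_m, (j : nat) != i -> ~ edge P j y.
  apply: near_forall => j; have [->|ji] := eqVneq (j : nat) i; first by apply: filterE.
  apply: filterS (near_off_edge (onp_off_edge hi (ltn_ord j) _ hs)) => //.
  by rewrite eq_sym.
by apply: filterS => y h j hj; exact: (h (Ordinal hj)).
Qed.

Lemma vertex_local i : (i < m)%N -> exists2 e, 0 < e &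
  forall y, box P`_(nx i) e y -> forall j, (j < m)%N -> j != i -> j != nx i -> ~ edge P j y.
Proof.
move=> hi; apply: near_box.
have : \forall y \near P`_(nx i), forall j : 'I_m, (j : nat) != i -> (j : nat) != nx i -> ~ edge P j y.
  apply: near_forall => j; have [->|ji] := eqVneq (j : nat) i; first by apply: filterE.
  have [->|jk] := eqVneq (j : nat) (nx i); first by apply: filterE.
  by apply: filterS (near_off_edge (vertex_off_edge hi (ltn_ord j) ji jk)).
by apply: filterS => y h j hj; exact: (h (Ordinal hj)).
Qed.

Lemma crossp_off tau i s h :
  crossp P`_i P`_(nx i) (off tau i s h) = tau * h * (dx i ^+ 2 + dy i ^+ 2).
Proof. by rewrite /crossp /off /= -/(dx i) -/(dy i); ring. Qed.

Lemma crossp_on i y : edge P i y -> crossp P`_i P`_(nx i) y = 0.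
Proof.
by move=> /edge_onp[s _ ->]; rewrite /crossp /onp /= -/(dx i) -/(dy i); ring.
Qed.

Lemma side_box i s e tau y z : (i < m)%N ->
  (forall y, box (onp i s) e y -> forall j, (j < m)%N -> j != i -> ~ edge P j y) ->
  box (onp i s) e y -> box (onp i s) e z -> side tau i y -> side tau i z -> conn y z.
Proof.
move=> hi he b1 b2 s1 s2.
apply: (@conn_box (onp i s) e (side tau i) y z _ _ b1 b2 s1 s2); last exact: side_segment.
move=> w bw sw /boundaryP[j hj].
have [ji|ji] := eqVneq (j : nat) i; last exact: (he w bw j (ltn_ord j) ji).
by move: sw; rewrite /side -ji (crossp_on hj) mulr0 ltxx.
Qed.

Definition unit_sign (tau : R) := tau ^+ 2 = 1.

Lemma side_off tau i s h : (i < m)%N -> unit_sign tau -> 0 < h -> side tau i (off tau i s h).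
Proof.
move=> hi ht h0; rewrite /side crossp_off !mulrA -expr2 ht mul1r mulr_gt0 //.
exact: d_neq0.
Qed.

Lemma unit_sign_norm tau : unit_sign tau -> `|tau| = 1.
Proof. by move=> h; apply/eqP; rewrite -sqrp_eq1 // real_normK ?num_real // h. Qed.

(** The displacements along the edge and across it stay below [e / 2] in each coordinate, as [D]
    exceeds both [|dx i|] and [|dy i|]. *)
Lemma off_box tau i s s' h e : unit_sign tau -> 0 < h ->
  let D := `|dx i| + `|dy i| + 1 in
  `|s' - s| < e / (2 * D) -> h < e / (2 * D) -> box (onp i s) e (off tau i s' h).
Proof.
move=> /unit_sign_norm ht h0 D hs hh.
have D0 : 0 < D by rewrite /D; have := normr_ge0 (dx i); have := normr_ge0 (dy i); lra.
have D20 : 0 < 2 * D by lra.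
rewrite ltr_pdivlMr // in hs; rewrite ltr_pdivlMr // in hh.
have hxy (u v : R) : `|u| + `|v| <= D -> `|(s' - s) * u + tau * h * v| < e.
  move=> huv; apply: le_lt_trans (ler_normD _ _) _; rewrite !normrM ht mul1r (gtr0_norm h0).
  have := normr_ge0 u; have := normr_ge0 v; have := normr_ge0 (s' - s); nra.
rewrite /box /=; apply/andP; split.
  rewrite (_ : _ - _ = (s' - s) * dx i + tau * h * - dy i); last by ring.
  by apply: hxy; rewrite normrN /D; lra.
rewrite (_ : _ - _ = (s' - s) * dy i + tau * h * dx i); last by ring.
by apply: hxy; rewrite /D; lra.
Qed.

(** The component of [z] touches the edge [i] at the parameter [s] from the side [tau]. *)
Definition sees tau i s z := exists2 h0, 0 < h0 &
  forall h, 0 < h < h0 -> conn (off tau i s h) z.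

Lemma sees_local tau i s : (i < m)%N -> unit_sign tau -> 0 < s < 1 ->
  exists2 del, 0 < del & forall s', `|s' - s| < del -> forall z, sees tau i s z <-> sees tau i s' z.
Proof.
move=> hi ht hs; have [e e0 he] := edge_local hi hs.
set D := `|dx i| + `|dy i| + 1.
have D0 : 0 < D by rewrite /D; have := normr_ge0 (dx i); have := normr_ge0 (dy i); lra.
have del0 : 0 < e / (2 * D) by rewrite divr_gt0 // mulr_gt0.
exists (e / (2 * D)) => // s' hs' z.
have cc h h' : 0 < h < e / (2 * D) -> 0 < h' < e / (2 * D) -> conn (off tau i s h) (off tau i s' h').
  move=> /andP[h0 h1] /andP[k0 k1]; apply: (side_box (tau := tau) hi he).
  - by apply: off_box => //; rewrite subrr normr0.
  - exact: off_box.
  - exact: side_off.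
  - exact: side_off.
split=> -[h0 hh0 hc]; have [h1 [h10 [h11 h12]]] := common_lt hh0 del0.
  exists (e / (2 * D)) => // h hh.
  by apply: conn_trans (hc h1 _); [apply: conn_sym; apply: cc => //|]; rewrite ?h10 ?h11 ?h12.
exists (e / (2 * D)) => // h hh.
by apply: conn_trans (hc h1 _); [apply: cc => //|]; rewrite ?h10 ?h11 ?h12.
Qed.

(** By [sees_local], the truth value is locally constant in the parameter, and the open unit
    interval is connected. *)
Lemma sees_const tau i s s' z : (i < m)%N -> unit_sign tau -> 0 < s < 1 -> 0 < s' < 1 ->
  sees tau i s z -> sees tau i s' z.
Proof.
move=> hi ht hs hs' hz.
have op (Q : Prop) : open [set r : R | 0 < r < 1 /\ (sees tau i r z <-> Q)].
  rewrite openE => r [/andP[r0 r1] hr].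
  have [del d0 hd] := sees_local hi ht (introT andP (conj r0 r1)).
  apply/nbhs_ballP; exists (Num.min del (Num.min r (1 - r))) => /=.
    by rewrite !lt_min d0 r0 subr_gt0.
  move=> u; rewrite /ball /= !lt_min => /and3P[u1 u2 u3].
  split; first by move: u2 u3; rewrite !ltr_norml; lra.
  by rewrite -(hd u) // distrC.
pose I01 := [set r : R | 0 < r < 1].
have cI : connected I01.
  apply/connected_intervalP => u v /= /andP[u0 u1] /andP[v0 v1] w /andP[w0 w1].
  by apply/andP; split; lra.
have : I01 `&` [set r | 0 < r < 1 /\ (sees tau i r z <-> True)] = I01.
  apply: cI.
  - by exists s; split=> //; split.
  - by exists [set r | 0 < r < 1 /\ (sees tau i r z <-> True)].
  - exists (~` [set r | 0 < r < 1 /\ (sees tau i r z <-> False)]); first exact: open_closedC.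
    apply/seteqP; split=> r /= [hr].
      by move=> [_ h]; split=> // -[_ h']; rewrite -h'; apply/h.
    move=> hn; split=> //; split=> //; split=> // _.
    by apply: contrapT => h; apply: hn; split=> //; split.
move=> h; have : I01 s' by [].
by rewrite -h => -[_ [_ h2]]; apply/h2.
Qed.

End Sides.

(** * Passing a vertex along one side *)

Section Corners.
Variables (R : realType) (P : seq (R * R)).
Hypothesis sP : simple_polygon P.
Implicit Types (x y z w : R * R).

Local Notation m := (size P).
Local Notation nx i := (i.+1 %% m)%N.
Local Notation bd := (boundary P).
Local Notation conn := (conn P).
Local Notation dx := (dx P).
Local Notation dy := (dy P).
Local Notation off := (off P).
Local Notation onp := (onp P).
Local Notation side := (side P).
Local Notation sees := (sees P).

Let m3 : (3 <= m)%N. Proof. by case: sP. Qed.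

Definition turn i := dx i * dy (nx i) - dy i * dx (nx i).
Definition dotn i := dx i * dx (nx i) + dy i * dy (nx i).

(** If the next edge ran backwards along the edge [i], the two would overlap beyond their common
    vertex, against simplicity. *)
Lemma no_fold i : (i < m)%N -> turn i = 0 -> 0 < dotn i.
Proof.
move=> hi ht; have hk := nx_lt sP i; rewrite ltNge; apply/negP => hd.
have [_ _ hnext _] := sP.
have di := d_neq0 sP hi; have dk := d_neq0 sP hk.
set N := dx i ^+ 2 + dy i ^+ 2 in di; set lam := dotn i / N.
have N0 : N != 0 by rewrite gt_eqF.
have e1 : dx (nx i) = lam * dx i.
  apply: (mulfI N0); rewrite [RHS]mulrA [N * lam]mulrC /lam divfK //.
  have -> : N * dx (nx i) = dotn i * dx i - dy i * turn i by rewrite /N /turn /dotn; ring.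
  by rewrite ht mulr0 subr0.
have e2 : dy (nx i) = lam * dy i.
  apply: (mulfI N0); rewrite [RHS]mulrA [N * lam]mulrC /lam divfK //.
  have -> : N * dy (nx i) = dotn i * dy i + dx i * turn i by rewrite /N /turn /dotn; ring.
  by rewrite ht mulr0 addr0.
have lam0 : lam < 0.
  rewrite lt_neqAle; apply/andP; split; last by rewrite /lam ler_pdivrMr // mul0r.
  apply/eqP => l0; move: dk; rewrite e1 e2 l0 !mul0r expr0n /= addr0 ltxx //.
have l1 : 0 < 1 - lam by lra.
(* With this value [1 + lam * b = b], so the common point has the parameter [b], between 0 and 1, on
   both edges. *)
pose b := (1 - lam)^-1.
have b0 : 0 < b by rewrite invr_gt0.
have bE : b * (1 - lam) = 1 by rewrite mulVf // gt_eqF.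
have eqp : onp (nx i) b = onp i (1 + lam * b).
  by rewrite /onp e1 e2; congr pair; rewrite /dx /dy; ring.
have : (edge P i `&` edge P (nx i)) (onp (nx i) b).
  split; apply/edge_onp; last by exists b => //; apply/andP; split; nra.
  by exists (1 + lam * b) => //; apply/andP; split; nra.
rewrite hnext // -(onp0 P (nx i)) => /(onp_inj sP hk) h; lra.
Qed.

Lemma turn_crossp i s : crossp P`_i P`_(nx i) (onp (nx i) s) = s * turn i.
Proof. by rewrite /crossp /onp /turn /dx /dy /=; ring. Qed.

Lemma turn_crossp' i s : crossp P`_(nx i) P`_(nx (nx i)) (onp i s) = (1 - s) * turn i.
Proof. by rewrite /crossp /onp /turn /dx /dy /=; ring. Qed.

Lemma turn_off i tau s h : unit_sign tau ->
  tau * crossp P`_i P`_(nx i) (off tau (nx i) s h) = s * (tau * turn i) + h * dotn i.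
Proof.
move=> ht; rewrite (_ : h * dotn i = tau ^+ 2 * (h * dotn i)); last by rewrite ht mul1r.
by rewrite /crossp /off /turn /dotn /dx /dy /=; ring.
Qed.

Lemma turn_off' i tau s h : unit_sign tau ->
  tau * crossp P`_(nx i) P`_(nx (nx i)) (off tau i s h) = (1 - s) * (tau * turn i) + h * dotn i.
Proof.
move=> ht; rewrite (_ : h * dotn i = tau ^+ 2 * (h * dotn i)); last by rewrite ht mul1r.
by rewrite /crossp /off /turn /dotn /dx /dy /=; ring.
Qed.

(* Near a vertex, the sector on the side [tau] of both edges is convex if the
   polygon turns towards [tau], and the union of two half planes otherwise. *)
Lemma corner tau i : (i < m)%N -> unit_sign tau ->
  exists2 del, 0 < del < 1 & exists2 h1, 0 < h1 & forall h h', 0 < h < h1 -> 0 < h' < h1 ->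
    conn (off tau i (1 - del) h) (off tau (nx i) del h').
Proof.
move=> hi ht; have hk := nx_lt sP i; have [e e0 he] := vertex_local sP hi.
have Dpos j : 0 < `|dx j| + `|dy j| + 1.
  by have := normr_ge0 (dx j); have := normr_ge0 (dy j); lra.
pose D j := `|dx j| + `|dy j| + 1.
have dD j : `|dx j| < D j /\ `|dy j| < D j.
  by rewrite /D; have := normr_ge0 (dx j); have := normr_ge0 (dy j); split; lra.
have eD j : 0 < e / (2 * D j) by rewrite divr_gt0 // mulr_gt0 // Dpos.
pose eta := Num.min 1 (Num.min (e / (2 * D i)) (e / (2 * D (nx i)))).
have [eta0 [eta1 [etai etak]]] : 0 < eta /\ eta <= 1 /\ eta <= e / (2 * D i) /\ eta <= e / (2 * D (nx i)).
  by rewrite /eta !lt_min ltr01 !eD !ge_min !lexx !orbT.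
pose del := eta / 2.
have del0 : 0 < del by rewrite /del; lra.
have dele : del < eta by rewrite /del; lra.
exists del; first by lra.
have b1 h : 0 < h < eta -> box P`_(nx i) e (off tau i (1 - del) h).
  move=> /andP[h0 h1]; rewrite -onp1; apply: off_box => //; last exact: lt_le_trans etai.
  rewrite (_ : 1 - del - 1 = - del); last by ring.
  by rewrite normrN gtr0_norm //; apply: lt_le_trans etai.
have b2 h : 0 < h < eta -> box P`_(nx i) e (off tau (nx i) del h).
  move=> /andP[h0 h1]; rewrite -onp0; apply: off_box => //; last exact: lt_le_trans etak.
  by rewrite subr0 gtr0_norm //; apply: lt_le_trans etak.
have offb (A : R * R -> Prop) :
    (forall w, edge P i w -> ~ A w) -> (forall w, edge P (nx i) w -> ~ A w) ->
    forall w, box P`_(nx i) e w -> A w -> ~ bd w.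
  move=> A1 A2 w bw Aw /boundaryP[j hj].
  have [ji|ji] := eqVneq (j : nat) i; first by apply: (A1 w) => //; rewrite -ji.
  have [jk|jk] := eqVneq (j : nat) (nx i); first by apply: (A2 w) => //; rewrite -jk.
  exact: (he w bw j).
have sidei w : edge P i w -> ~ side tau i w.
  by move=> hw; rewrite /side (crossp_on hw) mulr0 ltxx.
have sidek w : edge P (nx i) w -> ~ side tau (nx i) w.
  by move=> hw; rewrite /side (crossp_on hw) mulr0 ltxx.
have sidei' w : tau * turn i <= 0 -> edge P (nx i) w -> ~ side tau i w.
  move=> ht0 /edge_onp[s /andP[s0 s1] ->]; rewrite /side turn_crossp mulrCA.
  by apply/negP; rewrite -leNgt mulr_ge0_le0.
have sidek' w : tau * turn i <= 0 -> edge P i w -> ~ side tau (nx i) w.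
  move=> ht0 /edge_onp[s /andP[s0 s1] ->]; rewrite /side turn_crossp' mulrCA.
  by apply/negP; rewrite -leNgt mulr_ge0_le0 // subr_ge0.
have cs j u v w : segment u v w -> side tau j u -> side tau j v -> side tau j w.
  exact: side_segment.
have s1 h : 0 < h -> side tau i (off tau i (1 - del) h) by move=> ?; exact: side_off.
have s2 h : 0 < h -> side tau (nx i) (off tau (nx i) del h) by move=> ?; exact: side_off.
case: (ltgtP (tau * turn i) 0) => htn.
- exists eta => // h h' hh hh'.
  (* A point in both half planes, through which the path turns around the vertex: seen from either
     edge its orientation is [- (del / 2) * turn i]. *)
  pose w : R * R := ((P`_(nx i)).1 + del / 2 * (dx i - dx (nx i)), (P`_(nx i)).2 + del / 2 * (dy i - dy (nx i))).
  have bw : box P`_(nx i) e w.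
    have hxy (u v : R) : `|u| < D i -> `|v| < D (nx i) -> `|del / 2 * (u - v)| < e.
      move=> hu hv; rewrite normrM gtr0_norm; last by lra.
      have huv : `|u - v| < D i + D (nx i).
        by apply: le_lt_trans (ler_normB _ _) _; lra.
      move: etai etak; rewrite !ler_pdivlMr ?mulr_gt0 ?Dpos // => k1 k2.
      have : del / 2 * `|u - v| < del / 2 * (D i + D (nx i)) by rewrite ltr_pM2l //; lra.
      have : del / 2 * (D i + D (nx i)) <= e.
        by rewrite /del; lra.
      by lra.
    have [d1 d2] := dD i; have [d3 d4] := dD (nx i).
    by rewrite /box /w /=; apply/andP; split; rewrite addrAC subrr add0r; apply: hxy.
  have sw1 : side tau i w.
    rewrite /side (_ : tau * _ = del / 2 * - (tau * turn i)); first by rewrite mulr_gt0 ?oppr_gt0 //; lra.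
    by rewrite /crossp /w /turn /dx /dy /=; ring.
  have sw2 : side tau (nx i) w.
    rewrite /side (_ : tau * _ = del / 2 * - (tau * turn i)); first by rewrite mulr_gt0 ?oppr_gt0 //; lra.
    by rewrite /crossp /w /turn /dx /dy /=; ring.
  have [h0 _] := andP hh; have [h0' _] := andP hh'.
  apply: (@conn_trans _ _ _ w).
    apply: (@conn_box _ P P`_(nx i) e (side tau i)); rewrite ?b1 ?s1 //; last exact: cs.
    by apply: offb => // w' h1; apply: sidei' => //; exact: ltW.
  apply: (@conn_box _ P P`_(nx i) e (side tau (nx i))); rewrite ?b2 ?s2 //; last exact: cs.
  by apply: offb => // w' h1; apply: sidek' => //; exact: ltW.
- have N0 : 0 < `|dotn i| + 1 by have := normr_ge0 (dotn i); lra.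
  (* So small that in [turn_off] and [turn_off'] the turn outweighs [h * dotn i]: each of the two
     points then also lies on the side [tau] of the other edge. *)
  pose h1 := Num.min eta (del * (tau * turn i) / (`|dotn i| + 1)).
  exists h1; first by rewrite /h1 lt_min eta0 divr_gt0 // mulr_gt0.
  have key h : 0 < h < h1 -> 0 < del * (tau * turn i) + h * dotn i /\ 0 < h < eta.
    rewrite /h1 lt_min => /and3P[h0 -> ]; rewrite ltr_pdivlMr // h0 => hb; split=> //.
    have : - (h * `|dotn i|) <= h * dotn i by rewrite -mulrN ler_pM2l // lerNl; have := ler_norm (- dotn i); rewrite normrN.
    by lra.
  move=> h h' /key[k1 /[dup] hh /andP[h0 _]] /key[k1' /[dup] hh' /andP[h0' _]].
  apply: (@conn_box _ P P`_(nx i) e (fun w => side tau i w /\ side tau (nx i) w)).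
  + apply: offb => w hw [] h3 h4; first exact: sidei h3.
    exact: sidek h4.
  + by move=> u v w hw [u1 u2] [v1 v2]; split; apply: cs hw _ _.
  + exact: b1.
  + exact: b2.
  + split; first exact: s1.
    by rewrite /side turn_off' // (_ : 1 - (1 - del) = del) //; ring.
  + split; last exact: s2.
    by rewrite /side turn_off.
- have tn0 : tau != 0 by apply/eqP => t0; move: ht; rewrite /unit_sign t0 expr0n /= => /esym/eqP; rewrite oner_eq0.
  have ti0 : turn i = 0 by move/eqP: htn; rewrite mulf_eq0 (negbTE tn0) => /eqP.
  have hd := no_fold hi ti0.
  exists eta => // h h' hh hh'; have [h0 _] := andP hh; have [h0' _] := andP hh'.
  (* The two edges form a straight line without folding, so one half plane contains both points. *)
  apply: (@conn_box _ P P`_(nx i) e (side tau i)); rewrite ?b1 ?b2 ?s1 //.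
  + by apply: offb => // w' h1; apply: sidei' => //; rewrite htn.
  + exact: cs.
  + by rewrite /side turn_off // htn mulr0 add0r mulr_gt0.
Qed.

Lemma sees_next tau i z : (i < m)%N -> unit_sign tau ->
  (forall s, 0 < s < 1 -> sees tau i s z) -> forall s, 0 < s < 1 -> sees tau (nx i) s z.
Proof.
move=> hi ht hs s hs'; have [del hd [h1 h10 hc]] := corner hi ht.
apply: (sees_const sP (s := del)) => //; first exact: nx_lt.
have hd' : 0 < 1 - del < 1 by lra.
have [h0 h00 hz] := hs _ hd'.
exists h1 => // h hh.
have [h2 [k1 [k2 k3]]] := common_lt h00 h10.
apply: conn_trans (hz h2 _); last by rewrite k1 k2.
by apply: conn_sym; apply: hc => //; rewrite k1 k3.
Qed.

(** The walk along one side of the polygon: iterating the successor leads from any edge to any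
    other. *)
Lemma sees_all tau i j z : (i < m)%N -> (j < m)%N -> unit_sign tau ->
  (exists2 s, 0 < s < 1 & sees tau i s z) -> forall s, 0 < s < 1 -> sees tau j s z.
Proof.
move=> hi hj ht [s0 hs0 hz].
have base s : 0 < s < 1 -> sees tau i s z by move=> hs; exact: (sees_const sP (s := s0)).
suff H k : forall s, 0 < s < 1 -> sees tau ((i + k) %% m)%N s z.
  have -> : j = ((i + (m - i + j)) %% m)%N.
    by rewrite addnA subnKC 1?ltnW // modnDl modn_small.
  exact: H.
elim: k => [|k IH] => [|s hs]; first by rewrite addn0 modn_small.
have -> : ((i + k.+1) %% m = nx ((i + k) %% m))%N by rewrite addnS -addn1 -[in RHS]addn1 modnDml.
by apply: sees_next hs => //; rewrite ltn_mod; lia.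
Qed.

End Corners.

(** * Components of even points *)

Section Level.
Variables (R : realType) (P : seq (R * R)).
Hypothesis sP : simple_polygon P.
Implicit Types (x y z w : R * R).

Local Notation m := (size P).
Local Notation nx i := (i.+1 %% m)%N.
Local Notation bd := (boundary P).
Local Notation conn := (conn P).
Local Notation dx := (dx P).
Local Notation dy := (dy P).
Local Notation off := (off P).
Local Notation onp := (onp P).
Local Notation side := (side P).
Local Notation sees := (sees P).
Local Notation par := (par P).

Let m3 : (3 <= m)%N. Proof. by case: sP. Qed.

Lemma sees_near tau i s : (i < m)%N -> unit_sign tau -> 0 < s < 1 ->
  exists2 e, 0 < e & forall y, box (onp i s) e y -> side tau i y -> sees tau i s y.
Proof.
move=> hi ht hs; have [e e0 he] := edge_local sP hi hs; exists e => // y by_ sy.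
have D0 : 0 < `|dx i| + `|dy i| + 1 by have := normr_ge0 (dx i); have := normr_ge0 (dy i); lra.
exists (e / (2 * (`|dx i| + `|dy i| + 1))); first by rewrite divr_gt0 // mulr_gt0.
move=> h /andP[h0 h1]; apply: (side_box (tau := tau) hi he) => //; last exact: side_off.
by apply: off_box => //; rewrite subrr normr0 divr_gt0 // mulr_gt0.
Qed.

(** A level without vertices. On it an edge is met at one interior point or not at all, which
    removes the degenerate cases. *)
Definition generic (Y : R) := forall j, (j < m)%N -> (P`_j).2 != Y.

Lemma generic_near (Y e : R) : 0 < e -> exists2 r, 0 < r < e & generic (Y + r).
Proof.
move=> e0.
have : \forall r \near 0^'+, forall j : 'I_m, (P`_j).2 != Y + r.
  apply: (@filter_forall _ _ (fun (j : 'I_m) r => (P`_j).2 != Y + r)) => j.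
  have [h|h] := ltP Y (P`_j).2.
    have h' : 0 < (P`_j).2 - Y by rewrite subr_gt0.
    by apply: filterS (nbhs_right_lt h') => r hr; lra.
  by apply: filterS (nbhs_right_gt 0) => r hr; lra.
move=> h1.
have : \forall r \near 0^'+, [/\ 0 < r, r < e & forall j : 'I_m, (P`_j).2 != Y + r].
  by near=> r; split; near: r; [exact: nbhs_right_gt|exact: nbhs_right_lt|].
move=> /filter_ex[r [r0 r1 hr]].
exists r; first by apply/andP.
by move=> j hj; exact: (hr (Ordinal hj)).
Unshelve. all: by end_near. Qed.

Section OneLevel.
Variable Y : R.
Hypothesis gY : generic Y.

Lemma box_level c r e : 0 < r -> r <= e ->
  box (c, Y) e (c - r / 2, Y) /\ box (c, Y) e (c + r / 2, Y).
Proof.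
move=> r0 re; rewrite /box /= subrr normr0 !ltr_norml.
by split; apply/andP; split; lra.
Qed.

Definition spans i := ((P`_i).2 < Y < (P`_(nx i)).2) || ((P`_(nx i)).2 < Y < (P`_i).2).
Definition sl i := (Y - (P`_i).2) / dy i.
Definition cx i := (P`_i).1 + sl i * dx i.

Lemma spans_onp i : spans i -> [/\ 0 < sl i < 1, onp i (sl i) = (cx i, Y) & dy i != 0].
Proof.
rewrite /spans => hs.
have d0 : dy i != 0.
  by rewrite /dy; case/orP: hs => /andP[h1 h2]; [rewrite gt_eqF // subr_gt0|rewrite lt_eqF // subr_lt0]; exact: lt_trans h1 h2.
split=> //; last by rewrite /onp /cx /sl divfK // subrKC.
rewrite /sl; case/orP: hs => /andP[h1 h2].
  have dp : 0 < dy i by rewrite /dy; lra.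
  by rewrite ltr_pdivlMr // ltr_pdivrMr // mul0r mul1r /dy; apply/andP; split; lra.
have dp : dy i < 0 by rewrite /dy; lra.
by rewrite ltr_ndivlMr // ltr_ndivrMr // mul0r mul1r /dy; apply/andP; split; lra.
Qed.

Lemma crossp_level i u : spans i -> crossp P`_i P`_(nx i) (u, Y) = dy i * (cx i - u).
Proof.
move=> /spans_onp[_ _ d0]; have h : sl i * dy i = Y - (P`_i).2 by rewrite /sl divfK.
by rewrite /crossp /cx /= -h -/(dx i) -/(dy i); ring.
Qed.

Lemma ray_level i u : (i < m)%N -> ray_edge P`_i P`_(nx i) (u, Y) = spans i && (u < cx i).
Proof.
move=> hi; have g1 := gY hi; have g2 := gY (nx_lt sP i).
rewrite /ray_edge /= !(le_eqVlt _ Y) (negbTE g1) (negbTE g2) /=.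
have [hs|] := boolP (spans i); last by rewrite /spans negb_or => /andP[/negbTE-> /negbTE->].
rewrite (crossp_level u hs) /=; case/orP: (hs) => /andP[h1 h2].
  have dp : 0 < dy i by rewrite /dy; lra.
  by rewrite h1 h2 /= pmulr_rgt0 // subr_gt0 (_ : (_ < Y) = false) ?orbF //; apply/negbTE; lra.
have dp : dy i < 0 by rewrite /dy; lra.
rewrite h1 h2 /= nmulr_rlt0 // subr_gt0 (_ : ((P`_i).2 < Y) = false) ?orbF //.
by apply/negbTE; lra.
Qed.

Lemma edge_level i u : (i < m)%N -> edge P i (u, Y) -> spans i /\ u = cx i.
Proof.
move=> hi /edge_onp[s /andP[s0 s1] [hu hY]].
have g1 := gY hi; have g2 := gY (nx_lt sP i).
have d0 : dy i != 0.
  by apply: contra g1 => /eqP d0; rewrite hY d0 mulr0 addr0.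
have sE : s = sl i by rewrite /sl hY addrAC subrr add0r mulfK.
split; last by rewrite hu sE.
have hs : (P`_i).2 < Y < (P`_(nx i)).2 \/ (P`_(nx i)).2 < Y < (P`_i).2.
  case: (ltgtP (dy i) 0) d0 => // hd _; [right|left]; apply/andP; split.
  - by rewrite lt_neqAle g2 /=; move: hd hY; rewrite /dy; nra.
  - by rewrite lt_neqAle eq_sym g1 /=; nra.
  - by rewrite lt_neqAle g1 /=; nra.
  - by rewrite lt_neqAle eq_sym g2 /=; move: hd hY; rewrite /dy; nra.
by rewrite /spans; apply/orP.
Qed.

Lemma par_level u : par (u, Y) = \big[addb/false]_(i < m) (spans i && (u < cx i)).
Proof. by apply: eq_bigr => i _; rewrite ray_level. Qed.

Lemma off_level u : (forall i, (i < m)%N -> spans i -> u != cx i) -> ~ bd (u, Y).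
Proof.
by move=> h /boundaryP[i] /(edge_level (ltn_ord i))[h1 h2]; move: (h i (ltn_ord i) h1); rewrite h2 eqxx.
Qed.

Lemma conn_level u v : u <= v -> (forall i, (i < m)%N -> spans i -> ~~ (u <= cx i <= v)) ->
  conn (u, Y) (v, Y).
Proof.
move=> uv h; apply: conn_segment => w [t]; rewrite /= in_itv /= => /andP[t0 t1] <-.
rewrite subrr mulr0 addr0; apply: off_level => i hi /(h i hi).
by apply: contra => /eqP <-; apply/andP; split; nra.
Qed.

(** Near the crossing no other edge meets the level, so exactly one term of the parity changes. *)
Lemma cross_parity i e : (i < m)%N -> spans i -> 0 < e ->
  (forall y, box (onp i (sl i)) e y -> forall j, (j < m)%N -> j != i -> ~ edge P j y) ->
  par (cx i - e / 2, Y) = ~~ par (cx i + e / 2, Y).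
Proof.
move=> hi hs e0 he; rewrite !par_level (bigD1 (Ordinal hi)) //= [in RHS](bigD1 (Ordinal hi)) //=.
rewrite hs /= (_ : (_ - _ < _) = true) /=; last by apply/idP; lra.
rewrite (_ : (_ + _ < _) = false) /=; last by apply/negbTE; lra.
congr negb; apply: eq_bigr => j ji; have [hj|//] := boolP (spans j).
apply/idP/idP => /= h; last by lra.
rewrite ltNge; apply/negP => h2; have [hsj hoj _] := spans_onp hj; have [_ ho _] := spans_onp hs.
apply: (he (cx j, Y) _ j (ltn_ord j)); last first.
- by rewrite -hoj; apply/edge_onp; exists (sl j) => //; lra.
- by apply: contra ji => /eqP h3; apply/eqP/val_inj.
by rewrite /box ho /= subrr normr0 e0 andbT ltr_norml; lra.
Qed.

(** The side of the edge that faces left along the level: the left side of an upward edge, the right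
    side of a downward one. *)
Definition sgd i : R := Num.sg (dy i).

Lemma sgd_unit i : spans i -> unit_sign (sgd i).
Proof. by move=> /spans_onp[_ _ d0]; rewrite /unit_sign /sgd sqr_sg d0. Qed.

Lemma side_left i u : spans i -> u < cx i -> side (sgd i) i (u, Y).
Proof.
move=> hs hu; rewrite /side crossp_level // mulrA mulr_gt0 ?subr_gt0 //.
by rewrite /sgd -normrEsg normr_gt0; case: (spans_onp hs).
Qed.

Lemma side_right i u : spans i -> cx i < u -> side (- sgd i) i (u, Y).
Proof.
move=> hs hu; rewrite /side crossp_level // mulrA mulNr mulNr -mulrN opprB mulr_gt0 ?subr_gt0 //.
by rewrite /sgd -normrEsg normr_gt0; case: (spans_onp hs).
Qed.

(** The level is free between [u] and the crossing, and a point just before the crossing is close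
    enough to the edge for [sees_near]. *)
Lemma first_hit u i : (i < m)%N -> spans i -> u < cx i ->
  (forall j, (j < m)%N -> spans j -> u <= cx j -> cx i <= cx j) -> sees (sgd i) i (sl i) (u, Y).
Proof.
move=> hi hs hu hmin; have [hsl ho _] := spans_onp hs.
have [e e0 he] := sees_near hi (sgd_unit hs) hsl.
have [v [uv [vc ev]]] : exists v, u < v /\ v < cx i /\ cx i - v < e.
  by exists (Num.max ((u + cx i) / 2) (cx i - e / 2)); rewrite /Num.max; case: ifP => ?; do !split; lra.
have [h0 h00 hz] : sees (sgd i) i (sl i) (v, Y).
  apply: he; last exact: side_left.
  by rewrite ho /box /= subrr normr0 e0 andbT ltr_norml; lra.
exists h0 => // h /hz hh; apply: conn_trans hh _; apply: conn_sym; apply: conn_level.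
  exact: ltW.
move=> j hj hsj; apply/negP => /andP[c1 c2].
by have := hmin j hj hsj c1; lra.
Qed.

Lemma even_level_far u N : ~ bd (u, Y) -> ~~ par (u, Y) -> exists2 v, conn (u, Y) (v, Y) & N < `|v|.
Proof.
move=> hbd hp.
have nb i : (i < m)%N -> spans i -> u != cx i.
  move=> hi hs; apply/eqP => hu; apply: hbd; apply/boundaryP; exists (Ordinal hi).
  have [hsl ho _] := spans_onp hs; rewrite hu -ho; apply/edge_onp; exists (sl i) => //; lra.
(* Without a crossing to the right of [u], the level itself leads arbitrarily far. *)
have [hno|/existsNP[i1 hy]] := pselect (forall i : 'I_m, ~ (spans i && (u < cx i))).
  have a1 := ler_norm u; have a2 := normr_ge0 u; have a3 := ler_norm N; have a4 := normr_ge0 N.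
  exists (`|N| + `|u| + 1); last by rewrite ger0_norm; lra.
  apply: conn_level; first by lra.
  move=> i hi hs; apply/negP => /andP[c1 _]; apply: (hno (Ordinal hi)).
  by rewrite /= hs lt_neqAle c1 nb.
have {}hy : spans i1 && (u < cx i1) by apply: contrapT.
(* [i] is the first crossing to the right of [u], [i0] the leftmost crossing of the whole level. *)
case: (@arg_minP _ _ _ i1 (fun i : 'I_m => spans i && (u < cx i)) (fun i : 'I_m => cx i) hy) => i /andP[hs hu] hmin.
case: (@arg_minP _ _ _ i (fun i : 'I_m => spans i) (fun i : 'I_m => cx i) hs) => i0 hs0 hmin0.
have [hsl _ _] := spans_onp hs; have [hsl0 ho0 _] := spans_onp hs0.
have sy : sees (sgd i) i (sl i) (u, Y).
  apply: first_hit => // j hj hsj c1; apply: (hmin (Ordinal hj)).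
  by rewrite /= hsj lt_neqAle c1 nb.
(* Far enough to the left to exceed [N], to precede every crossing and to be even by [par_far]. *)
pose z := - (`|cx i0| + `|N| + `|vbound P| + 1).
have zc : z < cx i0.
  have := normr_ge0 N; have := normr_ge0 (vbound P); have := ler_norm (- cx i0); rewrite normrN /z; lra.
have zN : Num.max N (vbound P) < `|z|.
  rewrite /z normrN ger0_norm; last first.
    by have := normr_ge0 N; have := normr_ge0 (cx i0); have := normr_ge0 (vbound P); lra.
  have := normr_ge0 N; have := normr_ge0 (cx i0); have := normr_ge0 (vbound P).
  have := ler_norm N; have := ler_norm (vbound P); rewrite gt_max => *; apply/andP; split; lra.
move: zN; rewrite gt_max => /andP[zN zB].
have sz : sees (sgd i0) i0 (sl i0) (z, Y).
  by apply: first_hit => // j hj hsj c1; exact: (hmin0 (Ordinal hj)).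
have pz : par (z, Y) = false by apply: par_far => //; left; exact: ltW.
have u0 := sgd_unit hs0; have u1 := sgd_unit hs.
have meet tau j s y w : sees tau j s y -> sees tau j s w -> conn y w.
  move=> [h1 h10 hy1] [h2 h20 hw1].
  have [h3 [k1 [k2 k3]]] := common_lt h10 h20.
  apply: conn_trans (conn_sym (hy1 h3 _)) (hw1 h3 _); apply/andP; split=> //.
exists z => //.
have [e|ne] := eqVneq (sgd i) (sgd i0).
  apply: meet sy _.
  by apply: (sees_all sP (ltn_ord i0) (ltn_ord i)) => //; exists (sl i0); rewrite ?e.
have {ne} e : sgd i = - sgd i0.
  apply/eqP; move/eqP: u1; rewrite -[X in _ == X]u0 eqf_sqr (negbTE ne) //.
(* Both neighbours of the crossing of [i0] inherit even parity, one from [z] and the other from [u],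
   against [cross_parity]. *)
exfalso; move: hp; rewrite -[par _]negbK negbK => hp.
have sy0 : sees (- sgd i0) i0 (sl i0) (u, Y).
  have := sees_all sP (ltn_ord i) (ltn_ord i0) u1 (z := (u, Y)).
  by rewrite e; apply=> //; exists (sl i) => //; rewrite -e.
have [e1 e10 he1] := edge_local sP (ltn_ord i0) hsl0.
have [e2 e20 he2] := sees_near (ltn_ord i0) u0 hsl0.
have u0' : unit_sign (- sgd i0) by rewrite /unit_sign sqrrN.
have [e3 e30 he3] := sees_near (ltn_ord i0) u0' hsl0.
have [r [r0 [r1 [r2 r3]]]] : exists r, 0 < r /\ r <= e1 /\ r <= e2 /\ r <= e3.
  by exists (Num.min e1 (Num.min e2 e3)); rewrite !lt_min !ge_min !lexx !orbT e10 e20 e30.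
have bx y : box (onp i0 (sl i0)) r y -> box (onp i0 (sl i0)) e1 y.
  by rewrite /box => /andP[b1 b2]; rewrite !(lt_le_trans _ r1).
have := cross_parity (ltn_ord i0) hs0 r0 (fun y hy => he1 y (bx y hy)).
have p1 : par (cx i0 - r / 2, Y) = false.
  rewrite -pz; apply: par_conn => //; apply: (meet (sgd i0) i0 (sl i0)) => //.
  apply: he2; last by apply: side_left => //; lra.
  by rewrite ho0; exact: (proj1 (box_level _ r0 r2)).
have p2 : par (cx i0 + r / 2, Y) = false.
  rewrite -(negbTE hp); apply: par_conn => //; apply: (meet (- sgd i0) i0 (sl i0)) => //.
  apply: he3; last by apply: side_right => //; lra.
  by rewrite ho0; exact: (proj2 (box_level _ r0 r3)).
by rewrite p1 p2.
Qed.

End OneLevel.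

(** A slight vertical move inside the component brings the point to a level without vertices. *)
Lemma even_unbounded x : ~ bd x -> ~~ par x -> ~ bounded_set (connected_component (~` bd) x).
Proof.
move=> hx hp [N [_ hN]].
have [e e0 he] := near_box (near_off_boundary hx).
have [r /andP[r0 re] gr] := generic_near x.2 e0.
have bx : box x e x by rewrite /box !subrr !normr0 e0.
have by_ : box x e (x.1, x.2 + r).
  by rewrite /box /= subrr normr0 e0 /= addrAC subrr add0r gtr0_norm.
have xy : conn x (x.1, x.2 + r).
  apply: (@conn_box _ P x e (fun=> True)) => //.
  by move=> w bw _; exact: he.
have [_ hy] := conn_off xy.
have hpy : ~~ par (x.1, x.2 + r) by rewrite -(par_conn sP xy).
have [v hv Nv] := even_level_far gr (`|N| + 1) hy hpy.
have hNN : N < `|N| + 1 by have := ler_norm N; lra.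
have := hN _ hNN _ (conn_trans xy hv).
by rewrite /= prod_normE /= ge_max => /andP[h1 _]; move: Nv; lra.
Qed.

Theorem regionP x : region P x <-> boundary P x \/ par x.
Proof.
split.
  move=> [|[h1 h2]]; first by left.
  by right; apply: contraT => /(even_unbounded h1).
move=> [|h]; first by left.
have [hb|hb] := pselect (bd x); first by left.
by right; split=> //; exact: odd_bounded.
Qed.

End Level.

(** * Optimality *)

Section Sliding.
Variables (R : realType) (P : seq (R * R)).
Hypothesis sP : simple_polygon P.
Implicit Types (x y z w : R * R).

Local Notation m := (size P).
Local Notation nx i := (i.+1 %% m)%N.
Local Notation bd := (boundary P).
Local Notation dx := (dx P).
Local Notation dy := (dy P).
Local Notation onp := (onp P).

Let m3 : (3 <= m)%N. Proof. by case: sP. Qed.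

Definition line x w (t : R) : R * R := (x.1 + t * w.1, x.2 + t * w.2).

Lemma line_cvg x w t : line x w r @[r --> t] --> line x w t.
Proof.
have c1 (u v : R) : (u + r * v) @[r --> t] --> u + t * v.
  by apply: cvgD; [exact: cvg_cst|apply: cvgM; [exact: cvg_id|exact: cvg_cst]].
exact: (cvg_pair (c1 x.1 w.1) (c1 x.2 w.2)).
Qed.

Lemma near_line x w t (Q : R * R -> Prop) : (\forall y \near line x w t, Q y) ->
  \forall r \near t, Q (line x w r).
Proof. by move=> h; exact: (line_cvg h). Qed.

Definition parallel w j := dx j * w.2 - dy j * w.1 = 0.

Lemma parallelP w j : (j < m)%N -> parallel w j -> exists mu, w = (mu * dx j, mu * dy j).
Proof.
move=> hj; rewrite /parallel => h; have hd := d_neq0 sP hj; set N := dx j ^+ 2 + dy j ^+ 2 in hd.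
have N0 : N != 0 by rewrite gt_eqF.
have e : (w.1 * dx j + w.2 * dy j) / N * N = w.1 * dx j + w.2 * dy j by rewrite divfK.
exists ((w.1 * dx j + w.2 * dy j) / N); move: e; set mu := _ / N => e.
have k1 : N * w.1 = N * (mu * dx j).
  have -> : N * (mu * dx j) = mu * N * dx j by ring.
  rewrite e; have -> : N * w.1 = (w.1 * dx j + w.2 * dy j) * dx j - dy j * (dx j * w.2 - dy j * w.1).
    by rewrite /N; ring.
  by rewrite h mulr0 subr0.
have k2 : N * w.2 = N * (mu * dy j).
  have -> : N * (mu * dy j) = mu * N * dy j by ring.
  rewrite e; have -> : N * w.2 = (w.1 * dx j + w.2 * dy j) * dy j + dx j * (dx j * w.2 - dy j * w.1).
    by rewrite /N; ring.
  by rewrite h mulr0 addr0.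
by move: (mulfI N0 k1) (mulfI N0 k2); case: (w) => ? ? /= -> ->.
Qed.

(** With half-open parameters a vertex appears only as the end of an edge, so that the other edge to
    consider there is the next one. *)
Lemma bdP x : bd x <-> exists j r, [/\ (j < m)%N, 0 < r <= 1 & x = onp j r].
Proof.
split; last first.
  move=> [j [r [hj /andP[h1 h2] ->]]]; apply/boundaryP; exists (Ordinal hj); apply/edge_onp.
  by exists r => //; rewrite h2 ltW.
move=> /boundaryP[i /edge_onp[s /andP[s0 s1] ->]].
have [->|sn] := eqVneq s 0; last by exists (i : nat), s; rewrite ltn_ord s1 andbT lt_neqAle eq_sym sn s0.
exists ((i + m.-1) %% m)%N, 1; split; [by rewrite ltn_mod; lia|by rewrite ltr01 lexx|].
rewrite onp1 onp0; congr (P`_ _).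
rewrite -addn1 modnDml addn1 -addnS prednK; last by lia.
by rewrite modnDr modn_small.
Qed.

Lemma near_itv (u v t : R) : u < t < v -> \forall r \near t, u < r < v.
Proof.
move=> /andP[h1 h2]; near=> r; apply/andP; split; near: r.
  exact: (cvgr_gt _ cvg_id _ h1).
exact: (cvgr_lt _ cvg_id _ h2).
Unshelve. all: by end_near. Qed.

(* A point that moves along all the edges that contain it stays on the boundary:
   at a vertex, the two edges are parallel and the polygon does not fold. *)
Lemma boundary_stay x w t : bd (line x w t) ->
  (forall j, (j < m)%N -> edge P j (line x w t) -> parallel w j) ->
  \forall r \near t, bd (line x w r).
Proof.
move=> /bdP[j [s [hj /andP[s0 s1] e]]] hpar.
have ej : edge P j (line x w t) by apply/edge_onp; exists s => //; rewrite s1 ltW.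
have [mu hmu] := parallelP hj (hpar j hj ej).
have lE r : line x w r = onp j (s + (r - t) * mu).
  have [e1 e2] := e; rewrite /line hmu /onp /=; congr pair.
    by move: e1; rewrite hmu /= => e1; lra.
  by move: e2; rewrite hmu /= => e2; lra.
have cv0 (nu c : R) : (c + (r - t) * nu) @[r --> t] --> c.
  have : (c + (r - t) * nu) @[r --> t] --> c + (t - t) * nu.
    apply: cvgD; first exact: cvg_cst.
    by apply: cvgM; [apply: cvgB; [exact: cvg_id|exact: cvg_cst]|exact: cvg_cst].
  by rewrite subrr mul0r addr0.
have [sl|sn] := ltP s 1.
  have hs : 0 < s < 1 by rewrite s0.
  have : \forall r \near t, 0 < s + (r - t) * mu < 1 by exact: (cv0 mu s _ (near_itv hs)).
  apply: filterS => r /andP[r0 r1].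
  by rewrite lE; apply/bdP; exists j, (s + (r - t) * mu); rewrite hj r0 ltW.
have es : s = 1 by apply/eqP; rewrite eq_le s1.
have hk := nx_lt sP j.
have ek : edge P (nx j) (line x w t).
  by apply/edge_onp; exists 0; rewrite ?lexx ?ler01 // e es onp1 onp0.
have [mu' hmu'] := parallelP hk (hpar _ hk ek).
have lE' r : line x w r = onp (nx j) (0 + (r - t) * mu').
  rewrite lE /onp add0r -!mulrA; have [w1 w2] : w.1 = mu' * dx (nx j) /\ w.2 = mu' * dy (nx j) by rewrite {1 2}hmu'.
  rewrite -w1 -w2 hmu es /= /dx /dy; congr pair; ring.
have [m0|m0] := eqVneq mu 0.
  by apply: filterE => r; rewrite lE m0 mulr0 addr0 -e; apply/bdP; exists j, s; rewrite hj s0 s1.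
have hturn : turn P j = 0.
  have [w1 w2] : mu * dx j = mu' * dx (nx j) /\ mu * dy j = mu' * dy (nx j).
    by move: hmu; rewrite hmu' => -[-> ->].
  apply: (mulfI m0); rewrite mulr0 /turn mulrBr !mulrA w1 w2; ring.
have hdot := no_fold sP hj hturn.
(* The motion follows both edges or opposes both, since the polygon does not fold. *)
have mm : 0 <= mu * mu'.
  have [w1 w2] : mu * dx j = mu' * dx (nx j) /\ mu * dy j = mu' * dy (nx j).
    by move: hmu; rewrite hmu' => -[-> ->].
  have : 0 <= (mu * dx j) ^+ 2 + (mu * dy j) ^+ 2 by rewrite addr_ge0 // sqr_ge0.
  have -> : (mu * dx j) ^+ 2 + (mu * dy j) ^+ 2 = mu * mu' * dotn P j.
    by rewrite !expr2 {2}w1 {2}w2 /dotn; ring.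
  by rewrite pmulr_lge0.
have i1 : 0 < (1 : R) < 2 by lra.
have i2 : -1 < (0 : R) < 1 by lra.
near=> r.
have h1 : 0 < s + (r - t) * mu < 2.
  by near: r; rewrite es; exact: (cv0 mu 1 _ (near_itv i1)).
have h2 : -1 < 0 + (r - t) * mu' < 1.
  by near: r; exact: (cv0 mu' 0 _ (near_itv i2)).
(* Backwards the point remains on the edge [j], forwards it moves on to the next one. *)
have [h|h] := leP ((r - t) * mu) 0.
  by rewrite lE; apply/bdP; exists j, (s + (r - t) * mu); rewrite hj; split=> //; lra.
rewrite lE'; apply/boundaryP; exists (Ordinal hk); apply/edge_onp.
exists (0 + (r - t) * mu') => //.
suff : 0 <= (r - t) * mu' by lra.
have : 0 <= (r - t) * mu * ((r - t) * mu').
  by rewrite mulrACA mulr_ge0 // -expr2 sqr_ge0.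
by rewrite pmulr_rge0.
Unshelve. all: by end_near. Qed.

Lemma near_not_region x : ~ region P x -> \forall y \near x, ~ region P y.
Proof.
rewrite regionP // => hx; have hb : ~ bd x by move=> h; apply: hx; left.
have hp : ~ par P x by move=> h; apply: hx; right.
apply: filterS2 (near_off_boundary hb) (par_near sP hb) => y h1 h2.
by rewrite regionP // h2 => -[].
Qed.

Lemma region_stay x w t : region P (line x w t) ->
  (forall j, (j < m)%N -> edge P j (line x w t) -> parallel w j) ->
  \forall r \near t, region P (line x w r).
Proof.
move=> hr hpar; have [hb|hb] := pselect (bd (line x w t)).
  by apply: filterS (boundary_stay hb hpar) => r h; left.
move/(regionP sP): hr => [//|hp].
by apply: filterS (near_line (par_near sP hb)) => r e; apply/(regionP sP); right; rewrite e.
Qed.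

(** The times at which the point is in the region form a subset of the interval ]t1, t0] that is
    open by [region_stay] and closed since the region is closed. At [t1] itself contacts are
    unrestricted: membership there is obtained as a limit. *)
Lemma region_slide x w t1 t0 : t1 <= t0 ->
  (forall t, t1 < t <= t0 -> forall j, (j < m)%N -> edge P j (line x w t) -> parallel w j) ->
  region P (line x w t0) -> region P (line x w t1).
Proof.
move=> t10 hpar hr; apply: contrapT => hn.
have [e|ne] := eqVneq t1 t0; first by apply: hn; rewrite e.
have t1l : t1 < t0 by rewrite lt_neqAle ne.
pose I := [set t | t1 < t <= t0].
have cI : connected I.
  apply/connected_intervalP => u v /= /andP[u0 u1] /andP[v0 v1] r /andP[r0 r1].
  by apply/andP; split; lra.
have IE : I `&` [set t | region P (line x w t)] = I.
  apply: cI.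
  - by exists t0; split=> //; rewrite /I /= t1l lexx.
  - exists (interior [set t | region P (line x w t)]); first exact: open_interior.
    apply/seteqP; split=> t /= [hI ht]; split=> //; last exact: (interior_subset ht).
    by apply: region_stay => //; exact: hpar.
  - exists [set t | region P (line x w t)] => //.
    rewrite -[X in closed X]setCK; apply: open_closedC; rewrite openE => t /= ht.
    exact: (near_line (near_not_region ht)).
have /nbhs_ballP[e /= e0 he] := near_line (near_not_region hn).
pose t := Num.min t0 (t1 + e / 2).
have [k1 [k2 k3]] : t1 < t /\ t <= t0 /\ t < t1 + e.
  by rewrite /t /Num.min; case: ifP => ?; do !split; lra.
apply: (he t); first by rewrite /ball /= distrC ltr_norml; lra.
have : I t by rewrite /I /= k1 k2.
by rewrite -IE => -[].
Qed.

End Sliding.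

Lemma region_code (R : realType) (P : seq (R * R)) x : simple_polygon P ->
  let m := size P in let nx i := (i.+1 %% m)%N in let Pat i := nth (0, 0) P i in
  cont m (\sum_(j < m) ecode m (Pat j) (Pat (nx j)) x) = `[< region P x >].
Proof.
move=> sP m nx Pat; have m3 : (3 <= m)%N by case: sP.
have bdE : boundary P x <-> exists j : 'I_m, on_edge (Pat j) (Pat (nx j)) x.
  rewrite boundaryP; split.
    by move=> [j /segmentP h]; exists j.
  by move=> [j hj]; exists j; apply/segmentP.
have parE : par P x = odd (\sum_(j < m) ray_edge (Pat j) (Pat (nx j)) x).
  rewrite /par; elim/big_rec2: _ => [//|j u v _ ->].
  by rewrite oddD oddb.
have [[j hj]|hno] := pselect (exists j : 'I_m, on_edge (Pat j) (Pat (nx j)) x).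
  rewrite /cont (bigD1 j) //= {1}/ecode hj leq_addr /=.
  by symmetry; apply/asboolP; left; apply/bdE; exists j.
have ono (j : 'I_m) : on_edge (Pat j) (Pat (nx j)) x = false.
  by apply/negbTE/negP => h; apply: hno; exists j.
have -> : (\sum_(j < m) ecode m (Pat j) (Pat (nx j)) x = \sum_(j < m) ray_edge (Pat j) (Pat (nx j)) x)%N.
  by apply: eq_bigr => j _; rewrite /ecode ono.
rewrite /cont -parE.
have le : (\sum_(j < m) ray_edge (Pat j) (Pat (nx j)) x <= \sum_(j < m) 1)%N.
  by apply: leq_sum => j _; case: ray_edge.
rewrite sum_nat_const card_ord muln1 in le.
rewrite leqNgt (leq_ltn_trans le) /=; last by rewrite -addnn; lia.
apply/idP/asboolP; first by move=> h; apply/(regionP sP); right.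
by move=> /(regionP sP) [/bdE|].
Qed.

(** * Reduction of an arbitrary configuration to the curves *)

Section Optimality.
Variables (R : realType) (S P : seq (R * R)) (a b : R * R).
Hypothesis sP : simple_polygon P.
Local Notation n := (size S).
Local Notation m := (size P).

Let d : R * R := (b.1 - a.1, b.2 - a.2).
Local Notation nx i := (i.+1 %% m)%N.
Local Notation cnt := (@cnt R n m S P a b).
Local Notation Sat i := (nth (0, 0) S i).
Local Notation Pat i := (nth (0, 0) P i).
Local Notation pcq := (@pcq R m S P a b).

Let m3 : (2 < m)%N. Proof. by case: sP. Qed.

Definition inreg k v := region P (img a d k v).

Lemma cnt_inreg k : cnt k = (\sum_(i < n) `[< inreg k (Sat i) >])%N.
Proof.
apply: eq_bigr => i _; rewrite -region_code //; congr (cont _ _ : nat).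
apply: eq_bigr => j _.
rewrite /cd divnMDl; last by lia.
by rewrite divn_small // addn0 modnMDl modn_small.
Qed.

(** Instead of turning the polygon clockwise, the program turns the points counterclockwise: [img]
    is the inverse rotation about the same centre. *)
Lemma rotate_cw_img k v y theta : k.1 = (cos theta, sin theta) ->
  rotate_cw (a.1 + k.2 * d.1, a.2 + k.2 * d.2) theta y = v <-> y = img a d k v.
Proof.
case: k v y => [[c s] t] [v1 v2] [y1 y2] /= [-> ->].
have := cos2Dsin2 theta.
rewrite /rotate_cw /img /=; set r1 := a.1 + _; set r2 := a.2 + _.
move: (cos theta) (sin theta) => C D cs.
have id1 (u r : R) : u = r + (C ^+ 2 + D ^+ 2) * (u - r) by rewrite cs mul1r subrKC.
split=> [[<- <-]|[-> ->]]; congr pair.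
- by rewrite {1}[y1](id1 _ r1); ring.
- by rewrite {1}[y2](id1 _ r2); ring.
- by rewrite [RHS](id1 _ r1); ring.
- by rewrite [RHS](id1 _ r2); ring.
Qed.

Lemma contained_cnt k theta : k.1 = (cos theta, sin theta) ->
  contained S P (a.1 + k.2 * d.1, a.2 + k.2 * d.2) theta = cnt k.
Proof.
move=> hk; rewrite cnt_inreg /contained -sum1_count (big_nth (0, 0)) big_mkord big_mkcond /=.
apply: eq_bigr => i _; rewrite (_ : `[< _ >] = `[< inreg k (Sat i) >]); first by case: ifP.
apply: asbool_equiv_eq; split.
  by move=> [y hy /(rotate_cw_img _ _ hk) e]; rewrite /inreg -e.
by move=> h; exists (img a d k (Sat i)) => //; apply/(rotate_cw_img _ _ hk).
Qed.

Section FixedAngle.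
Variables (c s : R).
Hypotheses (cs1 : c ^+ 2 + s ^+ 2 = 1) (cN1 : c != -1).

(** The tangent of the half angle. *)
Let u := s / (1 + c).
(** The derivative of [img] in its parameter t, which does not depend on the point. *)
Let w : R * R := (d.1 - (c * d.1 - s * d.2), d.2 - (c * d.2 + s * d.1)).
Let x i := img a d (c, s, 0) (Sat i).

Let c1 : 1 + c != 0. Proof. by rewrite addrC addr_eq0. Qed.

Let U0 : 1 + u ^+ 2 != 0.
Proof. by rewrite gt_eqF // ltr_pwDl // sqr_ge0. Qed.

Let su : s = u * (1 + c). Proof. by rewrite /u divfK. Qed.

Let cU : c * (1 + u ^+ 2) = 1 - u ^+ 2.
Proof.
have h : (1 + c) * (c * (1 + u ^+ 2) - (1 - u ^+ 2)) = 0.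
  have e : (u * (1 + c)) ^+ 2 = 1 - c ^+ 2 by rewrite -su -cs1; ring.
  have -> : (1 + c) * (c * (1 + u ^+ 2) - (1 - u ^+ 2)) = (u * (1 + c)) ^+ 2 - (1 - c ^+ 2) by ring.
  by rewrite e subrr.
by apply/eqP; rewrite -subr_eq0; move/eqP: h; rewrite mulf_eq0 (negbTE c1).
Qed.

Let sU : s * (1 + u ^+ 2) = 2 * u.
Proof.
have -> : s * (1 + u ^+ 2) = u * ((1 + u ^+ 2) + c * (1 + u ^+ 2)) by rewrite su; ring.
by rewrite cU; ring.
Qed.

Let cE : c = (1 - u ^+ 2) / (1 + u ^+ 2). Proof. by rewrite -cU mulfK. Qed.
Let sE : s = (2 * u) / (1 + u ^+ 2). Proof. by rewrite -sU mulfK. Qed.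

Lemma img_line i t : img a d (c, s, t) (Sat i) = line (x i) w t.
Proof. by rewrite /line /x /w /img /=; congr pair; ring. Qed.

Lemma confu_start : confu (nth 0 (pc_start R)) u = (c, s, 0).
Proof.
rewrite /confu /quad /= !(mulr0, addr0) oner_eq0 mul0r ltxx ltr10 /=; congr (_, _, _).
  by rewrite [RHS]cE; congr (_ / _); ring.
by rewrite [RHS]sE; congr (_ / _); ring.
Qed.

(** In the notation of [pc_contact], the orientation of the image at t = 0 is
    [k + c * l + s * (e1 * v1 + e2 * v2)], and along the slide it changes at the rate
    [dx P j * w.2 - dy P j * w.1]. Multiplication by [1 + u ^+ 2] turns both into quadratics in
    [u]. *)
Lemma contact_quad i j : let pc := nth 0 (pc_contact (Pat j) (Pat (nx j)) (Sat i) a d) in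
  [/\ quad pc 0 u / quad pc 2 u = c, quad pc 1 u / quad pc 2 u = s,
   quad pc 3 u = - ((1 + u ^+ 2) * crossp (Pat j) (Pat (nx j)) (x i)) &
   quad pc 4 u = (1 + u ^+ 2) * (dx P j * w.2 - dy P j * w.1)].
Proof.
rewrite /quad /=; split.
- by rewrite [RHS]cE; congr (_ / _); ring.
- by rewrite [RHS]sE; congr (_ / _); ring.
- rewrite /crossp /x /img /=; move: cU sU; set p := Pat j; set q := Pat _; set v := Sat i.
  move=> hc hs.
  transitivity (- ((q.1 - p.1) * ((1 + u ^+ 2) * (a.2 - p.2) + (c * (1 + u ^+ 2)) * (v.2 - a.2) + (s * (1 + u ^+ 2)) * (v.1 - a.1)) -
    (q.2 - p.2) * ((1 + u ^+ 2) * (a.1 - p.1) + (c * (1 + u ^+ 2)) * (v.1 - a.1) - (s * (1 + u ^+ 2)) * (v.2 - a.2)))).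
    by rewrite hc hs; ring.
  by ring.
- rewrite /w /dx /dy /= -[P`_j]/(Pat j) -[P`_(nx j)]/(Pat (nx j)); move: cU sU; set p := Pat j; set q := Pat _.
  move=> hc hs.
  transitivity ((q.1 - p.1) * ((1 + u ^+ 2) * d.2 - ((c * (1 + u ^+ 2)) * d.2 + (s * (1 + u ^+ 2)) * d.1)) -
    (q.2 - p.2) * ((1 + u ^+ 2) * d.1 - ((c * (1 + u ^+ 2)) * d.1 - (s * (1 + u ^+ 2)) * d.2))).
    by rewrite hc hs /d /=; ring.
  by rewrite /d /=; ring.
Qed.

Definition transversal j := dx P j * w.2 - dy P j * w.1 != 0.

Definition contact_time i j := - crossp (Pat j) (Pat (nx j)) (x i) / (dx P j * w.2 - dy P j * w.1).

(** The orientation is affine in t, with nonzero slope for a transversal edge, so its line is met at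
    one time only. *)
Lemma contact_timeE i j t : transversal j -> edge P j (line (x i) w t) -> t = contact_time i j.
Proof.
move=> htr /crossp_on; rewrite /contact_time.
have -> : crossp P`_j P`_(nx j) (line (x i) w t) =
   crossp P`_j P`_(nx j) (x i) + t * (dx P j * w.2 - dy P j * w.1).
  by rewrite /crossp /line /dx /dy /=; ring.
by move=> /eqP; rewrite addr_eq0 => /eqP ->; rewrite opprK mulfK.
Qed.

Lemma confu_contact i j : transversal j -> 0 <= contact_time i j <= 1 ->
  confu (nth 0 (pc_contact (Pat j) (Pat (nx j)) (Sat i) a d)) u = (c, s, contact_time i j).
Proof.
move=> htr /andP[h0 h1]; have [q02 q12 q3 q4] := contact_quad i j.
rewrite /confu q02 q12 q3 q4 mulf_eq0 (negbTE U0) (negbTE htr) /=.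
rewrite -mulrN -mulf_div divff // mul1r -/(contact_time i j).
by rewrite !ltNge h0 h1.
Qed.

Lemma slide_to_contact B t : 0 <= t <= 1 ->
  (forall u, (cnt (confu (nth 0%R (pc_start R)) u) <= B)%N) ->
  (forall q u, (q < n * m)%N -> (cnt (confu (nth 0%R (pcq q)) u) <= B)%N) ->
  (cnt (c, s, t) <= B)%N.
Proof.
move=> /andP[t0 t1] hstart hcontact.
have slide t' : t' <= t -> (forall r, t' < r <= t -> forall i j, (i < n)%N -> (j < m)%N ->
    edge P j (line (x i) w r) -> ~~ transversal j) -> (cnt (c, s, t) <= cnt (c, s, t'))%N.
  move=> tt h; rewrite !cnt_inreg; apply: leq_sum => i _.
  case: asboolP => // hi; rewrite (_ : `[< _ >] = true) //; apply/asboolP.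
  move: hi; rewrite /inreg !img_line; apply: region_slide => // r hr j hj he.
  by apply/eqP; rewrite -[_ == _]negbK; exact: (h r hr i j).
(* The transversal contacts up to the time [t], at most one for each pair of a point and an edge. *)
pose hit (ij : 'I_n * 'I_m) := [&& transversal ij.2,
  on_edge (Pat ij.2) (Pat (nx ij.2)) (line (x ij.1) w (contact_time ij.1 ij.2)) &
  0 <= contact_time ij.1 ij.2 <= t].
have tohit i j r : (i < n)%N -> (j < m)%N -> 0 <= r <= t -> edge P j (line (x i) w r) -> transversal j ->
    exists2 ij : 'I_n * 'I_m, hit ij & r = contact_time ij.1 ij.2.
  move=> hi hj hr he htr; have er := contact_timeE htr he.
  exists (Ordinal hi, Ordinal hj) => //=; rewrite /hit /= htr -er hr andbT /=.
  by apply/segmentP.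
have [[ij0 h0]|hno] := pselect (exists ij, hit ij).
  (* The latest contact is where the slide from [t] stops; that configuration is on the contact
     curve of its pair. *)
  case: (@arg_maxP _ _ _ ij0 hit (fun ij => contact_time ij.1 ij.2) h0) => -[i j] /and3P[/= htr hon /andP[k0 k1]] hmax.
  apply: leq_trans (slide _ k1 _) _.
    move=> r /andP[r0 r1] i' j' hi' hj' he; apply/negP => htr'.
    have [|ij hij er] := tohit i' j' r hi' hj' _ he htr'; first by apply/andP; split; lra.
    by move: (hmax ij hij) r0; rewrite -er /= => h1 h2; lra.
  rewrite -confu_contact //; last by apply/andP; split; lra.
  have hq : (i * m + j < n * m)%N.
    by apply: (@leq_trans (i.+1 * m)); [rewrite mulSn addnC ltn_add2r|rewrite leq_mul2r ltn_ord orbT].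
  have m0 : (0 < m)%N := ltnW (ltnW m3).
  have ei : ((i * m + j) %/ m = i)%N by rewrite divnMDl // divn_small ?addn0.
  have ej : ((i * m + j) %% m = j)%N by rewrite modnMDl modn_small.
  by have := hcontact _ u hq; rewrite /pcq ei ej.
(* Nothing stops the slide before t = 0. *)
apply: leq_trans (slide 0 t0 _) _; last by rewrite -confu_start.
move=> r /andP[r0 r1] i j hi hj he; apply/negP => htr; apply: hno.
by have [|ij hij _] := tohit i j r hi hj _ he htr; [rewrite r1 ltW|exists ij].
Qed.

End FixedAngle.

Lemma cnt_optimal B k : validk k ->
  (forall u, (cnt (confu (nth 0%R (pc_start R)) u) <= B)%N) ->
  (forall u, (cnt (confu (nth 0%R (pc_half_turn R)) u) <= B)%N) ->
  (forall q u, (q < n * m)%N -> (cnt (confu (nth 0%R (pcq q)) u) <= B)%N) ->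
  (cnt k <= B)%N.
Proof.
case: k => [[c s] t] [/= cs1 ht] h1 h2 h3.
have [e|ne] := eqVneq c (-1); last exact: (slide_to_contact cs1 ne ht h1 h3).
have s0 : s = 0.
  by apply/eqP; rewrite -sqrf_eq0; apply/eqP; move: cs1; rewrite e sqrrN expr1n; lra.
(* On the half-turn curve the parameter is the position on the segment, so [u = t]. *)
have := h2 t; rewrite /confu /quad /= !(mulr0, addr0, add0r, mulr1, divr1) oner_eq0.
by case/andP: ht => t0 t1; rewrite !ltNge t0 t1 /= e s0.
Qed.

Definition angle (k : R * R * R) : R := if k.1.2 < 0 then 2 * pi - acos k.1.1 else acos k.1.1.

Lemma angleP k : validk k -> 0 <= angle k < 2 * pi /\ k.1 = (cos (angle k), sin (angle k)).
Proof.
case: k => [[c s] t] [/= cs1 _].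
have hc : -1 <= c <= 1 by have := sqr_ge0 s; move=> h; apply/andP; split; nra.
have [/andP[c0 cpi] ck] : 0 <= acos c <= pi /\ cos (acos c) = c.
  by rewrite acosK // acos_ge0 // acos_lepi.
have pi0 := pi_gt0 R.
have sa : sin (acos c) = `|s|.
  rewrite sin_acos // -sqrtr_sqr; congr Num.sqrt; lra.
rewrite /angle /=; case: ltP => hs.
  (* A negative sine excludes [acos c = 0], which would give the forbidden angle [2 * pi]. *)
  have cl : c < 1.
    rewrite lt_neqAle; have [_ ->] := andP hc; rewrite andbT; apply/eqP => e.
    by move: cs1; rewrite e expr1n => h; move: hs; have := sqr_ge0 s; nra.
  have ac0 : 0 < acos c by apply: acos_gt0; have [-> _] := andP hc.
  split; first by apply/andP; split; lra.
  have eC : cos (2 * pi - acos c) = c.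
    by rewrite cosB ?mulr_natl cos2pi sin2pi; lra.
  have eS : sin (2 * pi - acos c) = s.
    by rewrite sinB ?mulr_natl cos2pi sin2pi sa ltr0_norm //; lra.
  by rewrite eC eS.
split; first by apply/andP; split; lra.
by rewrite ck sa ger0_norm.
Qed.

Lemma optimal_solution k : validk k ->
  (forall u, (cnt (confu (nth 0%R (pc_start R)) u) <= cnt k)%N) ->
  (forall u, (cnt (confu (nth 0%R (pc_half_turn R)) u) <= cnt k)%N) ->
  (forall q u, (q < n * m)%N -> (cnt (confu (nth 0%R (pcq q)) u) <= cnt k)%N) ->
  segment_MCR_solution S P a b (a.1 + k.2 * d.1, a.2 + k.2 * d.2) (angle k).
Proof.
move=> hk h1 h2 h3; have [ha ka] := angleP hk; split=> //.
  by exists k.2 => //=; rewrite in_itv /=; case: hk.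
move=> r' theta' [t]; rewrite /= in_itv /= => ht <- _.
rewrite (contained_cnt ka) (@contained_cnt (cos theta', sin theta', t)) //.
by apply: cnt_optimal => //; split=> //=; exact: cos2Dsin2.
Qed.

End Optimality.

(** * The complete program *)

Section Prelude.
Local Open Scope nat_scope.

Fixpoint seqs (l : seq com) : com := if l is c :: l then Seq c (seqs l) else Skip.

(** The address of the entry 0 of the array [id], as [tmp] is 128. *)
Definition var_cell id := 128 + id.

(** For the copying loop, cell 2 receives the number of input coordinates, cell 3 the source
    address, cell 4 the destination address in [rIN], and cells 5 and 6 their increments 1 and
    64. *)
Definition prelude_setup : com := seqs [seq Do i | i <- [::
  IMove (Dir (var_cell iN)) (Dir 0);
  IMove (Dir (var_cell iM)) (Dir 1);
  IBin IMul (Dir (var_cell iNM)) (Dir 0) (Dir 1);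
  IConst (Dir 5) 6;
  IBin IMul (Dir (var_cell iOff)) (Dir 5) (Dir (var_cell iNM));
  IConst (Dir 5) 32;
  IBin IMul (Dir (var_cell iK)) (Dir 5) (Dir (var_cell iNM));
  IBin IAdd (Dir 2) (Dir 0) (Dir 1);
  IConst (Dir 5) 2;
  IBin IAdd (Dir 2) (Dir 2) (Dir 5);
  IBin IMul (Dir 2) (Dir 2) (Dir 5);
  IConst (Dir 6) 64;
  IBin IMul (Dir 4) (Dir 6) (Dir (var_cell iOff));
  IConst (Dir 5) 128;
  IBin IAdd (Dir 4) (Dir 4) (Dir 5);
  IConst (Dir 3) 0;
  IConst (Dir 5) 1]].

Definition copy_step : com := seqs [seq Do i | i <- [::
  RMove (Ind 4) (Ind 3);
  IBin IAdd (Dir 3) (Dir 3) (Dir 5);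
  IBin IAdd (Dir 4) (Dir 4) (Dir 6)]].

Definition prelude : com := Seq prelude_setup (While (ILt (Dir 3) (Dir 2)) copy_step).

Definition epilogue : com := seqs [seq Do i | i <- [::
  RMove (Dir 0) (Dir (var_cell rX1));
  RMove (Dir 1) (Dir (var_cell rX2));
  RMove (Dir 2) (Dir (var_cell rU))]].

Variables (R : realType) (S P : seq (R * R)) (a b : R * R).
Notation n := (size S).
Notation m := (size P).
Variables (M W : nat).
Hypothesis n0 : 0 < n.
Hypothesis m3 : 2 < m.
(** 128 scratch cells and 64 interleaved arrays of length [64 * (n * m)]. *)
Hypothesis hM : 128 + 4096 * (n * m) <= M.
Hypothesis MW : M <= W.
Notation ex := (exec M W).
Notation L := ((n + m + 2) * 2).
Notation pts := ([:: a; b] ++ S ++ P).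
Implicit Types st : state R.

Lemma exIMove st k i v : imem st i = v -> k < M -> i < M -> v < W ->
  ex (Do (IMove (Dir k) (Dir i))) st 1 (State (upd1 (imem st) k v) (rmem st)).
Proof.
move=> <- h1 h2 h3; apply: ExecDo.
by rewrite /= /iget /= h2 /= /iset h3 /= h1.
Qed.

Lemma exIBin_eq st o k i j v : iop_eval o (imem st i) (imem st j) = v ->
  k < M -> i < M -> j < M -> v < W ->
  ex (Do (IBin o (Dir k) (Dir i) (Dir j))) st 1 (State (upd1 (imem st) k v) (rmem st)).
Proof. by move=> <-; apply: exIBin. Qed.

Lemma exRMove st k i : k < M -> i < M ->
  ex (Do (RMove (Dir k) (Dir i))) st 1 (State (imem st) (upd1 (rmem st) k (rmem st i))).
Proof.
by move=> h1 h2; apply: ExecDo; rewrite /= /rget /= h2 /= /rset /= h1.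
Qed.

Lemma exRMove_ind st k i : k < M -> i < M -> imem st k < M -> imem st i < M ->
  ex (Do (RMove (Ind k) (Ind i))) st 1
    (State (imem st) (upd1 (rmem st) (imem st k) (rmem st (imem st i)))).
Proof.
by move=> h1 h2 h3 h4; apply: ExecDo; rewrite /= /rget /= h2 h4 /= /rset /= h1 h3.
Qed.

Lemma nm_bounds : [/\ n <= n * m, m <= n * m, 3 <= n * m & n + m <= n * m + 1].
Proof. split; nia. Qed.

Lemma setup_ok (rm : nat -> R) : exists im,
  [/\ ex prelude_setup (State (nth 0 [:: n; m]) rm) 17 (State im rm),
    [/\ im 2 = L, im 3 = 0, im 4 = 64 * (6 * (n * m)) + 128, im 5 = 1 & im 6 = 64],
    [/\ im (var_cell iN) = n, im (var_cell iM) = m, im (var_cell iNM) = n * m, im (var_cell iOff) = 6 * (n * m) & im (var_cell iK) = 32 * (n * m)] &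
    forall j, 128 <= j -> j \notin [:: var_cell iN; var_cell iM; var_cell iNM; var_cell iOff; var_cell iK] -> im j = 0].
Proof.
have [h1 h2 h3 h4] := nm_bounds.
have b1 : 128 + 4096 * (n * m) <= W by lia.
move: (n) (m) h1 h2 h3 h4 b1 hM => x y h1 h2 h3 h4 b1 hM'.
rewrite /prelude_setup /var_cell /iN /iM /iNM /iOff /iK; have step (l : seq com) c t im im' im'' : ex c (State im rm) 1 (State im' rm) ->
    ex (seqs l) (State im' rm) t (State im'' rm) -> ex (seqs (c :: l)) (State im rm) t.+1 (State im'' rm).
  by move=> e1 e2; apply: (ExecSeq (t1 := 1)) e1 e2.
eexists; split.
- apply: (step); first by apply: (@exIMove (State _ _) _ _ x); [by []|lia..].
  apply: (step); first by apply: (@exIMove (State _ _) _ _ y); [by []|lia..].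
  apply: (step); first by apply: (@exIBin_eq (State _ _) _ _ _ _ (x * y)); [by []|lia..].
  apply: (step); first by apply: (@exIConst _ _ _ (State _ _) _ 6); lia.
  apply: (step); first by apply: (@exIBin_eq (State _ _) _ _ _ _ (6 * (x * y))); [by []|lia..].
  apply: (step); first by apply: (@exIConst _ _ _ (State _ _) _ 32); lia.
  apply: (step); first by apply: (@exIBin_eq (State _ _) _ _ _ _ (32 * (x * y))); [by []|lia..].
  apply: (step); first by apply: (@exIBin_eq (State _ _) _ _ _ _ (x + y)); [by []|lia..].
  apply: (step); first by apply: (@exIConst _ _ _ (State _ _) _ 2); lia.
  apply: (step); first by apply: (@exIBin_eq (State _ _) _ _ _ _ (x + y + 2)); [by []|lia..].
  apply: (step); first by apply: (@exIBin_eq (State _ _) _ _ _ _ ((x + y + 2) * 2)); [by []|lia..].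
  apply: (step); first by apply: (@exIConst _ _ _ (State _ _) _ 64); lia.
  apply: (step); first by apply: (@exIBin_eq (State _ _) _ _ _ _ (64 * (6 * (x * y)))); [by []|lia..].
  apply: (step); first by apply: (@exIConst _ _ _ (State _ _) _ 128); lia.
  apply: (step); first by apply: (@exIBin_eq (State _ _) _ _ _ _ (64 * (6 * (x * y)) + 128)); [by []|lia..].
  apply: (step); first by apply: (@exIConst _ _ _ (State _ _) _ 0); lia.
  apply: (step); first by apply: (@exIConst _ _ _ (State _ _) _ 1); lia.
  exact: ExecSkip.
- by rewrite /= /upd1 /=; split.
- by rewrite /= /upd1 /=; split.
- move=> j hj; rewrite /= /upd1 !inE !negb_or => /and5P[/negbTE-> /negbTE-> /negbTE-> /negbTE-> /negbTE->].
  do ![rewrite ifN; last by lia].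
  by rewrite nth_default //=; lia.
Qed.

Definition copied (rm0 : nat -> R) (im0 : nat -> nat) x (im : nat -> nat) (rm : nat -> R) :=
  [/\ [/\ im 2 = L, im 3 = x, im 4 = 64 * (6 * (n * m) + x) + 128, im 5 = 1 & im 6 = 64],
   forall j, 128 <= j -> im j = im0 j,
   forall j, j < L -> rm j = rm0 j &
   forall y, y < x -> rm (64 * (6 * (n * m) + y) + 128) = rm0 y].

Lemma copy_ok rm0 im0 k im rm : k <= L -> copied rm0 im0 (L - k) im rm -> exists t im' rm',
  [/\ ex (While (ILt (Dir 3) (Dir 2)) copy_step) (State im rm) t (State im' rm'),
   t <= 4 * k + 1 & copied rm0 im0 L im' rm'].
Proof.
have [h1 h2 h3 h4] := nm_bounds.
have M4 j : j < 7 -> j < M by lia.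
have hL : L <= 2 * (n * m) + 6 by lia.
elim: k im rm => [|k IH] im rm hk; rewrite ?subn0 => -[[e2 e3 e4 e5 e6] hi hr hc].
  exists 1, im, rm; split=> //; apply: ExecWhileFalse.
  by rewrite /= /iget /= !M4 //= e2 e3 ltnn.
pose x := L - k.+1.
have ex3 : im 3 = x by [].
have hx : x < L by rewrite /x; lia.
have ht : test_eval M (ILt (Dir 3) (Dir 2)) (State im rm) = Some true.
  by rewrite /= /iget /= !M4 //= e2 ex3 hx.
set dst := 64 * (6 * (n * m) + x) + 128.
have e4' : im 4 = dst by rewrite e4.
have hdst : dst < M by rewrite /dst; lia.
have xM : x < M by lia.
pose im1 := upd1 (upd1 im 3 x.+1) 4 (64 * (6 * (n * m) + x.+1) + 128).
pose rm1 := upd1 rm dst (rm x).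
have exs : ex copy_step (State im rm) 3 (State im1 rm1).
  apply: (ExecSeq (t1 := 1) (t2 := 2) (s' := State im rm1)).
    by have := @exRMove_ind (State im rm) 4 3; rewrite /= e4' ex3; apply=> //; apply: M4.
  apply: (ExecSeq (t1 := 1) (t2 := 1) (s' := State (upd1 im 3 x.+1) rm1)).
    by apply: (@exIBin_eq (State _ _)); rewrite ?M4 //= ?ex3 ?e5 ?addn1 //; lia.
  apply: (ExecSeq (t1 := 1) (t2 := 0) (s' := State im1 rm1)); last exact: ExecSkip.
  apply: (@exIBin_eq (State _ _)); rewrite ?M4 //=; last by lia.
  by rewrite /upd1 /= e4' e6 /dst; lia.
have hc1 : copied rm0 im0 (L - k) im1 rm1.
  have ek : L - k = x.+1 by rewrite /x; lia.
  rewrite ek; split.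
  - by rewrite /im1 /upd1 /=.
  - move=> j hj; rewrite /im1 !upd1N; [exact: hi|lia|lia].
  - move=> j hj; rewrite /rm1 upd1N; [exact: hr|rewrite /dst; lia].
  - move=> y; rewrite ltnS leq_eqVlt => /orP[/eqP ->|hy].
      by rewrite /rm1 upd1E hr.
    by rewrite /rm1 upd1N; [exact: hc|rewrite /dst; lia].
have [t [im' [rm' [ex' ht' hc']]]] := IH im1 rm1 (ltnW hk) hc1.
exists (3 + t).+1, im', rm'; split=> //; last by lia.
exact: ExecWhileTrue ht exs ex'.
Qed.

Lemma nth_points (l : seq (R * R)) i :
  nth 0%R (flatten [seq [:: x.1; x.2] | x <- l]) (2 * i) = (nth (0, 0)%R l i).1 /\
  nth 0%R (flatten [seq [:: x.1; x.2] | x <- l]) (2 * i).+1 = (nth (0, 0)%R l i).2.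
Proof.
elim: l i => [i|x l IH [|i]]; [by rewrite !nth_default|by []|].
by rewrite mulnS; exact: IH.
Qed.

Lemma prelude_ok : exists t st,
  [/\ ex prelude (input_state S P a b) t st, t <= 50 * (n * m), wf W st,
      Env n m S P a b (view st) &
      forall c i, c \notin [:: iN; iM; iNM; iOff; iK] -> (view st).1 c i = 0].
Proof.
have [h1 h2 h3 h4] := nm_bounds.
pose rm0 := nth 0%R (flatten [seq [:: x.1; x.2] | x <- pts]).
have [im0 [ex0 [e2 e3 e4 e5 e6] [eN eM eNM eOff eK] hz]] := setup_ok rm0.
have [|t [im1 [rm1 [ex1 ht hc]]]] := @copy_ok rm0 im0 L im0 rm0 (leqnn _).
  by rewrite subnn; split=> //; rewrite addn0.
have exP : ex prelude (input_state S P a b) (17 + t) (State im1 rm1) by exact: ExecSeq ex0 ex1.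
have w0 : wf W (input_state S P a b).
  by move=> [|[|j]] /=; rewrite ?nth_nil; lia.
exists (17 + t), (State im1 rm1); split=> //; first by lia.
  exact: exec_wf exP w0.
  have [_ hi hr hcp] := hc.
  have vi c : c < 64 -> (view (State im1 rm1)).1 c 0 = im0 (var_cell c).
    by move=> hc64; rewrite view_id ?nidsE //= mul0n addn0 tmpE hi.
  have vr y : y < L -> (view (State im1 rm1)).2 rIN (6 * (n * m) + y) = rm0 y.
    move=> hy; rewrite view_rd ?nidsE //= tmpE /rIN addn0 -hcp //.
    by congr rm1; lia.
  have pS i : i < n -> nth (0, 0)%R pts (2 + i) = nth (0, 0)%R S i.
    by move=> hin; rewrite add2n /= nth_cat hin.
  have pP j : nth (0, 0)%R pts (2 + (n + j)) = nth (0, 0)%R P j.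
    by rewrite add2n /= nth_cat ifN ?addKn // -leqNgt leq_addr.
  split; rewrite ?vi //.
  - by rewrite vr; [exact: (proj1 (nth_points pts 0))|lia].
  - by rewrite vr; [exact: (proj2 (nth_points pts 0))|lia].
  - by rewrite vr; [exact: (proj1 (nth_points pts 1))|lia].
  - by rewrite vr; [exact: (proj2 (nth_points pts 1))|lia].
  - move=> i hin; rewrite vr; last by lia.
    rewrite (_ : 4 + 2 * i = 2 * (2 + i)); last by lia.
    by rewrite /rm0 (proj1 (nth_points _ _)) pS.
  - move=> i hin; rewrite vr; last by lia.
    rewrite (_ : 5 + 2 * i = (2 * (2 + i)).+1); last by lia.
    by rewrite /rm0 (proj2 (nth_points _ _)) pS.
  - move=> j hj; rewrite vr; last by lia.
    rewrite (_ : 4 + 2 * (n + j) = 2 * (2 + (n + j))); last by lia.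
    by rewrite /rm0 (proj1 (nth_points _ _)) pP.
  - move=> j hj; rewrite vr; last by lia.
    rewrite (_ : 5 + 2 * (n + j) = (2 * (2 + (n + j))).+1); last by lia.
    by rewrite /rm0 (proj2 (nth_points _ _)) pP.
move=> c i hcn; have [_ hi _ _] := hc.
rewrite /view /=; case: ifP => // hc64.
have hj : 128 <= tmp + i * nids + c by rewrite tmpE; lia.
rewrite hi // hz //; move: hcn hc64; rewrite !inE !negb_or /var_cell tmpE nidsE /iN /iM /iNM /iOff /iK.
by move=> *; lia.
Qed.

Lemma epilogue_ok st : exists st',
  [/\ ex epilogue st 3 st', rmem st' 0 = rmem st (var_cell rX1), rmem st' 1 = rmem st (var_cell rX2) &
   rmem st' 2 = rmem st (var_cell rU)].
Proof.
have [h1 h2 h3 h4] := nm_bounds.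
have M4 j : j < 200 -> j < M by lia.
eexists; split.
- apply: (ExecSeq (t1 := 1) (t2 := 2)); first by apply: exRMove; apply: M4.
  apply: (ExecSeq (t1 := 1) (t2 := 1)); first by apply: exRMove; apply: M4.
  apply: (ExecSeq (t1 := 1) (t2 := 0)); first by apply: exRMove; apply: M4.
  exact: ExecSkip.
- by rewrite /= /upd1 /=.
- by rewrite /= /upd1 /=.
- by rewrite /= /upd1 /=.
Qed.

End Prelude.

(** * Total running time *)

Section Cost.
Local Open Scope nat_scope.

Lemma pass_cost_le K : 0 < K -> pass_cost K <= K * pass_cost 1.
Proof.
move=> k0; rewrite /pass_cost !mul1n.
move: (hcost (hset iL _)) (block_cost + _ + _) (xcost _).+2 (hcost (HSeq _ _)) (forc _ _) (hcost (hset iW _)).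
move=> A B C D E F; nia.
Qed.

Lemma sort_cost_le E K : 0 < K -> sort_cost E K <= K * E.+1 * sort_cost 1 1.
Proof.
move=> k0; have := pass_cost_le k0; rewrite /sort_cost !mul1n.
move: (pass_cost K) (pass_cost 1) (hcost _) (xcost _).+2 => p p1 A B hp.
have h1 : E * (p + B) <= E * (K * (p1 + B)) by rewrite leq_mul2l; apply/orP; right; nia.
apply: (@leq_trans (A + E * (K * (p1 + B)) + B)); first by lia.
have h2 : A + B <= K * E.+1 * (A + B) by apply: leq_pmull; rewrite muln_gt0 k0.
have h3 : E * (K * (p1 + B)) <= K * E.+1 * (p1 + B).
  by rewrite mulnA leq_mul2r [K * _]mulnC leq_mul2r leqnSn !orbT.
by rewrite (_ : A + (p1 + B + B) = (A + B) + (p1 + B)) ?[X in _ <= X]mulnDr; lia.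
Qed.

Lemma sweep_cost_le n m : 0 < n * m ->
  sweep_cost n m <= 32 * (n * m) * (hcost sweep_init + probe_cost 1 + step_cost2 +
    (xcost (XI (EL (V iG) (V iK)))).+2 + (xcost (XI (EL (V iG) (V iK)))).+2).
Proof.
move=> N0; have K0 : 0 < 32 * (n * m) by lia.
have := probe_cost_le K0; rewrite /sweep_cost.
move: (probe_cost (32 * (n * m))) (probe_cost 1) => p p1.
move: (32 * (n * m)) K0 => K K0 hp.
move: (hcost sweep_init) (xcost (XI (EL (V iG) (V iK)))).+2 step_cost2 => A B C.
have := leq_pmull A K0; have := leq_pmull B K0; rewrite !mulnDr; lia.
Qed.

(** The constants are named and then abstracted, never evaluated: only the dependence on [n * m] and
    on the number [E] of sorting passes matters. *)
Lemma path_cost_le : exists A, forall n m E, 0 < n * m -> path_cost n m E <= A * (n * m * E.+1).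
Proof.
pose g1 := hcost atom_events + forc iQ (V iNM) + forc iQ (V iNM).
pose g2 := hcost (HI aId (V kk) (XI (EB IDiv (V kk) (EN 32)))) + forc kk (V iK) + forc kk (V iK).
pose g3 := sort_cost 1 1.
pose g4 := hcost sweep_init + probe_cost 1 + step_cost2 +
    (xcost (XI (EL (V iG) (V iK)))).+2 + (xcost (XI (EL (V iG) (V iK)))).+2.
exists (g1 + 32 * (g2 + g3 + g4)) => n m E N0.
have K0 : 0 < 32 * (n * m) by lia.
have hs := sort_cost_le E K0; have hw := sweep_cost_le N0.
have hk : gen_keys_cost n m <= n * m * g1.
  rewrite /gen_keys_cost /g1; move: (n * m) N0 (forc _ _) (hcost _) => N N0 A B; nia.
have hi : gen_ids_cost n m <= 32 * (n * m) * g2.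
  rewrite /gen_ids_cost /g2; move: (32 * (n * m)) K0 (forc _ _) (hcost _) => N N1 A B; nia.
rewrite /path_cost; move: hs hw hk hi; rewrite -/g3 -/g4.
move: (sort_cost E _) (sweep_cost n m) (gen_keys_cost n m) (gen_ids_cost n m) g1 g2 g3 g4.
move=> s w k i g1 g2 g3 g4; move: (n * m) => N hs hw hk hi.
have {}hs : s <= 32 * g3 * (N * E.+1) by move: hs; lia.
have NX : N <= N * E.+1 by exact: leq_pmulr.
move: (N * E.+1) NX hs => X NX hs.
have {}hw : w <= 32 * g4 * X.
  by apply: leq_trans hw _; rewrite mulnAC leq_mul2l NX orbT.
have {}hi : i <= 32 * g2 * X.
  by apply: leq_trans hi _; rewrite mulnAC leq_mul2l NX orbT.
have {}hk : k <= g1 * X.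
  by apply: leq_trans hk _; rewrite mulnC leq_mul2l NX orbT.
by lia.
Qed.

Lemma main_cost_le : exists A, forall n m E, 0 < n * m -> main_cost n m E <= A * ((n * m) ^ 2 * E.+1).
Proof.
have [A hA] := path_cost_le.
pose c1 := hcost init_best + hcost (setpc 0 epc_start) + hcost (setpc 0 epc_half_turn) + hcost finish
  + forc iP (V iNM).
pose c2 := hcost (hset iQ (XI (V iP))) + hcost set_ij + hcost (setpc 0 epc_contact) + forc iP (V iNM).
exists (c1 + c2 + 3 * A) => n m E N0; have := hA n m E N0.
have : main_cost n m E = c1 + 2 * path_cost n m E + n * m * (c2 + path_cost n m E).
  rewrite /main_cost /c1 /c2.
  move: (path_cost n m E) (hcost init_best) (hcost (setpc 0 epc_start)) (hcost (setpc 0 epc_half_turn)) (hcost finish)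
   (forc _ _) (hcost (hset _ _)) (hcost set_ij) (hcost (setpc _ _)) => p x1 x2 x3 x4 x5 x6 x7 x8.
  by move: (n * m) => N; lia.
move=> ->; move: (path_cost n m E) c1 c2; move: (n * m) N0 => N N0 p c1 c2 hp.
have NE : 0 < N * E.+1 by rewrite muln_gt0 N0.
have N2 : N * E.+1 <= N ^ 2 * E.+1 by rewrite leq_mul2r leq_pmulr // orbT.
have X0 : 0 < N ^ 2 * E.+1 by lia.
have h1 : c1 <= c1 * (N ^ 2 * E.+1) by apply: leq_pmulr.
have h2 : p <= A * (N ^ 2 * E.+1) by apply: leq_trans hp _; rewrite leq_mul2l N2 orbT.
have h3 : N * p <= A * (N ^ 2 * E.+1).
  apply: (@leq_trans (N * (A * (N * E.+1)))); first by rewrite leq_mul2l hp orbT.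
  by rewrite mulnCA (mulnA N N) mulnn.
have h4 : N * c2 <= c2 * (N ^ 2 * E.+1).
  rewrite mulnC leq_mul2l; apply/orP; right; apply: leq_trans N2; exact: leq_pmulr.
move: (N ^ 2 * E.+1) h1 h2 h3 h4 => X h1 h2 h3 h4.
by rewrite !mulnDl mulnDr; lia.
Qed.

End Cost.

Definition mcr_program : com := Seq prelude (Seq (compile main_code) epilogue).

Section Solve.
Local Open Scope nat_scope.

Lemma mcr_program_ok (R : realType) : exists A, forall (S P : seq (R * R)) a b M W E,
  let N := size S * size P in
  0 < size S -> simple_polygon P -> 128 + 4096 * N <= M -> M <= W ->
  16 * N ^ 2 + 256 * N < W -> 32 * N <= 2 ^ E -> exists t s,
  [/\ exec M W mcr_program (input_state S P a b) t s, t <= A * (N ^ 2 * E.+1) &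
    segment_MCR_solution S P a b (output_point s) (output_angle s)].
Proof.
(* The extra 53 absorbs the [50 * (n * m)] steps of the prelude and the 3 steps of the epilogue. *)
have [A hA] := main_cost_le; exists (53 + A) => S P a b M W E N n0 sP hM MW hW hE.
have m3 : 2 < size P by case: sP.
have N0 : 0 < N by rewrite muln_gt0 n0; lia.
have [t1 [s1 [ex1 ht1 w1 hEnv hz]]] := @prelude_ok R S P a b M W n0 m3 hM MW.
(* The integer memory starts at 0, so all codes, all sums and the total are 0, which is
   consistent. *)
have hc : cons (size S) (size P) (view s1).
  split=> [i hi||q hq]; rewrite ?hz // big1 // => k _; rewrite hz //.
  by rewrite /cont leqn0 double_eq0; case: (size P) m3.
have hb : (view s1).1 iBest 0 = 0 by rewrite hz.
have [t2 [s2 [ex2 ht2 ho]]] := main_ok n0 m3 (erefl (64 * N)) hW hE hEnv hc hb.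
have LimM : tmp + 64 * N * nids <= M by rewrite tmpE nidsE; lia.
have [t3 [s3 [ex3 ht3 v3]]] := compile_ok LimM MW ex2 w1 erefl.
have [s4 [ex4 e0 e1 e2]] := epilogue_ok n0 m3 hM MW s3.
exists (t1 + (t3 + 3)), s4; split.
- exact: ExecSeq ex1 (ExecSeq ex3 ex4).
- have := hA _ _ E N0; rewrite -/N => hm; have := leq_trans ht3 (leq_trans ht2 hm).
  have NX : N <= N ^ 2 * E.+1.
    by rewrite -mulnn -mulnA leq_pmulr // muln_gt0 N0.
  by rewrite -/N in ht1; lia.
have rd c : c < 64 -> rmem s3 (var_cell c) = s2.2 c 0.
  by move=> hc64; rewrite -v3 view_rd ?nidsE // mul0n addn0 tmpE.
rewrite /output_point /output_angle e0 e1 e2 !rd //.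
case: ho => k [hk [-> ->] -> hsh hq].
by apply: (@optimal_solution _ _ _ _ _ sP k hk) => [u|u|]; [case: (hsh u)|case: (hsh u)|].
Qed.

End Solve.

(** From ln (1 + x) <= x at x = -1/2. *)
Lemma ln2_ge (R : realType) : 1 / 2 <= ln (2 : R).
Proof.
have : ln (1 + (- (1 / 2)) : R) <= - (1 / 2) by apply: le_ln1Dx; lra.
rewrite (_ : 1 + _ = 2^-1 :> R); last by lra.
by rewrite lnV ?posrE //; lra.
Qed.

(** With U the rounded logarithm, 2 ^ (U - 1) < 32 N gives U + 1 <= 7 + 2 ln N, because 1 / ln 2 <=
    2; and 7 <= 14 ln N, because ln N >= 1/2. *)
Lemma up_log_ln (R : realType) N : (1 < N)%N ->
  ((up_log 2 (32 * N)).+1)%:R <= 16 * ln (N%:R : R).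
Proof.
move=> N1; have hl2 := ln2_ge R.
have lN : ln (2 : R) <= ln (N%:R : R) by rewrite ler_ln ?posrE ?ltr0n ?ler_nat //; lia.
set U := up_log 2 _.
have hU : (2 ^ U.-1 < 32 * N)%N by apply: up_log_gtn => //; lia.
have : ln ((2 ^ U.-1)%N%:R : R) <= ln ((32 * N)%N%:R : R).
  by rewrite ler_ln ?posrE ?ltr0n ?ler_nat ?expn_gt0 //; lia.
rewrite natrX natrM lnXn ?ltr0n // lnM ?posrE ?ltr0n //; last by lia.
rewrite (_ : 32 = 2 ^+ 5 :> R); last by rewrite -natrX.
rewrite lnXn ?ltr0n // -(mulr_natl (ln 2) U.-1) -(mulr_natl (ln 2) 5) => h.
have hU' : (U.+1%:R : R) <= U.-1%:R + 2 by rewrite -natrD ler_nat; lia.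
have : (U.-1%:R - 5) * (1 / 2) <= ln (N%:R : R).
  have [h5|h5] := leP (U.-1%:R : R) 5; first by have : 0 <= ln (N%:R : R); [lra|nra].
  by apply: le_trans (_ : (U.-1%:R - 5) * ln 2 <= _); [apply: ler_wpM2l; lra|lra].
by lra.
Qed.

Theorem theorem12 (R : realType) :
  exists (prog : com) (C k : nat),
  forall (n m : nat) (S : n.-tuple (R * R)) (P : m.-tuple (R * R))
         (a b : R * R),
    (0 < n)%N -> uniq S -> simple_polygon P ->
    exists (t : nat) (s : state R),
      [/\ exec (C * (n ^ 2 * m ^ 2))%N ((n * m) ^ k)%N prog
               (input_state S P a b) t s,
          t%:R <= C%:R * (n ^ 2 * m ^ 2)%N%:R * ln ((n * m)%N%:R : R)
        & segment_MCR_solution S P a b (output_point s) (output_angle s)].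
Proof.
have [A hA] := mcr_program_ok R.
(* 5000 covers the memory and the range of the integers, [16 * A] the time once the number of passes
   is bounded by [up_log_ln]. The exponent [C + 2] makes the word range at least the memory size,
   since [(n * m) ^ C] exceeds [C]. *)
pose C := (16 * A + 5000)%N; exists mcr_program, C, (C + 2)%N.
move=> n m S P a b n0 _ sP.
have := hA S P a b (C * (n ^ 2 * m ^ 2))%N ((n * m) ^ (C + 2))%N (up_log 2 (32 * (n * m))).
rewrite !size_tuple -expnMn => h.
have m3 : (2 < m)%N by case: sP => h3 _ _ _; rewrite size_tuple in h3.
have N3 : (2 < n * m)%N by rewrite (leq_trans m3) // leq_pmull.
have CW : (C * (n * m) ^ 2 <= (n * m) ^ (C + 2))%N.
  by rewrite expnD leq_mul2r ltnW ?orbT // ltn_expl //; lia.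
have [||||t [s [ex1 ht hs]]] := h n0 sP.
- by rewrite /C; nia.
- exact: CW.
- by apply: leq_trans CW; rewrite /C; nia.
- exact: up_logP.
exists t, s; split=> //.
have hl := @up_log_ln R _ (ltnW N3).
apply: (@le_trans _ _ ((A * ((n * m) ^ 2 * (up_log 2 (32 * (n * m))).+1))%N%:R)); first by rewrite ler_nat.
rewrite mulnA natrM; apply: (@le_trans _ _ ((A * (n * m) ^ 2)%N%:R * (16 * ln (n * m)%N%:R))).
  by rewrite ler_wpM2l.
have l0 : 0 <= ln ((n * m)%N%:R : R) by apply: ln_ge0; rewrite ler1n; lia.
rewrite mulrA ler_wpM2r // -!natrM ler_nat /C; lia.
Qed.
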